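(* If $\mathcal M$ is a minimal time-like surface of general type in $\mathbb R^4_2$, then it admits locally canonical coordinates (i.e. every point of $\mathcal M$ has a neighborhood in which canonical coordinates exist).
   Context: All maps are smooth and domains are open and connected. $\mathbb R^4_2$ is $\mathbb R^4$ with scalar product $a\cdot b=-a_1b_1+a_2b_2-a_3b_3+a_4b_4$; $a^2=a\cdot a$. Double numbers: $\mathbb D=\{t=u+\mathrm jv:u,v\in\mathbb R\}$, $\mathrm j^2=1$, $\bar t=u-\mathrm jv$, $|t|^2=t\bar t=u^2-v^2$; $\mathbb D_0=\{t:|t|^2=0\}$; $\mathbb D_+=\{t:|t|^2>0,\ \mathrm{Re}\,t>0\}$; $\frac{\partial}{\partial t}=\frac12(\frac{\partial}{\partial u}+\mathrm j\frac{\partial}{\partial v})$. $\mathbb D^4_2$ is $\mathbb D^4$ with the $\mathbb D$-bilinear extension of the scalar product. A time-like surface $\mathcal M=(\mathcal D,x)$ is an immersion $x:\mathcal D\to\mathbb R^4_2$, $\mathcal D\subset\mathbb R^2$, whose induced scalar product on tangent planes is indefinite (signature $(1,1)$). Coordinates $(u,v)$ are isothermal if $x_u^2=-x_v^2$ and $x_u\cdot x_v=0$; always with $E=x_u^2<0$ (by a standard fact they exist near every point). The surface is minimal if $\frac12(-\sigma(X_1,X_1)+\sigma(X_2,X_2))=0$, where $\sigma$ is the second fundamental form and $(X_1,X_2)$ is an orthonormal tangent frame with $X_1^2=-1$, $X_2^2=1$. For isothermal $t=u+\mathrm jv$ put $\Phi=x_u+\mathrm jx_v$ and $\Phi'=\partial\Phi/\partial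 t$; $\Phi'^\bot$ is the projection of $\Phi'$ to the complexified normal space (the $\mathbb D$-span of the normal space), along the complexified tangent space, and ${\Phi'^\bot}^2=\Phi'^\bot\cdot\Phi'^\bot\in\mathbb D$. A minimal time-like surface is of general type if ${\Phi'^\bot}^2\notin\mathbb D_0$ at every point; it is of the first type if ${\Phi'^\bot}^2\in\mathbb D_+$, of the second type if $-{\Phi'^\bot}^2\in\mathbb D_+$, of the third type if $\pm\mathrm j{\Phi'^\bot}^2\in\mathbb D_+$ (i.e. $|{\Phi'^\bot}^2|^2<0$); these notions are independent of the isothermal coordinates. Isothermal coordinates with $E<0$ are canonical if ${\Phi'^\bot}^2=\varepsilon$, where $\varepsilon=1,-1,\mathrm j$ for surfaces of the first, second, third type, respectively. *)

(* Defs.v *)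
From Stdlib Require Import Reals Lra.
From Coquelicot Require Import Coquelicot.
Open Scope R_scope.

(** * Double numbers *)

Record dnum := Dn { dre : R; dim : R }.

Definition RtoD (a : R) : dnum := Dn a 0.
Definition dj : dnum := Dn 0 1.
Definition dadd (s t : dnum) : dnum := Dn (dre s + dre t) (dim s + dim t).
Definition dopp (t : dnum) : dnum := Dn (- dre t) (- dim t).
Definition dmul (s t : dnum) : dnum :=
  Dn (dre s * dre t + dim s * dim t) (dre s * dim t + dim s * dre t).
Definition dconj (t : dnum) : dnum := Dn (dre t) (- dim t).

Declare Scope dnum_scope.
Delimit Scope dnum_scope with DN.
Bind Scope dnum_scope with dnum.
Infix "+" := dadd : dnum_scope.
Infix "*" := dmul : dnum_scope.
Notation "- t" := (dopp t) : dnum_scope.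

Definition dnorm2 (t : dnum) : R := dre t ^ 2 - dim t ^ 2.

Lemma dnorm2_conj (t : dnum) : (t * dconj t)%DN = RtoD (dnorm2 t).
Proof.
  destruct t as [u v]; unfold dmul, dconj, RtoD, dnorm2; simpl; f_equal; ring.
Qed.

Definition D_zero (t : dnum) : Prop := dnorm2 t = 0.
Definition D_plus (t : dnum) : Prop := 0 < dnorm2 t /\ 0 < dre t.

(** * The spaces R^4_2 and D^4_2 *)

Inductive idx := i1 | i2 | i3 | i4.

Definition vec (A : Type) := idx -> A.

Definition dot (a b : vec R) : R :=
  - (a i1 * b i1) + a i2 * b i2 - a i3 * b i3 + a i4 * b i4.

Definition ddot (a b : vec dnum) : dnum :=
  (- (a i1 * b i1) + a i2 * b i2 + - (a i3 * b i3) + a i4 * b i4)%DN.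

(** * Domains and smooth maps of the plane *)

Definition connected (S : R * R -> Prop) : Prop :=
  forall A B : R * R -> Prop, open A -> open B ->
    (forall p, S p -> A p \/ B p) ->
    (exists p, S p /\ A p) -> (exists p, S p /\ B p) ->
    exists p, S p /\ A p /\ B p.

Definition domain (S : R * R -> Prop) : Prop := open S /\ connected S.

(* [ex_diff_n f n u v] only asserts continuity of the partial derivatives of
   order at most [n] at the single point [(u, v)]; required at all points of
   an open set and for all [n], it says that [f] is smooth there. *)
Definition smooth_on (S : R * R -> Prop) (f : R * R -> R) : Prop :=
  forall n p, S p -> ex_diff_n (fun u v => f (u, v)) n (fst p) (snd p).

Definition partial_u (f : R * R -> R) (p : R * R) : R :=
  Derive (fun u => f (u, snd p)) (fst p).
Definition partial_v (f : R * R -> R) (p : R * R) : R :=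
  Derive (fun v => f (fst p, v)) (snd p).

Definition vec_u (x : R * R -> vec R) (p : R * R) : vec R :=
  fun i => partial_u (fun q => x q i) p.
Definition vec_v (x : R * R -> vec R) (p : R * R) : vec R :=
  fun i => partial_v (fun q => x q i) p.

Definition differential (x : R * R -> vec R) (p a : R * R) : vec R :=
  fun i => fst a * vec_u x p i + snd a * vec_v x p i.

(** * Surfaces *)

Definition immersion (S : R * R -> Prop) (x : R * R -> vec R) : Prop :=
  (forall i, smooth_on S (fun p => x p i)) /\
  (forall p, S p -> forall a : R * R,
     (forall i, differential x p a i = 0) -> a = (0, 0)).

(* Tangent vectors are given by their coefficients in the basis
   [(x_u, x_v)], i.e. as images of vectors of the plane. *)
Definition timelike_surface (S : R * R -> Prop) (x : R * R -> vec R) : Prop :=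
  domain S /\ immersion S x /\
  forall p, S p ->
    (exists a, dot (differential x p a) (differential x p a) < 0) /\
    (exists b, 0 < dot (differential x p b) (differential x p b)).

Definition gram_det (x : R * R -> vec R) (p : R * R) : R :=
  dot (vec_u x p) (vec_u x p) * dot (vec_v x p) (vec_v x p)
  - dot (vec_u x p) (vec_v x p) ^ 2.

(* Coefficients on [x_u], [x_v] of the tangential part of [w], by Cramer's
   rule for the Gram system. *)
Definition tan_u (x : R * R -> vec R) (p : R * R) (w : vec R) : R :=
  (dot (vec_v x p) (vec_v x p) * dot w (vec_u x p)
   - dot (vec_u x p) (vec_v x p) * dot w (vec_v x p)) / gram_det x p.
Definition tan_v (x : R * R -> vec R) (p : R * R) (w : vec R) : R :=
  (dot (vec_u x p) (vec_u x p) * dot w (vec_v x p)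
   - dot (vec_u x p) (vec_v x p) * dot w (vec_u x p)) / gram_det x p.

Definition normal_part (x : R * R -> vec R) (p : R * R) (w : vec R) : vec R :=
  fun i => w i - differential x p (tan_u x p w, tan_v x p w) i.

Lemma normal_part_decomp x p w i :
  w i = normal_part x p w i + differential x p (tan_u x p w, tan_v x p w) i.
Proof. unfold normal_part; ring. Qed.

Lemma normal_part_orth x p w :
  gram_det x p <> 0 ->
  dot (normal_part x p w) (vec_u x p) = 0 /\
  dot (normal_part x p w) (vec_v x p) = 0.
Proof.
  unfold normal_part, differential, tan_u, tan_v; cbn [fst snd].
  intros H; split.
  - transitivity (dot w (vec_u x p)
      - (dot (vec_v x p) (vec_v x p) * dot w (vec_u x p)
         - dot (vec_u x p) (vec_v x p) * dot w (vec_v x p)) / gram_det x p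
        * dot (vec_u x p) (vec_u x p)
      - (dot (vec_u x p) (vec_u x p) * dot w (vec_v x p)
         - dot (vec_u x p) (vec_v x p) * dot w (vec_u x p)) / gram_det x p
        * dot (vec_u x p) (vec_v x p)).
    + set (k := (_ / _)); set (l := (_ / _)); unfold dot; ring.
    + revert H; unfold gram_det; intros H; field; exact H.
  - transitivity (dot w (vec_v x p)
      - (dot (vec_v x p) (vec_v x p) * dot w (vec_u x p)
         - dot (vec_u x p) (vec_v x p) * dot w (vec_v x p)) / gram_det x p
        * dot (vec_u x p) (vec_v x p)
      - (dot (vec_u x p) (vec_u x p) * dot w (vec_v x p)
         - dot (vec_u x p) (vec_v x p) * dot w (vec_u x p)) / gram_det x p
        * dot (vec_v x p) (vec_v x p)).
    + set (k := (_ / _)); set (l := (_ / _)); unfold dot; ring.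
    + revert H; unfold gram_det; intros H; field; exact H.
Qed.

(* [sigma (X, Y)] is the normal part of the derivative along [X] of an
   extension of [Y] to a tangent field; the extension used has constant
   coefficients [b]. *)
Definition second_form (x : R * R -> vec R) (p a b : R * R) : vec R :=
  normal_part x p (differential (fun q => differential x q b) p a).

Definition minimal (S : R * R -> Prop) (x : R * R -> vec R) : Prop :=
  forall p, S p -> forall a b : R * R,
    dot (differential x p a) (differential x p a) = -1 ->
    dot (differential x p b) (differential x p b) = 1 ->
    dot (differential x p a) (differential x p b) = 0 ->
    forall i, / 2 * (- second_form x p a a i + second_form x p b b i) = 0.

(** * Local coordinates *)

Definition smooth_map (S : R * R -> Prop) (f : R * R -> R * R) : Prop :=
  smooth_on S (fun p => fst (f p)) /\ smooth_on S (fun p => snd (f p)).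

(* [phi : V -> U] is the inverse of a chart on the part [U] of [S]; the surface
   in the new coordinates is [x o phi]. *)
Definition local_coords (S U V : R * R -> Prop) (phi : R * R -> R * R) : Prop :=
  domain U /\ domain V /\ (forall p, U p -> S p) /\
  smooth_map V phi /\ (forall t, V t -> U (phi t)) /\
  exists psi : R * R -> R * R,
    smooth_map U psi /\ (forall p, U p -> V (psi p)) /\
    (forall t, V t -> psi (phi t) = t) /\
    (forall p, U p -> phi (psi p) = p).

Definition reparam (x : R * R -> vec R) (phi : R * R -> R * R) :
  R * R -> vec R := fun t => x (phi t).

Definition isothermal (V : R * R -> Prop) (y : R * R -> vec R) : Prop :=
  forall t, V t ->
    dot (vec_u y t) (vec_u y t) = - dot (vec_v y t) (vec_v y t) /\
    dot (vec_u y t) (vec_v y t) = 0 /\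
    dot (vec_u y t) (vec_u y t) < 0.

(** * The function Phi *)

Definition d_dt (f : R * R -> dnum) (t : R * R) : dnum :=
  (RtoD (/ 2) *
   (Dn (partial_u (fun s => dre (f s)) t) (partial_u (fun s => dim (f s)) t)
    + dj * Dn (partial_v (fun s => dre (f s)) t)
              (partial_v (fun s => dim (f s)) t)))%DN.

Definition Phi (y : R * R -> vec R) (t : R * R) : vec dnum :=
  fun i => (RtoD (vec_u y t i) + dj * RtoD (vec_v y t i))%DN.

Definition Phi' (y : R * R -> vec R) (t : R * R) : vec dnum :=
  fun i => d_dt (fun s => Phi y s i) t.

(* The projection to the complexified normal space along the complexified
   tangent space is the D-linear extension of the real one. *)
Definition dnormal_part (y : R * R -> vec R) (t : R * R) (w : vec dnum) :
  vec dnum :=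
  fun i => Dn (normal_part y t (fun k => dre (w k)) i)
              (normal_part y t (fun k => dim (w k)) i).

Lemma dnormal_part_decomp y t w :
  exists alpha beta : dnum, forall i,
    w i = (dnormal_part y t w i
           + (alpha * RtoD (vec_u y t i) + beta * RtoD (vec_v y t i)))%DN.
Proof.
  exists (Dn (tan_u y t (fun k => dre (w k))) (tan_u y t (fun k => dim (w k)))).
  exists (Dn (tan_v y t (fun k => dre (w k))) (tan_v y t (fun k => dim (w k)))).
  intros i; destruct (w i) as [a b] eqn:Hw.
  unfold dnormal_part, normal_part, differential, dadd, dmul, RtoD; simpl.
  rewrite Hw; simpl; f_equal; ring.
Qed.

Definition Phi'_perp_sq (y : R * R -> vec R) (t : R * R) : dnum :=
  ddot (dnormal_part y t (Phi' y t)) (dnormal_part y t (Phi' y t)).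

(* [P] holds for the values of [Phi'_perp_sq] at all points of the surface, in
   all isothermal coordinates. *)
Definition Phi'_perp_sq_in (S : R * R -> Prop) (x : R * R -> vec R)
  (P : dnum -> Prop) : Prop :=
  forall U V phi, local_coords S U V phi -> isothermal V (reparam x phi) ->
    forall t, V t -> P (Phi'_perp_sq (reparam x phi) t).

Definition general_type S x : Prop :=
  Phi'_perp_sq_in S x (fun w => ~ D_zero w).
Definition first_type S x : Prop :=
  Phi'_perp_sq_in S x (fun w => D_plus w).
Definition second_type S x : Prop :=
  Phi'_perp_sq_in S x (fun w => D_plus (- w)%DN).
Definition third_type S x : Prop :=
  Phi'_perp_sq_in S x
    (fun w => D_plus (dj * w)%DN \/ D_plus (- (dj * w))%DN).

Definition type_sign S x (eps : dnum) : Prop :=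
  (first_type S x /\ eps = RtoD 1) \/
  (second_type S x /\ eps = RtoD (-1)) \/
  (third_type S x /\ eps = dj).

(* The type, hence [eps], is that of the whole surface [(S, x)]. *)
Definition canonical (S : R * R -> Prop) (x : R * R -> vec R)
  (V : R * R -> Prop) (phi : R * R -> R * R) : Prop :=
  isothermal V (reparam x phi) /\
  exists eps : dnum, type_sign S x eps /\
    forall t, V t -> Phi'_perp_sq (reparam x phi) t = eps.

(* Main.v *)
From Stdlib Require Import Reals Lra Lia Ranalysis5 ClassicalEpsilon.
From Coquelicot Require Import Coquelicot.
Require Import Defs.
Open Scope R_scope.

(** In null coordinates [s = u + v], [t = u - v] a time-like surface satisfies
    [x_s^2 = x_t^2 = 0], and minimality says [x_st = 0]; so locally
    [x = a(s) + b(t)] with null curves [a], [b]. In the idempotent basis of the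
    double numbers the components of [Phi'_perp_sq] are then [4 a''^2] and
    [4 b''^2] ([separated_invariant]), the first a function of [s] alone and
    the second of [t] alone. General type means that neither vanishes. Under a
    change of parameter [s] each is multiplied by the fourth power of a
    derivative, so the primitives of [(4 |a''^2|)^(1/4)] and
    [(4 |b''^2|)^(1/4)] are new null parameters for which the components become
    [1] or [-1] ([canonical_chart]). The values [(1, 1)], [(-1, -1)], [(1, -1)]
    are the double numbers [1], [-1], [j]; the remaining case [(-1, 1)] is
    turned into [j] by exchanging [s] and [t].

    The existence of null coordinates is obtained from minimality itself. Let
    [*] be composition with the endomorphism [J] of the tangent planes whose
    eigendirections, for the eigenvalues [1] and [-1], are the null directions.
    The coordinate functions of a minimal surface are harmonic: the 1-forms
    [*dx_i] are closed ([star_closed]), hence [*dx_i = dy_i] near a given point.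
    All functions [x_i + y_i] have differentials proportional to one null
    covector, all functions [x_i - y_i] to the other one. Two of them with
    nonzero differentials are the null coordinates [s], [t], by the inverse
    function theorem, and then every [x_i + y_i] depends on [s] only and every
    [x_i - y_i] on [t] only, which is the decomposition [x = a(s) + b(t)]
    ([exists_null_chart]).

    The type of a canonical chart is that of the whole surface. Any isothermal
    chart has the same null lines as a null chart, up to order, so its invariant
    has components of the same signs ([isothermal_invariant]); the type is
    therefore locally constant, and the domain is connected
    ([type_constant]). *)

(** * Calculus of smooth functions of two variables *)

Arguments partial_u : simpl never.
Arguments partial_v : simpl never.

Definition Ck (n : nat) (S : R * R -> Prop) (f : R * R -> R) : Prop :=
  forall p, S p -> ex_diff_n (fun u v => f (u, v)) n (fst p) (snd p).

Definition cont (f : R * R -> R) (p : R * R) : Prop :=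
  continuity_2d_pt (fun u v => f (u, v)) (fst p) (snd p).

(** A relation rather than the function [Derive], which is total: a derivation
    of [dif f p a b] proves differentiability and computes both partial
    derivatives at once. *)
Definition dif (f : R * R -> R) (p : R * R) (a b : R) : Prop :=
  differentiable_pt_lim (fun u v => f (u, v)) (fst p) (snd p) a b.

Definition near (p : R * R) (P : R * R -> Prop) : Prop :=
  exists d : posreal, forall q,
    Rabs (fst q - fst p) < d -> Rabs (snd q - snd p) < d -> P q.

Lemma near_2d (p : R * R) (P : R * R -> Prop) :
  near p P <-> locally_2d (fun u v => P (u, v)) (fst p) (snd p).
Proof.
  split; intros [d H]; exists d.
  - intros u v Hu Hv; apply H; assumption.
  - intros [u v] Hu Hv; apply H; assumption.
Qed.

Lemma near_locally (p : R * R) (P : R * R -> Prop) : near p P <-> locally p P.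
Proof.
  rewrite near_2d, locally_2d_locally; destruct p as [a b]; simpl.
  split; apply filter_imp; intros [u v]; auto.
Qed.

Lemma near_imp (p : R * R) (P Q : R * R -> Prop) :
  (forall q, P q -> Q q) -> near p P -> near p Q.
Proof. intros H [d Hd]; exists d; auto. Qed.

Lemma near_and (p : R * R) (P Q : R * R -> Prop) :
  near p P -> near p Q -> near p (fun q => P q /\ Q q).
Proof. rewrite !near_locally; apply filter_and. Qed.

Lemma near_self (p : R * R) (P : R * R -> Prop) : near p P -> P p.
Proof.
  intros [d H]; apply H; rewrite Rminus_diag, Rabs_R0; apply cond_pos.
Qed.

Lemma open_near (S : R * R -> Prop) (p : R * R) : open S -> S p -> near p S.
Proof. intros H Hp; apply near_locally, H, Hp. Qed.

Lemma near_open (S : R * R -> Prop) : (forall p, S p -> near p S) -> open S.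
Proof. intros H p Hp; apply near_locally, H, Hp. Qed.

Lemma cont_near (f : R * R -> R) (p : R * R) :
  cont f p <-> forall eps : posreal, near p (fun q => Rabs (f q - f p) < eps).
Proof.
  destruct p as [a b]; split; intros H eps.
  - apply near_2d, H.
  - apply (proj1 (near_2d (a, b) (fun q => Rabs (f q - f (a, b)) < eps))), H.
Qed.

Lemma cont_pos (f : R * R -> R) (p : R * R) :
  cont f p -> 0 < f p -> near p (fun q => 0 < f q).
Proof.
  intros H Hp; apply (near_imp p (fun q => Rabs (f q - f p) < mkposreal _ Hp)).
  - intros q Hq; apply Rabs_def2 in Hq; simpl in Hq; lra.
  - apply cont_near, H.
Qed.

Lemma cont_neq0 (f : R * R -> R) (p : R * R) :
  cont f p -> f p <> 0 -> near p (fun q => f q <> 0).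
Proof.
  intros H Hp; apply near_2d; apply (continuity_2d_pt_neq_0 _ _ _ H).
  destruct p; exact Hp.
Qed.

Lemma cont_comp (f g h : R * R -> R) (p : R * R) :
  cont f (g p, h p) -> cont g p -> cont h p -> cont (fun q => f (g q, h q)) p.
Proof.
  intros Hf Hg Hh; apply cont_near; intros eps.
  destruct (proj1 (cont_near _ _) Hf eps) as [d Hd]; simpl in Hd.
  generalize (near_and _ _ _ (proj1 (cont_near _ _) Hg d)
                             (proj1 (cont_near _ _) Hh d)).
  apply near_imp; intros q [H1 H2]; apply Hd; assumption.
Qed.

Lemma cont_plus (f g : R * R -> R) (p : R * R) :
  cont f p -> cont g p -> cont (fun q => f q + g q) p.
Proof. apply (continuity_2d_pt_plus (fun u v => f (u, v)) (fun u v => g (u, v))). Qed.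

Lemma cont_mult (f g : R * R -> R) (p : R * R) :
  cont f p -> cont g p -> cont (fun q => f q * g q) p.
Proof. apply (continuity_2d_pt_mult (fun u v => f (u, v)) (fun u v => g (u, v))). Qed.

Lemma cont_const (c : R) (p : R * R) : cont (fun _ => c) p.
Proof. apply (continuity_2d_pt_const (fst p) (snd p) c). Qed.

Lemma dif_cont (f : R * R -> R) (p : R * R) (a b : R) : dif f p a b -> cont f p.
Proof. intros H; apply differentiable_continuity_pt; exists a, b; exact H. Qed.

Lemma dif_unique (f : R * R -> R) (p : R * R) (a b : R) :
  dif f p a b -> partial_u f p = a /\ partial_v f p = b.
Proof. apply differentiable_pt_lim_unique. Qed.

Lemma dif_agree (f : R * R -> R) (p : R * R) (a b a' b' : R) :
  dif f p a b -> dif f p a' b' -> a = a' /\ b = b'.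
Proof.
  intros H H'; destruct (dif_unique _ _ _ _ H) as [<- <-].
  apply (dif_unique _ _ _ _ H').
Qed.

Lemma dif_ext (f g : R * R -> R) (p : R * R) (a b : R) :
  near p (fun q => f q = g q) -> dif f p a b -> dif g p a b.
Proof. intros H; apply differentiable_pt_lim_ext, (near_2d p (fun q => f q = g q)), H. Qed.

Lemma dif_of_partials (f : R * R -> R) (p : R * R) (a : R * R -> R) (b : R) :
  near p (fun q => is_derive (fun u => f (u, snd q)) (fst q) (a q)) ->
  is_derive (fun v => f (fst p, v)) (snd p) b -> cont a p ->
  dif f p (a p) b.
Proof.
  destruct p as [u0 v0]; intros Hu Hv Ha.
  apply filterdiff_differentiable_pt_lim.
  assert (H := is_derive_filterdiff (fun u v => f (u, v)) u0 v0 (fun u v => a (u, v)) b).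
  apply H.
  - apply near_locally in Hu; revert Hu; apply filter_imp; intros [u v]; auto.
  - exact Hv.
  - apply continuity_2d_pt_filterlim in Ha; exact Ha.
Qed.

Lemma dif_is_derive_u (f : R * R -> R) (p : R * R) (a b : R) :
  dif f p a b -> is_derive (fun u => f (u, snd p)) (fst p) a.
Proof.
  intros H; apply is_derive_Reals.
  replace a with (a * 1 + b * 0) by ring.
  apply (derivable_pt_lim_comp_2d (fun u v => f (u, v)) (fun u => u) (fun _ => snd p)).
  - exact H.
  - apply derivable_pt_lim_id.
  - apply derivable_pt_lim_const.
Qed.

Lemma dif_is_derive_v (f : R * R -> R) (p : R * R) (a b : R) :
  dif f p a b -> is_derive (fun v => f (fst p, v)) (snd p) b.
Proof.
  intros H; apply is_derive_Reals.
  replace b with (a * 0 + b * 1) by ring.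
  apply (derivable_pt_lim_comp_2d (fun u v => f (u, v)) (fun _ => fst p) (fun v => v)).
  - exact H.
  - apply derivable_pt_lim_const.
  - apply derivable_pt_lim_id.
Qed.

Lemma dif_comp (f g h : R * R -> R) (p : R * R) (a b : R) a1 b1 a2 b2 :
  dif f (g p, h p) a b -> dif g p a1 b1 -> dif h p a2 b2 ->
  dif (fun q => f (g q, h q)) p (a * a1 + b * a2) (a * b1 + b * b2).
Proof.
  destruct p as [u v]; intros Hf Hg Hh.
  apply (differentiable_pt_lim_comp (fun u v => f (u, v))
           (fun u v => g (u, v)) (fun u v => h (u, v))); assumption.
Qed.

Lemma dif_eq (f : R * R -> R) (p : R * R) (a b : R) a' b' : dif f p a b -> a = a' -> b = b' -> dif f p a' b'.
Proof. intros H <- <-; exact H. Qed.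

Lemma dif_comp1 (f : R -> R) (g : R * R -> R) (p : R * R) l (a b : R) :
  is_derive f (g p) l -> dif g p a b -> dif (fun q => f (g q)) p (l * a) (l * b).
Proof.
  intros Hf Hg.
  apply (dif_eq _ _ (l * a + 0 * a) (l * b + 0 * b)); try ring.
  apply (dif_comp (fun r => f (fst r)) g g); try assumption.
  apply (differentiable_pt_lim_proj1_0 f (g p) (g p) l), is_derive_Reals, Hf.
Qed.

Lemma dif_const (c : R) (p : R * R) : dif (fun _ => c) p 0 0.
Proof.
  apply (dif_of_partials (fun _ => c) p (fun _ => 0)).
  - exists (mkposreal 1 Rlt_0_1); intros q _ _.
    apply (is_derive_const (V := R_NormedModule)).
  - apply (is_derive_const (V := R_NormedModule)).
  - apply cont_const.
Qed.

Lemma dif_fst (p : R * R) : dif (fun q => fst q) p 1 0.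
Proof. apply (differentiable_pt_lim_proj1_0 (fun u => u) (fst p) (snd p) 1), derivable_pt_lim_id. Qed.

Lemma dif_snd (p : R * R) : dif (fun q => snd q) p 0 1.
Proof.
  apply (dif_of_partials (fun q => snd q) p (fun _ => 0)).
  - exists (mkposreal 1 Rlt_0_1); intros q _ _; simpl.
    apply (is_derive_const (V := R_NormedModule)).
  - apply (is_derive_id (K := R_AbsRing)).
  - apply cont_const.
Qed.

Lemma dif_plus (f g : R * R -> R) (p : R * R) (a b c d : R) :
  dif f p a b -> dif g p c d -> dif (fun q => f q + g q) p (a + c) (b + d).
Proof.
  intros Hf Hg.
  apply (dif_eq _ _ (1 * a + 1 * c) (1 * b + 1 * d)); try ring.
  apply (dif_comp (fun r => fst r + snd r) f g); try assumption.
  apply (dif_of_partials (fun r => fst r + snd r) (f p, g p) (fun _ => 1)).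
  - exists (mkposreal 1 Rlt_0_1); intros q _ _; simpl; auto_derive; auto.
  - simpl; auto_derive; auto.
  - apply cont_const.
Qed.

Lemma dif_mult (f g : R * R -> R) (p : R * R) (a b c d : R) :
  dif f p a b -> dif g p c d ->
  dif (fun q => f q * g q) p (a * g p + f p * c) (b * g p + f p * d).
Proof.
  intros Hf Hg.
  apply (dif_eq _ _ (g p * a + f p * c) (g p * b + f p * d)); try ring.
  apply (dif_comp (fun r => fst r * snd r) f g); try assumption.
  apply (dif_of_partials (fun r => fst r * snd r) (f p, g p) (fun r => snd r)).
  - exists (mkposreal 1 Rlt_0_1); intros q _ _; simpl; auto_derive; auto; ring.
  - simpl; auto_derive; auto; ring.
  - apply (dif_cont _ _ 0 1), dif_snd.
Qed.

Lemma dif_scal (c : R) (f : R * R -> R) (p : R * R) (a b : R) :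
  dif f p a b -> dif (fun q => c * f q) p (c * a) (c * b).
Proof.
  intros H; eapply dif_eq.
  - apply (dif_mult _ _ _ _ _ _ _ (dif_const c p) H).
  - simpl; ring.
  - simpl; ring.
Qed.

Lemma dif_opp (f : R * R -> R) (p : R * R) (a b : R) :
  dif f p a b -> dif (fun q => - f q) p (- a) (- b).
Proof.
  intros H; apply (dif_ext (fun q => -1 * f q)).
  - exists (mkposreal 1 Rlt_0_1); intros; ring.
  - eapply dif_eq; [apply (dif_scal (-1) _ _ _ _ H) | ring | ring].
Qed.

Lemma dif_minus (f g : R * R -> R) (p : R * R) (a b c d : R) :
  dif f p a b -> dif g p c d -> dif (fun q => f q - g q) p (a - c) (b - d).
Proof. intros Hf Hg; apply (dif_plus _ _ _ _ _ _ _ Hf (dif_opp _ _ _ _ Hg)). Qed.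

Lemma dif_inv (f : R * R -> R) (p : R * R) (a b : R) : f p <> 0 -> dif f p a b ->
  dif (fun q => / f q) p (- (/ f p * / f p) * a) (- (/ f p * / f p) * b).
Proof.
  intros H0 H; apply (dif_comp1 Rinv); [| exact H].
  auto_derive; [exact H0 | field; exact H0].
Qed.

Lemma dif_sqrt (f : R * R -> R) (p : R * R) (a b : R) : 0 < f p -> dif f p a b ->
  dif (fun q => sqrt (f q)) p (/ 2 * / sqrt (f p) * a) (/ 2 * / sqrt (f p) * b).
Proof.
  intros H0 H; apply (dif_comp1 sqrt); [| exact H].
  auto_derive; [exact H0 |].
  assert (sqrt (f p) <> 0) by (apply Rgt_not_eq, sqrt_lt_R0, H0).
  field; assumption.
Qed.

(** ** Classes [C^k] on open sets *)

Lemma Ck_cont (n : nat) (S : R * R -> Prop) (f : R * R -> R) (p : R * R) :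
  Ck n S f -> S p -> cont f p.
Proof. intros H Hp; specialize (H p Hp); destruct n; apply H. Qed.

Lemma Ck_O (S : R * R -> Prop) (f : R * R -> R) : (forall p, S p -> cont f p) -> Ck 0 S f.
Proof. intros H p Hp; split; [apply H, Hp | exact I]. Qed.

Lemma Ck_ext (n : nat) (S : R * R -> Prop) (f g : R * R -> R) :
  open S -> (forall p, S p -> f p = g p) -> Ck n S f -> Ck n S g.
Proof.
  intros HS H Hf p Hp; generalize (Hf p Hp); apply ex_diff_n_ext_loc.
  apply (near_2d p (fun q => f q = g q)).
  apply (near_imp p S); [exact H | apply open_near; assumption].
Qed.

Lemma Ck_sub (n : nat) (S T : R * R -> Prop) (f : R * R -> R) :
  (forall p, T p -> S p) -> Ck n S f -> Ck n T f.
Proof. intros H Hf p Hp; apply Hf, H, Hp. Qed.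

(** The induction step of all smoothness proofs below: a function is of class
    [C^(n+1)] once its partial derivatives are given by expressions of class
    [C^n]. *)
Lemma Ck_S_intro (n : nat) (S : R * R -> Prop) (f : R * R -> R) a b : open S ->
  (forall p, S p -> dif f p (a p) (b p)) -> Ck n S a -> Ck n S b ->
  Ck (Datatypes.S n) S f.
Proof.
  intros HS Hd Ha Hb p Hp; split; [apply (dif_cont _ _ _ _ (Hd p Hp)) |].
  repeat split.
  - exists (a p); apply (dif_is_derive_u _ _ _ _ (Hd p Hp)).
  - exists (b p); apply (dif_is_derive_v _ _ _ _ (Hd p Hp)).
  - apply (Ck_ext n S a (partial_u f)); try assumption.
    intros q Hq; symmetry; apply (dif_unique _ _ _ _ (Hd q Hq)).
  - apply (Ck_ext n S b (partial_v f)); try assumption.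
    intros q Hq; symmetry; apply (dif_unique _ _ _ _ (Hd q Hq)).
Qed.

Lemma Ck_S_elim (n : nat) (S : R * R -> Prop) (f : R * R -> R) :
  open S -> Ck (Datatypes.S n) S f ->
  (forall p, S p -> dif f p (partial_u f p) (partial_v f p)) /\
  Ck n S (partial_u f) /\ Ck n S (partial_v f).
Proof.
  intros HS H.
  assert (Hu : Ck n S (partial_u f)) by (intros p Hp; apply (H p Hp)).
  assert (Hv : Ck n S (partial_v f)) by (intros p Hp; apply (H p Hp)).
  split; [| split; assumption].
  intros p Hp; apply dif_of_partials.
  - apply (near_imp p S); [| apply open_near; assumption].
    intros q Hq; apply (Derive_correct (fun u => f (u, snd q))), (H q Hq).
  - apply (Derive_correct (fun v => f (fst p, v))), (H p Hp).
  - apply (Ck_cont n S); assumption.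
Qed.

Lemma Ck_pred (n : nat) (S : R * R -> Prop) (f : R * R -> R) :
  Ck (Datatypes.S n) S f -> Ck n S f.
Proof. intros H p Hp; apply (ex_diff_n_m (Datatypes.S n)), H, Hp; lia. Qed.

Lemma Ck_const (n : nat) (S : R * R -> Prop) (c : R) : open S -> Ck n S (fun _ => c).
Proof.
  intros HS; revert c; induction n as [| n IH]; intros c.
  - apply Ck_O; intros; apply cont_const.
  - apply (Ck_S_intro n S _ (fun _ => 0) (fun _ => 0)); auto.
    intros p _; apply dif_const.
Qed.

Lemma Ck_plus (n : nat) (S : R * R -> Prop) (f g : R * R -> R) :
  open S -> Ck n S f -> Ck n S g ->
  Ck n S (fun p => f p + g p).
Proof.
  intros HS; revert f g; induction n as [| n IH]; intros f g Hf Hg.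
  - apply Ck_O; intros p Hp; apply cont_plus; eapply Ck_cont; eauto.
  - destruct (Ck_S_elim n S f HS Hf) as [Df [Hfu Hfv]].
    destruct (Ck_S_elim n S g HS Hg) as [Dg [Hgu Hgv]].
    eapply Ck_S_intro; [exact HS | | exact (IH _ _ Hfu Hgu) | exact (IH _ _ Hfv Hgv)].
    intros p Hp; apply dif_plus; auto.
Qed.

Lemma Ck_mult (n : nat) (S : R * R -> Prop) (f g : R * R -> R) :
  open S -> Ck n S f -> Ck n S g ->
  Ck n S (fun p => f p * g p).
Proof.
  intros HS; revert f g; induction n as [| n IH]; intros f g Hf Hg.
  - apply Ck_O; intros p Hp; apply cont_mult; eapply Ck_cont; eauto.
  - destruct (Ck_S_elim n S f HS Hf) as [Df [Hfu Hfv]].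
    destruct (Ck_S_elim n S g HS Hg) as [Dg [Hgu Hgv]].
    apply Ck_pred in Hf; apply Ck_pred in Hg.
    eapply Ck_S_intro;
      [exact HS | | exact (Ck_plus _ _ _ _ HS (IH _ _ Hfu Hg) (IH _ _ Hf Hgu))
       | exact (Ck_plus _ _ _ _ HS (IH _ _ Hfv Hg) (IH _ _ Hf Hgv))].
    intros p Hp; apply dif_mult; auto.
Qed.

Lemma Ck_comp (n : nat) (S V : R * R -> Prop) (f g h : R * R -> R) : open S -> open V ->
  (forall p, V p -> S (g p, h p)) -> Ck n S f -> Ck n V g -> Ck n V h ->
  Ck n V (fun p => f (g p, h p)).
Proof.
  intros HS HV HVS; revert f g h HVS; induction n as [| n IH]; intros f g h HVS Hf Hg Hh.
  - apply Ck_O; intros p Hp; apply cont_comp; eapply Ck_cont; eauto.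
  - destruct (Ck_S_elim n S f HS Hf) as [Df [Hfu Hfv]].
    destruct (Ck_S_elim n V g HV Hg) as [Dg [Hgu Hgv]].
    destruct (Ck_S_elim n V h HV Hh) as [Dh [Hhu Hhv]].
    apply Ck_pred in Hf; apply Ck_pred in Hg; apply Ck_pred in Hh.
    assert (Hcu := IH _ _ _ HVS Hfu Hg Hh).
    assert (Hcv := IH _ _ _ HVS Hfv Hg Hh).
    eapply Ck_S_intro; [exact HV | |
      exact (Ck_plus _ _ _ _ HV (Ck_mult _ _ _ _ HV Hcu Hgu) (Ck_mult _ _ _ _ HV Hcv Hhu)) |
      exact (Ck_plus _ _ _ _ HV (Ck_mult _ _ _ _ HV Hcu Hgv) (Ck_mult _ _ _ _ HV Hcv Hhv))].
    intros p Hp; apply (dif_comp f g h); auto.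
Qed.

Lemma Ck_inv (n : nat) (S : R * R -> Prop) (f : R * R -> R) :
  open S -> (forall p, S p -> f p <> 0) -> Ck n S f ->
  Ck n S (fun p => / f p).
Proof.
  intros HS H0; induction n as [| n IH]; intros Hf.
  - apply Ck_O; intros p Hp; apply continuity_2d_pt_inv.
    + eapply Ck_cont; eauto.
    + destruct p; apply H0, Hp.
  - destruct (Ck_S_elim n S f HS Hf) as [Df [Hfu Hfv]].
    apply Ck_pred in Hf; specialize (IH Hf).
    assert (H2 : Ck n S (fun p => - (/ f p * / f p))).
    { apply (Ck_ext n S (fun p => -1 * (/ f p * / f p))); [exact HS | intros; ring |].
      apply Ck_mult; [exact HS | apply Ck_const, HS | apply Ck_mult; assumption]. }
    eapply Ck_S_intro; [exact HS | |
      exact (Ck_mult _ _ _ _ HS H2 Hfu) | exact (Ck_mult _ _ _ _ HS H2 Hfv)].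
    intros p Hp; apply dif_inv; auto.
Qed.

Lemma Ck_sqrt (n : nat) (S : R * R -> Prop) (f : R * R -> R) :
  open S -> (forall p, S p -> 0 < f p) -> Ck n S f ->
  Ck n S (fun p => sqrt (f p)).
Proof.
  intros HS H0; induction n as [| n IH]; intros Hf.
  - apply Ck_O; intros p Hp; apply (continuity_1d_2d_pt_comp sqrt).
    + apply continuity_pt_sqrt; destruct p; left; apply H0, Hp.
    + apply (Ck_cont 0 S f p Hf Hp).
  - destruct (Ck_S_elim n S f HS Hf) as [Df [Hfu Hfv]].
    apply Ck_pred in Hf; specialize (IH Hf).
    assert (H2 : Ck n S (fun p => / 2 * / sqrt (f p))).
    { apply Ck_mult; [exact HS | apply Ck_const, HS | apply Ck_inv; try assumption].
      intros p Hp; apply Rgt_not_eq, sqrt_lt_R0, H0, Hp. }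
    eapply Ck_S_intro; [exact HS | |
      exact (Ck_mult _ _ _ _ HS H2 Hfu) | exact (Ck_mult _ _ _ _ HS H2 Hfv)].
    intros p Hp; apply dif_sqrt; auto.
Qed.

(** ** Smooth functions *)

Lemma smooth_cont (S : R * R -> Prop) (f : R * R -> R) (p : R * R) :
  smooth_on S f -> S p -> cont f p.
Proof. intros H; apply (Ck_cont 0 S f p (H 0%nat)). Qed.

Lemma smooth_dif (S : R * R -> Prop) (f : R * R -> R) (p : R * R) :
  open S -> smooth_on S f -> S p ->
  dif f p (partial_u f p) (partial_v f p).
Proof. intros HS H; apply (Ck_S_elim 0 S f HS (H 1%nat)). Qed.

Lemma smooth_partial_u (S : R * R -> Prop) (f : R * R -> R) :
  open S -> smooth_on S f -> smooth_on S (partial_u f).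
Proof. intros HS H n; apply (Ck_S_elim n S f HS (H (Datatypes.S n))). Qed.

Lemma smooth_partial_v (S : R * R -> Prop) (f : R * R -> R) :
  open S -> smooth_on S f -> smooth_on S (partial_v f).
Proof. intros HS H n; apply (Ck_S_elim n S f HS (H (Datatypes.S n))). Qed.

Lemma smooth_intro (S : R * R -> Prop) (f : R * R -> R) a b : open S ->
  (forall p, S p -> dif f p (a p) (b p)) -> smooth_on S a -> smooth_on S b ->
  smooth_on S f.
Proof.
  intros HS Hd Ha Hb [| n].
  - apply Ck_O; intros p Hp; apply (dif_cont _ _ _ _ (Hd p Hp)).
  - apply (Ck_S_intro n S f a b HS Hd (Ha n) (Hb n)).
Qed.

Lemma smooth_ext (S : R * R -> Prop) (f g : R * R -> R) :
  open S -> (forall p, S p -> f p = g p) ->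
  smooth_on S f -> smooth_on S g.
Proof. intros HS H Hf n; exact (Ck_ext n S f g HS H (Hf n)). Qed.

Lemma smooth_sub (S T : R * R -> Prop) (f : R * R -> R) : (forall p, T p -> S p) ->
  smooth_on S f -> smooth_on T f.
Proof. intros H Hf n; exact (Ck_sub n S T f H (Hf n)). Qed.

Lemma smooth_const (S : R * R -> Prop) (c : R) : open S -> smooth_on S (fun _ => c).
Proof. intros HS n; apply (Ck_const n S c HS). Qed.

Lemma smooth_fst (S : R * R -> Prop) : open S -> smooth_on S (fun p => fst p).
Proof.
  intros HS; apply (smooth_intro S _ (fun _ => 1) (fun _ => 0) HS).
  - intros; apply dif_fst.
  - apply smooth_const, HS.
  - apply smooth_const, HS.
Qed.

Lemma smooth_snd (S : R * R -> Prop) : open S -> smooth_on S (fun p => snd p).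
Proof.
  intros HS; apply (smooth_intro S _ (fun _ => 0) (fun _ => 1) HS).
  - intros; apply dif_snd.
  - apply smooth_const, HS.
  - apply smooth_const, HS.
Qed.

Lemma smooth_plus (S : R * R -> Prop) (f g : R * R -> R) :
  open S -> smooth_on S f -> smooth_on S g ->
  smooth_on S (fun p => f p + g p).
Proof. intros HS Hf Hg n; apply (Ck_plus n S f g HS (Hf n) (Hg n)). Qed.

Lemma smooth_mult (S : R * R -> Prop) (f g : R * R -> R) :
  open S -> smooth_on S f -> smooth_on S g ->
  smooth_on S (fun p => f p * g p).
Proof. intros HS Hf Hg n; apply (Ck_mult n S f g HS (Hf n) (Hg n)). Qed.

Lemma smooth_opp (S : R * R -> Prop) (f : R * R -> R) :
  open S -> smooth_on S f -> smooth_on S (fun p => - f p).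
Proof.
  intros HS Hf; apply (smooth_ext S (fun p => -1 * f p) _ HS).
  - intros; ring.
  - apply smooth_mult; [exact HS | apply smooth_const, HS | exact Hf].
Qed.

Lemma smooth_minus (S : R * R -> Prop) (f g : R * R -> R) :
  open S -> smooth_on S f -> smooth_on S g ->
  smooth_on S (fun p => f p - g p).
Proof. intros HS Hf Hg; apply smooth_plus, smooth_opp; assumption. Qed.

Lemma smooth_inv (S : R * R -> Prop) (f : R * R -> R) :
  open S -> (forall p, S p -> f p <> 0) -> smooth_on S f ->
  smooth_on S (fun p => / f p).
Proof. intros HS H0 Hf n; apply (Ck_inv n S f HS H0 (Hf n)). Qed.

Lemma smooth_sqrt (S : R * R -> Prop) (f : R * R -> R) :
  open S -> (forall p, S p -> 0 < f p) -> smooth_on S f ->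
  smooth_on S (fun p => sqrt (f p)).
Proof. intros HS H0 Hf n; apply (Ck_sqrt n S f HS H0 (Hf n)). Qed.

Lemma smooth_comp (S V : R * R -> Prop) (f g h : R * R -> R) : open S -> open V ->
  (forall p, V p -> S (g p, h p)) -> smooth_on S f -> smooth_on V g ->
  smooth_on V h -> smooth_on V (fun p => f (g p, h p)).
Proof.
  intros HS HV H Hf Hg Hh n; apply (Ck_comp n S V f g h HS HV H (Hf n) (Hg n) (Hh n)).
Qed.

Lemma smooth_schwarz (S : R * R -> Prop) (f : R * R -> R) (p : R * R) :
  open S -> smooth_on S f -> S p ->
  partial_v (partial_u f) p = partial_u (partial_v f) p.
Proof.
  intros HS Hf Hp; symmetry.
  assert (Hu := smooth_partial_u S f HS Hf).
  assert (Hv := smooth_partial_v S f HS Hf).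
  apply (Schwarz (fun u v => f (u, v)) (fst p) (snd p)).
  - apply (near_2d p (fun q =>
      ex_derive (fun z => f (z, snd q)) (fst q) /\
      ex_derive (fun z => f (fst q, z)) (snd q) /\
      ex_derive (fun z => partial_v f (z, snd q)) (fst q) /\
      ex_derive (fun z => partial_u f (fst q, z)) (snd q))).
    apply (near_imp p S); [| apply open_near; assumption].
    intros q Hq; repeat split.
    + exact (proj1 (proj2 (Hf 1%nat q Hq))).
    + exact (proj1 (proj2 (proj2 (Hf 1%nat q Hq)))).
    + exact (proj1 (proj2 (Hv 1%nat q Hq))).
    + exact (proj1 (proj2 (proj2 (Hu 1%nat q Hq)))).
  - apply (smooth_cont S (partial_u (partial_v f)) p); [| exact Hp].
    apply smooth_partial_u; assumption.
  - apply (smooth_cont S (partial_v (partial_u f)) p); [| exact Hp].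
    apply smooth_partial_v; assumption.
Qed.

(** * Inverse functions *)

Definition square (c : R * R) (e : R) (p : R * R) : Prop :=
  Rabs (fst p - fst c) < e /\ Rabs (snd p - snd c) < e.

Lemma square_center c e : 0 < e -> square c e c.
Proof. intros H; split; rewrite Rminus_diag, Rabs_R0; exact H. Qed.

Lemma square_sub c e e' p : e' <= e -> square c e' p -> square c e p.
Proof. unfold square; lra. Qed.

Lemma near_square (p : R * R) (P : R * R -> Prop) :
  near p P <-> exists e, 0 < e /\ forall q, square p e q -> P q.
Proof.
  split.
  - intros [d H]; exists d; split; [apply cond_pos | intros q [H1 H2]; auto].
  - intros [e [He H]]; exists (mkposreal e He); intros q H1 H2; apply H; split; assumption.
Qed.

Lemma open_strip a b (f : R * R -> R) c e :
  (forall p, dif f p a b) -> open (fun p => Rabs (f p - c) < e).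
Proof.
  intros Hf; apply near_open; intros p Hp.
  assert (H : 0 < e - Rabs (f p - c)) by lra.
  generalize (proj1 (cont_near f p) (dif_cont _ _ _ _ (Hf p)) (mkposreal _ H)).
  apply near_imp; simpl; intros q Hq.
  replace (f q - c) with ((f q - f p) + (f p - c)) by ring.
  eapply Rle_lt_trans; [apply Rabs_triang | lra].
Qed.

Lemma open_inter (A B : R * R -> Prop) : open A -> open B -> open (fun p => A p /\ B p).
Proof. apply open_and. Qed.

Lemma open_square c e : open (square c e).
Proof.
  apply open_inter.
  - apply (open_strip 1 0 (fun p => fst p)), dif_fst.
  - apply (open_strip 0 1 (fun p => snd p)), dif_snd.
Qed.

Lemma open_preimage (S A : R * R -> Prop) (f g : R * R -> R) :
  open S -> open A -> (forall p, S p -> cont f p /\ cont g p) ->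
  open (fun p => S p /\ A (f p, g p)).
Proof.
  intros HS HA H; apply near_open; intros p [Hp HAp].
  destruct (H p Hp) as [Hf Hg].
  destruct (open_near _ _ HA HAp) as [d Hd]; simpl in Hd.
  generalize (near_and _ _ _ (open_near _ _ HS Hp) (near_and _ _ _
    (proj1 (cont_near _ _) Hf d) (proj1 (cont_near _ _) Hg d))).
  apply near_imp; intros q [H1 [H2 H3]]; split; [exact H1 | apply Hd; assumption].
Qed.

(** The equation [f (g (w, v), v) = w] linearises to
    [A dg + B dv = dw]; the error term is absorbed because [A] does not
    vanish, so [g] is Lipschitz at the point before it is differentiable. *)
Lemma dif_implicit (f g : R * R -> R) (q : R * R) A B :
  dif f (g q, snd q) A B -> A <> 0 -> cont g q ->
  near q (fun r => f (g r, snd r) = fst r) ->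
  dif g q (/ A) (- B * / A).
Proof.
  intros Hf HA Hg Heq eps.
  assert (Ha : 0 < Rabs A) by (apply Rabs_pos_lt, HA).
  set (a := Rabs A) in *.
  set (K := 2 * (1 + Rabs B + a / 2) / a).
  assert (HB := Rabs_pos B).
  assert (HK : 0 < K).
  { unfold K; apply Rdiv_lt_0_compat; lra. }
  set (eta := Rmin (a / 2) (eps * a / (K + 1))).
  assert (Heta : 0 < eta).
  { unfold eta; apply Rmin_glb_lt; [lra |].
    apply Rdiv_lt_0_compat; [apply Rmult_lt_0_compat; [apply cond_pos | lra] | lra]. }
  assert (E1 : eta <= a / 2) by apply Rmin_l.
  assert (E2 : eta * (K + 1) <= eps * a).
  { apply (Rmult_le_reg_r (/ (K + 1))); [apply Rinv_0_lt_compat; lra |].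
    rewrite Rmult_assoc, Rinv_r, Rmult_1_r by lra.
    apply (Rle_trans _ _ _ (Rmin_r _ _)); right; unfold Rdiv; ring. }
  destruct (Hf (mkposreal eta Heta)) as [d Hd]; simpl in Hd.
  apply (near_2d q (fun r =>
    Rabs (g r - g (fst q, snd q) - (/ A * (fst r - fst q) + - B * / A * (snd r - snd q)))
      <= eps * Rmax (Rabs (fst r - fst q)) (Rabs (snd r - snd q)))).
  assert (Hc := proj1 (cont_near _ _) Hg d).
  assert (Hs : near q (fun r => Rabs (snd r - snd q) < d)).
  { exists d; intros r _ Hr; exact Hr. }
  assert (H0 := near_self _ _ Heq); simpl in H0.
  generalize (near_and _ _ _ Heq (near_and _ _ _ Hc Hs)).
  apply near_imp; intros r [Hr [H1 H2]].
  specialize (Hd (g r) (snd r) H1 H2).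
  rewrite Hr, H0 in Hd.
  rewrite <- surjective_pairing.
  set (x := fst r - fst q) in *; set (y := snd r - snd q) in *.
  set (z := g r - g q) in *.
  set (M := Rmax (Rabs x) (Rabs y)).
  assert (Mx : Rabs x <= M) by apply Rmax_l.
  assert (My : Rabs y <= M) by apply Rmax_r.
  assert (Hx0 := Rabs_pos x). assert (Hy0 := Rabs_pos y). assert (Hz0 := Rabs_pos z).
  assert (Hm : Rmax (Rabs z) (Rabs y) <= Rabs z + M).
  { apply Rmax_lub; lra. }
  assert (Hd2 : Rabs (x - (A * z + B * y)) <= eta * (Rabs z + M)).
  { eapply Rle_trans; [exact Hd | apply Rmult_le_compat_l; [lra | exact Hm]]. }
  assert (HzK : Rabs z <= K * M).
  { assert (T : a * Rabs z <= M + Rabs B * M + eta * (Rabs z + M)).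
    { unfold a; rewrite <- Rabs_mult.
      replace (A * z) with (x + - (B * y) + - (x - (A * z + B * y))) by ring.
      eapply Rle_trans; [apply Rabs_triang |].
      rewrite Rabs_Ropp; apply Rplus_le_compat; [| exact Hd2].
      eapply Rle_trans; [apply Rabs_triang |].
      rewrite Rabs_Ropp, Rabs_mult; apply Rplus_le_compat; [exact Mx |].
      apply Rmult_le_compat_l; assumption. }
    assert (T2 : eta * (Rabs z + M) <= a / 2 * (Rabs z + M)) by
      (apply Rmult_le_compat_r; lra).
    assert (HaK : a * K = 2 * (1 + Rabs B + a / 2)) by (unfold K; field; lra).
    apply (Rmult_le_reg_l a); [exact Ha |].
    rewrite <- Rmult_assoc, HaK; lra. }
  replace (z - (/ A * x + - B * / A * y)) with (- (x - (A * z + B * y)) * / A)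
    by (field; exact HA).
  rewrite Rabs_mult, Rabs_Ropp, Rabs_inv; fold a.
  apply (Rmult_le_reg_r a); [exact Ha |].
  rewrite Rmult_assoc, Rinv_l, Rmult_1_r by lra.
  eapply Rle_trans; [exact Hd2 |].
  apply (Rle_trans _ (eta * ((K + 1) * M))).
  - apply Rmult_le_compat_l; lra.
  - rewrite <- Rmult_assoc. replace (eps * M * a) with (eps * a * M) by ring.
    apply Rmult_le_compat_r; lra.
Qed.

Lemma increasing_u (f : R * R -> R) v (a b : R) :
  (forall u, a < u < b -> dif f (u, v) (partial_u f (u, v)) (partial_v f (u, v))) ->
  (forall u, a < u < b -> 0 < partial_u f (u, v)) ->
  forall u1 u2, a < u1 -> u1 < u2 -> u2 < b -> f (u1, v) < f (u2, v).
Proof.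
  intros Hd Hp u1 u2 H1 H12 H2.
  apply (incr_function (fun u => f (u, v)) a b (fun u => partial_u f (u, v))).
  - intros u Ha Hb; simpl in *; apply (dif_is_derive_u f (u, v) _ _ (Hd u (conj Ha Hb))).
  - intros u Ha Hb; simpl in *; apply Hp; split; assumption.
  - exact H1.
  - exact H12.
  - exact H2.
Qed.

(** The equation [f (u, v) = w] is solved for [u] near [p0] by [u = g (w, v)];
    [d] bounds the range in which the solution is unique. *)
Definition implicit_solution (S : R * R -> Prop) (f : R * R -> R) (p0 : R * R)
  (d e : R) (g : R * R -> R) : Prop :=
  0 < d /\ 0 < e /\
  (forall u v, Rabs (u - fst p0) < d -> Rabs (v - snd p0) < e -> S (u, v)) /\
  (forall q, square (f p0, snd p0) e q ->
     Rabs (g q - fst p0) < d /\ f (g q, snd q) = fst q) /\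
  (forall u v, Rabs (u - fst p0) < d -> square (f p0, snd p0) e (f (u, v), v) ->
     g (f (u, v), v) = u) /\
  (forall q, square (f p0, snd p0) e q -> partial_u f (g q, snd q) <> 0 /\
     dif g q (/ partial_u f (g q, snd q))
       (- partial_v f (g q, snd q) * / partial_u f (g q, snd q))) /\
  smooth_on (square (f p0, snd p0) e) g.

(** With [f] increasing in [u], the solution exists by the intermediate value
    theorem, is unique and continuous by monotonicity, and is differentiable by
    [dif_implicit]; its partial derivatives are smooth functions of [g] itself,
    which gives all higher orders by induction. *)
Lemma implicit_pos (S : R * R -> Prop) (f : R * R -> R) (p0 : R * R) :
  open S -> smooth_on S f -> S p0 ->
  0 < partial_u f p0 -> exists d e g, implicit_solution S f p0 d e g.
Proof.
  intros HS Hf Hp0 Hpos.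
  destruct (proj1 (near_square _ _) (near_and _ _ _ (open_near _ _ HS Hp0)
    (cont_pos _ _ (smooth_cont _ _ _ (smooth_partial_u _ _ HS Hf) Hp0) Hpos)))
    as [d0 [Hd0 HQ]].
  destruct p0 as [u0 v0]; simpl in *.
  set (d := d0 / 2).
  assert (Hd : 0 < d < d0) by (unfold d; lra).
  assert (Hin : forall u v, Rabs (u - u0) < d0 -> Rabs (v - v0) < d0 ->
    S (u, v) /\ 0 < partial_u f (u, v)).
  { intros u v Hu Hv; apply HQ; split; assumption. }
  assert (Hmono : forall v u1 u2, Rabs (v - v0) < d0 -> u0 - d0 < u1 -> u1 < u2 ->
    u2 < u0 + d0 -> f (u1, v) < f (u2, v)).
  { intros v u1 u2 Hv; apply increasing_u.
    - intros u Hu; apply (smooth_dif S); try assumption.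
      apply Hin; [apply Rabs_def1; lra | exact Hv].
    - intros u Hu; apply Hin; [apply Rabs_def1; lra | exact Hv]. }
  assert (Hv0 : Rabs (v0 - v0) < d0) by (rewrite Rminus_diag, Rabs_R0; exact Hd0).
  assert (H1 : f (u0 - d, v0) < f (u0, v0)) by (apply Hmono; try assumption; lra).
  assert (H2 : f (u0, v0) < f (u0 + d, v0)) by (apply Hmono; try assumption; lra).
  assert (Hslice : forall (u : R) q, Rabs (u - u0) < d0 -> Rabs (snd q - v0) < d0 ->
    cont (fun r => f (u, snd r)) q).
  { intros u q Hu Hq; apply cont_comp.
    - apply (smooth_cont S); [exact Hf | apply Hin; assumption].
    - apply cont_const.
    - apply (dif_cont _ _ _ _ (dif_snd q)). }
  assert (Hfst : forall q, cont (fun r => fst r) q)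
    by (intros q; apply (dif_cont _ _ _ _ (dif_fst q))).
  assert (Hneg : forall h q, cont h q -> cont (fun r => -1 * h r) q)
    by (intros h q Hh; apply cont_mult; [apply cont_const | exact Hh]).
  assert (He : near (f (u0, v0), v0) (fun q =>
     Rabs (snd q - v0) < d0 /\ 0 < fst q + -1 * f (u0 - d, snd q) /\
     0 < f (u0 + d, snd q) + -1 * fst q)).
  { apply near_and; [| apply near_and].
    - exists (mkposreal d0 Hd0); intros q _ Hq; exact Hq.
    - apply (cont_pos (fun q => fst q + -1 * f (u0 - d, snd q))); [| simpl; lra].
      apply cont_plus; [apply Hfst | apply Hneg, Hslice]; [| exact Hv0].
      replace (u0 - d - u0) with (- d) by ring; rewrite Rabs_Ropp, Rabs_pos_eq; lra.
    - apply (cont_pos (fun q => f (u0 + d, snd q) + -1 * fst q)); [| simpl; lra].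
      apply cont_plus; [apply Hslice | apply Hneg, Hfst]; [| exact Hv0].
      replace (u0 + d - u0) with d by ring; rewrite Rabs_pos_eq; lra. }
  apply near_square in He; destruct He as [e [He HE]].
  set (g := fun q => epsilon (inhabits 0)
              (fun u => Rabs (u - u0) < d /\ f (u, snd q) = fst q)).
  assert (Hg : forall q, square (f (u0, v0), v0) e q ->
    Rabs (g q - u0) < d /\ f (g q, snd q) = fst q).
  { intros q Hq; unfold g; apply epsilon_spec.
    destruct (HE q Hq) as [Hq1 [Hq2 Hq3]].
    destruct (IVT_interv (fun u => f (u, snd q) - fst q) (u0 - d) (u0 + d)) as [z [Hz1 Hz2]].
    - intros u Hu; apply continuity_pt_filterlim.
      assert (Hu' : S (u, snd q)) by (apply Hin; [apply Rabs_def1; lra | exact Hq1]).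
      apply (ex_derive_continuous (fun u => f (u, snd q) - fst q)).
      apply (ex_derive_minus (fun u => f (u, snd q)) (fun _ => fst q));
        [| apply ex_derive_const].
      eexists; apply (dif_is_derive_u f (u, snd q) _ _ (smooth_dif S f _ HS Hf Hu')).
    - lra.
    - lra.
    - lra.
    - exists z; split; [| lra].
      assert (z <> u0 - d) by (intros ->; lra).
      assert (z <> u0 + d) by (intros ->; lra).
      apply Rabs_def1; lra. }
  assert (Huniq : forall u u' v, Rabs (v - v0) < d0 -> Rabs (u - u0) < d0 ->
    Rabs (u' - u0) < d0 -> f (u, v) = f (u', v) -> u = u').
  { intros u u' v Hv Hu Hu' Heq; apply Rabs_def2 in Hu; apply Rabs_def2 in Hu'.
    destruct (Rtotal_order u u') as [Hlt | [Heq' | Hlt]]; [| exact Heq' |].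
    - assert (T := Hmono v u u' Hv); lra.
    - assert (T := Hmono v u' u Hv); lra. }
  assert (Hgc : forall q, square (f (u0, v0), v0) e q -> cont g q).
  { intros q Hq; destruct (HE q Hq) as [Hq1 _]; destruct (Hg q Hq) as [Hg1 Hg2].
    apply cont_near; intros eps.
    set (r := Rmin eps (d0 / 2)).
    assert (Hr : 0 < r) by (apply Rmin_glb_lt; [apply cond_pos | lra]).
    assert (Hr1 : r <= eps) by apply Rmin_l.
    assert (Hr2 : r <= d0 / 2) by apply Rmin_r.
    apply Rabs_def2 in Hg1; unfold d in Hg1.
    assert (L1 : Rabs (g q - r - u0) < d0) by (apply Rabs_def1; lra).
    assert (L2 : Rabs (g q + r - u0) < d0) by (apply Rabs_def1; lra).
    assert (M1 : f (g q - r, snd q) < fst q).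
    { rewrite <- Hg2; apply Hmono; try assumption; lra. }
    assert (M2 : fst q < f (g q + r, snd q)).
    { rewrite <- Hg2; apply Hmono; try assumption; lra. }
    assert (N1 : near q (fun q' => 0 < fst q' + -1 * f (g q - r, snd q'))).
    { apply (cont_pos (fun q' => fst q' + -1 * f (g q - r, snd q'))); [| lra].
      apply cont_plus; [apply Hfst | apply Hneg, Hslice; assumption]. }
    assert (N2 : near q (fun q' => 0 < f (g q + r, snd q') + -1 * fst q')).
    { apply (cont_pos (fun q' => f (g q + r, snd q') + -1 * fst q')); [| lra].
      apply cont_plus; [apply Hslice; assumption | apply Hneg, Hfst]. }
    generalize (near_and _ _ _ (open_near _ _ (open_square _ _) Hq) (near_and _ _ _ N1 N2)).
    apply near_imp; intros q' [Hq' [N1' N2']].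
    destruct (HE q' Hq') as [Hq1' _]; destruct (Hg q' Hq') as [Hg1' Hg2'].
    apply Rabs_def2 in Hg1'; unfold d in Hg1'.
    apply Rabs_def1.
    - apply Rnot_le_lt; intros Hc.
      assert (T : f (g q + r, snd q') <= f (g q', snd q')); [| lra].
      destruct (Rle_lt_or_eq_dec (g q + r) (g q')) as [Hl | ->]; [lra | | lra].
      left; apply Hmono; try assumption; lra.
    - apply Rnot_le_lt; intros Hc.
      assert (T : f (g q', snd q') <= f (g q - r, snd q')); [| lra].
      destruct (Rle_lt_or_eq_dec (g q') (g q - r)) as [Hl | ->]; [lra | | lra].
      left; apply Hmono; try assumption; lra. }
  assert (Hgin : forall q, square (f (u0, v0), v0) e q ->
    S (g q, snd q) /\ 0 < partial_u f (g q, snd q)).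
  { intros q Hq; apply Hin; [destruct (Hg q Hq) | destruct (HE q Hq)]; lra. }
  assert (Hgd : forall q, square (f (u0, v0), v0) e q ->
     dif g q (/ partial_u f (g q, snd q))
       (- partial_v f (g q, snd q) * / partial_u f (g q, snd q))).
  { intros q Hq; destruct (Hgin q Hq) as [Hs Hpu]; apply (dif_implicit f).
    - apply (smooth_dif S); assumption.
    - lra.
    - apply Hgc, Hq.
    - apply (near_imp q (square (f (u0, v0), v0) e)); [apply Hg | apply open_near, Hq].
      apply open_square. }
  exists d, e, g.
  split; [lra |]; split; [exact He |]; split; [| split; [exact Hg |]; split; [| split]].
  - simpl; intros u v Hu Hv; apply Hin; [lra |].
    apply (HE (f (u0, v0), v)); split; simpl; [| exact Hv].
    rewrite Rminus_diag, Rabs_R0; exact He.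
  - intros u v Hu Hq; destruct (HE _ Hq) as [Hq1 _]; destruct (Hg _ Hq) as [Hg1 Hg2].
    simpl in *; apply (Huniq _ _ v); try lra.
  - intros q Hq; split; [apply Rgt_not_eq, Hgin, Hq | apply Hgd, Hq].
  - assert (HO := open_square (f (u0, v0), v0) e).
    intros n; induction n as [| n IH]; [apply Ck_O, Hgc |].
    assert (Hcomp : forall h, smooth_on S h ->
      Ck n (square (f (u0, v0), v0) e) (fun q => h (g q, snd q))).
    { intros h Hh; apply (Ck_comp n S); try assumption.
      - intros q Hq; apply Hgin, Hq.
      - exact (Hh n).
      - exact (smooth_snd _ HO n). }
    assert (I : Ck n (square (f (u0, v0), v0) e) (fun q => / partial_u f (g q, snd q))).
    { apply Ck_inv; [exact HO | | apply Hcomp, smooth_partial_u; assumption].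
      intros q Hq; apply Rgt_not_eq, Hgin, Hq. }
    apply (Ck_S_intro n _ _ _ _ HO Hgd I).
    apply Ck_mult; [exact HO | | exact I].
    apply (Hcomp (fun q => - partial_v f q)), smooth_opp, smooth_partial_v; assumption.
Qed.

Lemma implicit (S : R * R -> Prop) (f : R * R -> R) (p0 : R * R) :
  open S -> smooth_on S f -> S p0 ->
  partial_u f p0 <> 0 -> exists d e g, implicit_solution S f p0 d e g.
Proof.
  intros HS Hf Hp0 Hne.
  destruct (Rtotal_order (partial_u f p0) 0) as [Hlt | [Heq | Hgt]];
    [| contradiction | apply implicit_pos; assumption].
  assert (Hd : forall p, S p ->
    dif (fun q => - f q) p (- partial_u f p) (- partial_v f p)).
  { intros p Hp; apply dif_opp, (smooth_dif S); assumption. }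
  assert (Hu : forall p, S p -> partial_u (fun q => - f q) p = - partial_u f p)
    by (intros p Hp; apply (dif_unique _ _ _ _ (Hd p Hp))).
  assert (Hv : forall p, S p -> partial_v (fun q => - f q) p = - partial_v f p)
    by (intros p Hp; apply (dif_unique _ _ _ _ (Hd p Hp))).
  destruct (implicit_pos S (fun q => - f q) p0 HS (smooth_opp _ _ HS Hf) Hp0)
    as (d & e & g & H1 & H2 & H3 & H4 & H5 & H6 & H7).
  { rewrite Hu by assumption; lra. }
  assert (Hflip : forall q, square (f p0, snd p0) e q ->
    square (- f p0, snd p0) e (- fst q, snd q)).
  { intros q [Ha Hb]; split; simpl in *; [| exact Hb].
    replace (- fst q - - f p0) with (- (fst q - f p0)) by ring.
    rewrite Rabs_Ropp; exact Ha. }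
  assert (Hmap : forall q, dif (fun r => - fst r) q (- (1)) (- 0))
    by (intros q; apply dif_opp, dif_fst).
  exists d, e, (fun q => g (- fst q, snd q)).
  split; [exact H1 |]; split; [exact H2 |]; split; [exact H3 |].
  split; [| split; [| split]].
  - intros q Hq; destruct (H4 _ (Hflip q Hq)) as [Ha Hb]; split; [exact Ha |].
    simpl in Hb; lra.
  - intros u v Hu' Hq; apply (H5 u v Hu'), (Hflip _ Hq).
  - intros q Hq.
    assert (HSq : S (g (- fst q, snd q), snd q)).
    { apply H3; [apply (H4 _ (Hflip q Hq)) | apply Hq]. }
    assert (T := H6 _ (Hflip q Hq)); simpl in T; rewrite Hu, Hv in T by exact HSq.
    destruct T as [Hn T].
    assert (Hn0 : partial_u f (g (- fst q, snd q), snd q) <> 0) by lra.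
    split; [exact Hn0 |].
    eapply dif_eq.
    + apply (dif_comp g (fun r => - fst r) (fun r => snd r) q _ _ _ _ _ _ T (Hmap q) (dif_snd q)).
    + simpl; field; exact Hn0.
    + simpl; field; exact Hn0.
  - apply (smooth_comp (square (- f p0, snd p0) e)).
    + apply open_square.
    + apply open_square.
    + exact Hflip.
    + exact H7.
    + apply smooth_opp, smooth_fst; apply open_square.
    + apply smooth_snd, open_square.
Qed.

Definition inverse_pair (S U : R * R -> Prop) (c : R * R) (e : R)
  (phi psi : R * R -> R * R) : Prop :=
  open U /\ 0 < e /\ (forall p, U p -> S p) /\
  smooth_map (square c e) phi /\ (forall t, square c e t -> U (phi t)) /\
  smooth_map U psi /\ (forall p, U p -> square c e (psi p)) /\
  (forall t, square c e t -> psi (phi t) = t) /\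
  (forall p, U p -> phi (psi p) = p).

Definition jac (f g : R * R -> R) (p : R * R) : R :=
  partial_u f p * partial_v g p - partial_v f p * partial_u g p.

(** Solving for one variable at a time: first [u] from the value of [f], then
    [v] from the value of [g] along the curves on which [f] is constant. *)
Lemma local_inverse_aux (S : R * R -> Prop) (f g : R * R -> R) (p0 : R * R) :
  open S -> smooth_on S f -> smooth_on S g ->
  S p0 -> partial_u f p0 <> 0 -> jac f g p0 <> 0 ->
  exists U e phi, U p0 /\ inverse_pair S U (f p0, g p0) e phi (fun p => (f p, g p)).
Proof.
  intros HS Hf Hg Hp0 Hfu HJ.
  destruct (implicit S f p0 HS Hf Hp0 Hfu) as (d & e & k & Hd & He & K3 & K4 & K5 & K6 & K7).
  set (Q := square (f p0, snd p0) e) in *.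
  assert (HQ : open Q) by apply open_square.
  assert (HkS : forall q, Q q -> S (k q, snd q)).
  { intros q Hq; apply K3; [apply (K4 q Hq) | apply Hq]. }
  set (h := fun q => g (k q, snd q)).
  assert (Hh : smooth_on Q h).
  { apply (smooth_comp S Q); try assumption; apply smooth_snd, HQ. }
  assert (Hc : Q (f p0, snd p0)) by apply (square_center (f p0, snd p0)), He.
  assert (Hk0 : k (f p0, snd p0) = fst p0).
  { assert (T := K5 (fst p0) (snd p0)); rewrite <- surjective_pairing in T; apply T.
    - rewrite Rminus_diag, Rabs_R0; exact Hd.
    - exact Hc. }
  assert (Hh0 : h (f p0, snd p0) = g p0).
  { unfold h; simpl; rewrite Hk0, <- surjective_pairing; reflexivity. }
  set (Q' := fun q => Q (snd q, fst q)).
  assert (HQ' : open Q').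
  { unfold Q'; apply near_open; intros p Hp.
    destruct (open_near _ _ HQ Hp) as [r Hr]; exists r; intros q H1 H2; apply Hr; assumption. }
  set (h' := fun q => h (snd q, fst q)).
  assert (Hh' : smooth_on Q' h').
  { apply (smooth_comp Q Q'); try assumption.
    - intros p Hp; exact Hp.
    - apply smooth_snd, HQ'.
    - apply smooth_fst, HQ'. }
  assert (Hhd : dif h (f p0, snd p0)
     (partial_u g p0 * / partial_u f p0)
     (partial_u g p0 * (- partial_v f p0 * / partial_u f p0) + partial_v g p0)).
  { eapply dif_eq.
    - exact (dif_comp g k (fun r => snd r) (f p0, snd p0) _ _ _ _ _ _
        (smooth_dif S g _ HS Hg (HkS _ Hc)) (proj2 (K6 _ Hc)) (dif_snd _)).
    - simpl; rewrite Hk0, <- surjective_pairing; ring.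
    - simpl; rewrite Hk0, <- surjective_pairing; ring. }
  assert (Hh'u : partial_u h' (snd p0, f p0) <> 0).
  { assert (T := dif_comp h (fun r => snd r) (fun r => fst r) (snd p0, f p0) _ _ _ _ _ _
                   Hhd (dif_snd _) (dif_fst _)).
    rewrite (proj1 (dif_unique h' _ _ _ T)).
    intros Hz; apply HJ; unfold jac.
    apply (Rmult_eq_reg_r (/ partial_u f p0)); [| apply Rinv_neq_0_compat, Hfu].
    rewrite Rmult_0_l; rewrite <- Hz; field; exact Hfu. }
  assert (Hc' : Q' (snd p0, f p0)) by exact Hc.
  destruct (implicit Q' h' (snd p0, f p0) HQ' Hh' Hc' Hh'u)
    as (d2 & e2 & m & Hd2 & He2 & M3 & M4 & M5 & M6 & M7).
  assert (Eh : h' (snd p0, f p0) = g p0) by exact Hh0.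
  rewrite Eh in *; simpl in M3, M4, M5, M6, M7.
  set (V := square (f p0, g p0) e2).
  assert (HV : open V) by apply open_square.
  assert (Hsw : forall t, V t -> square (g p0, f p0) e2 (snd t, fst t)).
  { intros t [T1 T2]; split; assumption. }
  set (m' := fun t => m (snd t, fst t)).
  assert (Hm' : smooth_on V m').
  { apply (smooth_comp (square (g p0, f p0) e2) V); try assumption.
    - apply open_square.
    - apply smooth_snd, HV.
    - apply smooth_fst, HV. }
  assert (HmQ : forall t, V t -> Q (fst t, m' t)).
  { intros t Ht; apply (M3 (m' t) (fst t)); [apply (M4 _ (Hsw t Ht)) | apply Ht]. }
  set (phi := fun t => (k (fst t, m' t), m' t)).
  set (U := fun p => (S p /\ Rabs (fst p - fst p0) < d /\ Rabs (snd p - snd p0) < d2)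
                     /\ V (f p, g p)).
  assert (Hdd : d2 <= e).
  { apply Rnot_lt_le; intros Hlt.
    assert (T : Q' (snd p0 + e, f p0)).
    { apply M3.
      - replace (snd p0 + e - snd p0) with e by ring; rewrite Rabs_pos_eq; lra.
      - rewrite Rminus_diag, Rabs_R0; exact He2. }
    destruct T as [_ T]; simpl in T.
    replace (snd p0 + e - snd p0) with e in T by ring; rewrite Rabs_pos_eq in T; lra. }
  assert (HfgV : forall t, V t -> f (phi t) = fst t /\ g (phi t) = snd t).
  { intros t Ht; split.
    - apply (K4 _ (HmQ t Ht)).
    - apply (M4 _ (Hsw t Ht)). }
  exists U, e2, phi; split; [| repeat split].
  - split; [split; [exact Hp0 |]; split; rewrite Rminus_diag, Rabs_R0; assumption |].
    apply (square_center (f p0, g p0)), He2.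
  - apply open_preimage; [| exact HV |].
    + apply open_inter; [exact HS | apply open_inter].
      * apply (open_strip 1 0 (fun p => fst p)), dif_fst.
      * apply (open_strip 0 1 (fun p => snd p)), dif_snd.
    + intros p [Hp _]; split; apply (smooth_cont S); assumption.
  - exact He2.
  - intros p Hp; apply Hp.
  - apply (smooth_comp Q V k (fun t => fst t) m'); try assumption.
    apply smooth_fst, HV.
  - exact Hm'.
  - apply (HkS _ (HmQ t H)).
  - apply (K4 _ (HmQ t H)).
  - apply (M4 _ (Hsw t H)).
  - simpl; rewrite (proj1 (HfgV t H)); apply H.
  - simpl; rewrite (proj2 (HfgV t H)); apply H.
  - apply (smooth_sub S); [intros p Hp; apply Hp | exact Hf].
  - apply (smooth_sub S); [intros p Hp; apply Hp | exact Hg].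
  - apply H.
  - apply H.
  - intros t Ht; destruct (HfgV t Ht) as [-> ->]; symmetry; apply surjective_pairing.
  - intros p [[Hp [Hp1 Hp2]] Hp3].
    assert (Hw : Rabs (f p - f p0) < e).
    { apply (M3 (snd p) (f p)); [exact Hp2 | apply Hp3]. }
    assert (Hk : k (f p, snd p) = fst p).
    { assert (T := K5 (fst p) (snd p) Hp1); rewrite <- surjective_pairing in T; apply T.
      split; simpl; [exact Hw | lra]. }
    assert (Hhp : h' (snd p, f p) = g p).
    { unfold h', h; simpl; rewrite Hk, <- surjective_pairing; reflexivity. }
    assert (Hm : m (g p, f p) = snd p).
    { rewrite <- Hhp; apply M5; [exact Hp2 |].
      rewrite Hhp; apply (Hsw _ Hp3). }
    unfold phi, m'; simpl; rewrite Hm, Hk; symmetry; apply surjective_pairing.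
Qed.

(** If the [u]-derivative of [f] vanishes at the point, that of [g] does not,
    by the condition on the Jacobian, and the functions exchange their roles. *)
Lemma local_inverse (S : R * R -> Prop) (f g : R * R -> R) (p0 : R * R) :
  open S -> smooth_on S f -> smooth_on S g ->
  S p0 -> jac f g p0 <> 0 ->
  exists U e phi, U p0 /\ inverse_pair S U (f p0, g p0) e phi (fun p => (f p, g p)).
Proof.
  intros HS Hf Hg Hp0 HJ.
  destruct (Req_dec (partial_u f p0) 0) as [H0 | H0];
    [| apply local_inverse_aux; assumption].
  destruct (local_inverse_aux S g f p0) as
    (U & e & phi & HU & H1 & H2 & H3 & [H4 H4'] & H5 & H6 & H7 & H8 & H9); try assumption.
  - intros Hc; apply HJ; unfold jac; rewrite H0, Hc; ring.
  - intros Hc; apply HJ; unfold jac in *; lra.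
  - assert (Hsw : forall t, square (f p0, g p0) e t -> square (g p0, f p0) e (snd t, fst t)).
    { intros t [T1 T2]; split; assumption. }
    exists U, e, (fun t => phi (snd t, fst t)); split; [exact HU |].
    split; [exact H1 |]; split; [exact H2 |]; split; [exact H3 |].
    split; [split |].
    + apply (smooth_comp (square (g p0, f p0) e)
               (square (f p0, g p0) e) (fun t => fst (phi t)) (fun t => snd t) (fun t => fst t));
        try apply open_square; try assumption.
      * apply smooth_snd, open_square.
      * apply smooth_fst, open_square.
    + apply (smooth_comp (square (g p0, f p0) e)
               (square (f p0, g p0) e) (fun t => snd (phi t)) (fun t => snd t) (fun t => fst t));
        try apply open_square; try assumption.
      * apply smooth_snd, open_square.
      * apply smooth_fst, open_square.
    + split; [intros t Ht; apply H5, Hsw, Ht |].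
      split; [split; [apply H6 | apply H6] |].
      split; [intros p Hp; destruct (H7 p Hp); split; assumption |].
      split; [| exact H9].
      intros t Ht; specialize (H8 _ (Hsw t Ht)); injection H8 as E1 E2.
      rewrite E1, E2; symmetry; apply surjective_pairing.
Qed.

(** * Connectedness *)

Definition convex (V : R * R -> Prop) : Prop :=
  forall p q tau, V p -> V q -> 0 <= tau <= 1 ->
    V ((1 - tau) * fst p + tau * fst q, (1 - tau) * snd p + tau * snd q).

(** On a segment joining the two open sets, the supremum of the parameters
    whose points lie in the first set belongs to both. *)
Lemma convex_connected (V : R * R -> Prop) : convex V -> connected V.
Proof.
  intros HV A B HA HB Hcov [p [Hp HpA]] [q [Hq HqB]].
  apply NNPP; intros Hdisj.
  set (ga := fun tau => ((1 - tau) * fst p + tau * fst q, (1 - tau) * snd p + tau * snd q)).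
  assert (HgV : forall tau, 0 <= tau <= 1 -> V (ga tau)) by (intros; apply HV; assumption).
  assert (Hnot : forall tau, 0 <= tau <= 1 -> A (ga tau) -> B (ga tau) -> False).
  { intros tau Ht H1 H2; apply Hdisj; exists (ga tau); auto. }
  assert (H0 : ga 0 = p) by (unfold ga; rewrite (surjective_pairing p) at 3; f_equal; ring).
  assert (H1 : ga 1 = q) by (unfold ga; rewrite (surjective_pairing q) at 3; f_equal; ring).
  assert (Hopen : forall C : R * R -> Prop, open C -> forall tau, C (ga tau) ->
    exists d, 0 < d /\ forall s, Rabs (s - tau) < d -> C (ga s)).
  { intros C HC tau Ht; destruct (open_near _ _ HC Ht) as [d Hd].
    set (m := Rabs (fst q - fst p) + Rabs (snd q - snd p) + 1).
    assert (M1 := Rabs_pos (fst q - fst p)); assert (M2 := Rabs_pos (snd q - snd p)).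
    assert (Hm : 0 < m) by (unfold m; lra).
    exists (d / m); split; [apply Rdiv_lt_0_compat; [apply cond_pos | exact Hm] |].
    intros s Hs.
    assert (Hsm : Rabs (s - tau) * m < d).
    { apply (Rmult_lt_reg_r (/ m)); [apply Rinv_0_lt_compat, Hm |].
      rewrite Rmult_assoc, Rinv_r, Rmult_1_r by lra; exact Hs. }
    assert (Hs0 := Rabs_pos (s - tau)).
    apply Hd; unfold ga; simpl.
    - replace (_ - _) with ((s - tau) * (fst q - fst p)) by ring.
      rewrite Rabs_mult; eapply Rle_lt_trans; [| exact Hsm].
      apply Rmult_le_compat_l; [exact Hs0 | unfold m; lra].
    - replace (_ - _) with ((s - tau) * (snd q - snd p)) by ring.
      rewrite Rabs_mult; eapply Rle_lt_trans; [| exact Hsm].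
      apply Rmult_le_compat_l; [exact Hs0 | unfold m; lra]. }
  set (E := fun tau => 0 <= tau <= 1 /\ A (ga tau)).
  destruct (completeness E) as [m [Hub Hlub]].
  - exists 1; intros tau [Ht _]; lra.
  - exists 0; split; [lra | rewrite H0; exact HpA].
  - assert (E0 : 0 <= m) by (apply Hub; split; [lra | rewrite H0; exact HpA]).
    assert (E1 : m <= 1) by (apply Hlub; intros tau [Ht _]; lra).
    destruct (Hcov (ga m) (HgV m (conj E0 E1))) as [Ha | Hb].
    + destruct (Req_dec m 1) as [-> | Hne].
      { apply (Hnot 1); [lra | exact Ha | rewrite H1; exact HqB]. }
      destruct (Hopen A HA m Ha) as [d [Hd Hd']].
      set (s := m + Rmin (d / 2) (1 - m)).
      assert (Hr : 0 < Rmin (d / 2) (1 - m)) by (apply Rmin_glb_lt; lra).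
      assert (R1 := Rmin_l (d / 2) (1 - m)). assert (R2 := Rmin_r (d / 2) (1 - m)).
      assert (Hs : s <= m); [| unfold s in Hs; lra].
      apply Hub; split; [unfold s; lra |].
      apply Hd'; unfold s; apply Rabs_def1; lra.
    + destruct (Hopen B HB m Hb) as [d [Hd Hd']].
      assert (Hs : m <= m - d); [| lra].
      apply Hlub; intros tau [Ht HtA]; apply Rnot_lt_le; intros Hlt.
      assert (tau <= m) by (apply Hub; split; assumption).
      apply (Hnot tau Ht HtA), Hd', Rabs_def1; lra.
Qed.

Lemma connected_image (U V : R * R -> Prop) (phi psi : R * R -> R * R) :
  open V -> connected V -> smooth_map V phi -> (forall t, V t -> U (phi t)) ->
  (forall p, U p -> V (psi p)) -> (forall p, U p -> phi (psi p) = p) -> connected U.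
Proof.
  intros HV Hc [Hf Hg] HVU HUV Hpp A B HA HB Hcov [p [Hp HpA]] [q [Hq HqB]].
  assert (Hcont : forall t, V t -> cont (fun s => fst (phi s)) t /\ cont (fun s => snd (phi s)) t).
  { intros t Ht; split; apply (smooth_cont V); assumption. }
  destruct (Hc (fun t => V t /\ A (fst (phi t), snd (phi t)))
               (fun t => V t /\ B (fst (phi t), snd (phi t)))) as [t [Ht [[_ Ha] [_ Hb]]]].
  - apply open_preimage; assumption.
  - apply open_preimage; assumption.
  - intros t Ht; rewrite <- surjective_pairing.
    destruct (Hcov _ (HVU t Ht)); [left | right]; split; assumption.
  - exists (psi p); rewrite <- surjective_pairing, Hpp by exact Hp; auto.
  - exists (psi q); rewrite <- surjective_pairing, Hpp by exact Hq; auto.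
  - rewrite <- surjective_pairing in Ha, Hb; exists (phi t); auto.
Qed.

Lemma convex_combination_lt (a b r tau : R) :
  a < r -> b < r -> 0 <= tau <= 1 -> (1 - tau) * a + tau * b < r.
Proof.
  intros Ha Hb Ht; destruct (Rle_lt_dec a b).
  - apply (Rle_lt_trans _ b); nra.
  - apply (Rle_lt_trans _ a); nra.
Qed.

Lemma convex_Rabs (a b c r tau : R) : Rabs (a - c) < r -> Rabs (b - c) < r ->
  0 <= tau <= 1 -> Rabs ((1 - tau) * a + tau * b - c) < r.
Proof.
  intros Ha Hb Ht; apply Rabs_def2 in Ha, Hb.
  assert (T1 := convex_combination_lt a b (c + r) tau).
  assert (T2 := convex_combination_lt (- a) (- b) (r - c) tau).
  apply Rabs_def1; lra.
Qed.

Lemma local_coords_intro (S U V : R * R -> Prop) (phi psi : R * R -> R * R) :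
  open V -> convex V -> open U -> (forall p, U p -> S p) ->
  smooth_map V phi -> (forall t, V t -> U (phi t)) ->
  smooth_map U psi -> (forall p, U p -> V (psi p)) ->
  (forall t, V t -> psi (phi t) = t) -> (forall p, U p -> phi (psi p) = p) ->
  local_coords S U V phi.
Proof.
  intros HV Hconv HU HUS Hphi HVU Hpsi HUV H1 H2.
  assert (Hc := convex_connected V Hconv).
  split; [split; [exact HU | apply (connected_image U V phi psi); assumption] |].
  split; [split; assumption |].
  repeat (split; [assumption |]); exists psi; auto.
Qed.

(** * Primitives *)

(** Functions of one variable are treated as functions of the plane that depend
    on the first coordinate only, so that the calculus above applies to them. *)
Definition strip (c e : R) (p : R * R) : Prop := Rabs (fst p - c) < e.

Definition smooth1 (c e : R) (f : R -> R) : Prop :=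
  smooth_on (strip c e) (fun p => f (fst p)).

Lemma open_strip_fst (c e : R) : open (strip c e).
Proof. apply (open_strip 1 0 (fun p => fst p)), dif_fst. Qed.

Lemma smooth1_const (c e k : R) : smooth1 c e (fun _ => k).
Proof. exact (smooth_const (strip c e) k (open_strip_fst c e)). Qed.

Lemma smooth1_is_derive (c e : R) (f : R -> R) (s : R) :
  smooth1 c e f -> Rabs (s - c) < e -> is_derive f s (Derive f s).
Proof.
  intros Hf Hs.
  apply (dif_is_derive_u (fun p => f (fst p)) (s, 0) _ _
    (smooth_dif (strip c e) _ (s, 0) (open_strip_fst c e) Hf Hs)).
Qed.

Lemma smooth1_Derive (c e : R) (f : R -> R) : smooth1 c e f -> smooth1 c e (Derive f).
Proof. apply (smooth_partial_u (strip c e)), open_strip_fst. Qed.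

Lemma smooth1_comp (c e : R) (f : R -> R) (V : R * R -> Prop) (g : R * R -> R) :
  open V -> smooth1 c e f -> (forall p, V p -> Rabs (g p - c) < e) ->
  smooth_on V g -> smooth_on V (fun p => f (g p)).
Proof.
  intros HV Hf HVg Hg.
  apply (smooth_comp (strip c e) V (fun p => f (fst p)) g (fun _ => 0)); try assumption.
  - apply open_strip_fst.
  - apply smooth_const, HV.
Qed.

Lemma interval_between (c e x z : R) :
  Rabs (x - c) < e -> Rmin c x <= z <= Rmax c x -> Rabs (z - c) < e.
Proof.
  intros Hx; apply Rabs_def2 in Hx; unfold Rmin, Rmax; intros Hz; apply Rabs_def1;
  destruct (Rle_dec c x); lra.
Qed.

Lemma is_derive_primitive (f : R -> R) (c e x : R) :
  (forall s, Rabs (s - c) < e -> continuous f s) -> Rabs (x - c) < e ->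
  is_derive (fun x => RInt f c x) x (f x).
Proof.
  intros Hf Hx; apply (is_derive_RInt f (fun x => RInt f c x) c x); [| apply Hf, Hx].
  assert (H : 0 < e - Rabs (x - c)) by lra.
  exists (mkposreal _ H); intros y Hy; apply (RInt_correct f), ex_RInt_continuous.
  intros z Hz; apply Hf, (interval_between c e y); [| exact Hz].
  change (Rabs (y - x) < e - Rabs (x - c)) in Hy.
  replace (y - c) with ((y - x) + (x - c)) by ring.
  eapply Rle_lt_trans; [apply Rabs_triang | lra].
Qed.

Lemma cont_slice_u (f : R * R -> R) (u v : R) :
  cont f (u, v) -> continuous (fun s => f (s, v)) u.
Proof.
  intros H; apply continuity_pt_filterlim.
  intros eps He; destruct (H (mkposreal eps He)) as [d Hd]; exists d; split; [apply cond_pos |].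
  intros s [_ Hs]; apply Hd; [exact Hs |]; simpl.
  rewrite Rminus_diag, Rabs_R0; apply cond_pos.
Qed.

Lemma cont_slice_v (f : R * R -> R) (u v : R) :
  cont f (u, v) -> continuous (fun s => f (u, s)) v.
Proof.
  intros H; apply continuity_pt_filterlim.
  intros eps He; destruct (H (mkposreal eps He)) as [d Hd]; exists d; split; [apply cond_pos |].
  intros s [_ Hs]; apply Hd; [| exact Hs]; simpl.
  rewrite Rminus_diag, Rabs_R0; apply cond_pos.
Qed.

Lemma smooth1_cont (c e : R) (f : R -> R) (s : R) :
  smooth1 c e f -> Rabs (s - c) < e -> continuous f s.
Proof.
  intros Hf Hs; apply (cont_slice_u (fun p => f (fst p)) s 0).
  apply (smooth_cont (strip c e)); [exact Hf | exact Hs].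
Qed.

(** The Poincare lemma on a square: [P] is integrated along the horizontal
    line through the centre and [Q] along vertical lines; closedness turns the
    derivative under the second integral into a total derivative. *)
Lemma closed_form_exact (c : R * R) (e : R) (P Q : R * R -> R) :
  smooth_on (square c e) P -> smooth_on (square c e) Q ->
  (forall p, square c e p -> partial_v P p = partial_u Q p) ->
  exists y, smooth_on (square c e) y /\ forall p, square c e p -> dif y p (P p) (Q p).
Proof.
  intros HP HQ Hcl.
  assert (HO := open_square c e).
  destruct c as [u0 v0].
  set (y := fun p : R * R => RInt (fun s => P (s, v0)) u0 (fst p)
              + RInt (fun s => Q (fst p, s)) v0 (snd p)).
  assert (Hin : forall u v, Rabs (u - u0) < e -> Rabs (v - v0) < e -> square (u0, v0) e (u, v))
    by (intros; split; assumption).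
  assert (Hd : forall p, square (u0, v0) e p -> dif y p (P p) (Q p)).
  { intros p0 Hp0; apply (dif_of_partials y p0 P);
      [| | apply (smooth_cont (square (u0, v0) e)); assumption].
    - apply (near_imp p0 (square (u0, v0) e)); [| apply open_near; assumption].
      intros [u v] [Hu Hv]; simpl in *.
      assert (Hvv : Rabs (v0 - v0) < e).
      { rewrite Rminus_diag, Rabs_R0; eapply Rle_lt_trans; [apply Rabs_pos | exact Hu]. }
      assert (D1 : is_derive (fun u => RInt (fun s => P (s, v0)) u0 u) u (P (u, v0))).
      { apply (is_derive_primitive (fun s => P (s, v0)) u0 e); [| exact Hu].
        intros s Hs; apply cont_slice_u, (smooth_cont (square (u0, v0) e)); [exact HP |].
        apply Hin; assumption. }
      assert (D2 : is_derive (fun u => RInt (fun s => Q (u, s)) v0 v) u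
                     (RInt (fun s => partial_u Q (u, s)) v0 v)).
      { apply (is_derive_RInt_param (fun u s => Q (u, s)) v0 v u).
        - assert (H : 0 < e - Rabs (u - u0)) by lra.
          exists (mkposreal _ H); intros z Hz t Ht.
          assert (Hzu : Rabs (z - u0) < e).
          { change (Rabs (z - u) < e - Rabs (u - u0)) in Hz.
            replace (z - u0) with ((z - u) + (u - u0)) by ring.
            eapply Rle_lt_trans; [apply Rabs_triang | lra]. }
          assert (Ht' := interval_between _ _ _ _ Hv Ht).
          eexists; apply (dif_is_derive_u Q (z, t) _ _
            (smooth_dif _ _ _ HO HQ (Hin _ _ Hzu Ht'))).
        - intros t Ht.
          apply (smooth_cont _ _ (u, t) (smooth_partial_u _ _ HO HQ)).
          apply Hin; [exact Hu | apply (interval_between _ _ _ _ Hv Ht)].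
        - assert (H : 0 < e - Rabs (u - u0)) by lra.
          exists (mkposreal _ H); intros z Hz.
          apply (ex_RInt_continuous (V := R_CompleteNormedModule)); intros t Ht.
          assert (Hzu : Rabs (z - u0) < e).
          { change (Rabs (z - u) < e - Rabs (u - u0)) in Hz.
            replace (z - u0) with ((z - u) + (u - u0)) by ring.
            eapply Rle_lt_trans; [apply Rabs_triang | lra]. }
          apply cont_slice_v, (smooth_cont (square (u0, v0) e)); [exact HQ |].
          apply Hin; [exact Hzu | apply (interval_between _ _ _ _ Hv Ht)]. }
      assert (Hint : RInt (fun s => partial_u Q (u, s)) v0 v = P (u, v) - P (u, v0)).
      { rewrite <- (RInt_Derive (fun s => P (u, s)) v0 v).
        - apply RInt_ext; intros t Ht; symmetry; apply (Hcl (u, t)).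
          apply Hin; [exact Hu | apply (interval_between _ _ _ _ Hv)]; lra.
        - intros t Ht.
          eexists; apply (dif_is_derive_v P (u, t) _ _
            (smooth_dif _ _ _ HO HP (Hin _ _ Hu (interval_between _ _ _ _ Hv Ht)))).
        - intros t Ht; apply (cont_slice_v (partial_v P)).
          apply (smooth_cont _ _ (u, t) (smooth_partial_v _ _ HO HP)).
          apply Hin; [exact Hu | apply (interval_between _ _ _ _ Hv Ht)]. }
      rewrite Hint in D2.
      assert (D := is_derive_plus (K := R_AbsRing) (V := R_NormedModule) _ _ u _ _ D1 D2).
      replace (P (u, v)) with (plus (P (u, v0)) (P (u, v) - P (u, v0)))
        by (unfold plus; simpl; ring).
      exact D.
    - destruct p0 as [u v], Hp0 as [Hu Hv]; simpl in *.
      assert (D2 : is_derive (fun t => RInt (fun s => Q (u, s)) v0 t) v (Q (u, v))).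
      { apply (is_derive_primitive (fun s => Q (u, s)) v0 e); [| exact Hv].
        intros s Hs; apply cont_slice_v, (smooth_cont (square (u0, v0) e)); [exact HQ |].
        apply Hin; assumption. }
      assert (D := is_derive_plus (K := R_AbsRing) (V := R_NormedModule)
        (fun _ => RInt (fun s => P (s, v0)) u0 u) _ v _ _
        (is_derive_const (V := R_NormedModule) (RInt (fun s => P (s, v0)) u0 u) v) D2).
      replace (Q (u, v)) with (plus zero (Q (u, v))) by apply plus_zero_l.
      exact D. }
  exists y; split; [| exact Hd].
  apply (smooth_intro _ y P Q); assumption.
Qed.

Lemma strip_slice (c e : R) (f : R -> R) : 0 < e -> smooth1 c e f ->
  forall p, Rabs (fst p - c) < e -> dif (fun q => f (fst q)) p (Derive f (fst p)) 0.
Proof.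
  intros He Hf p Hp; eapply dif_eq.
  - apply (dif_comp1 f (fun q => fst q)); [apply (smooth1_is_derive c e); assumption |].
    apply dif_fst.
  - ring.
  - ring.
Qed.

(** [h] is the primitive of [rho] vanishing at [c], and [f] its local inverse,
    found as a solution of the equation [h (u) = w] that involves no second
    variable. *)
Lemma reparametrisation (c e : R) (rho : R -> R) :
  0 < e -> smooth1 c e rho -> (forall s, Rabs (s - c) < e -> rho s <> 0) ->
  exists (d de : R) (h f : R -> R), 0 < d /\ d <= e /\ 0 < de /\ h c = 0 /\
    smooth1 c e h /\ smooth1 0 de f /\
    (forall w, Rabs w < de -> Rabs (f w - c) < d /\ h (f w) = w /\
       is_derive f w (/ rho (f w))) /\
    (forall s, Rabs (s - c) < d -> Rabs (h s) < de -> f (h s) = s).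
Proof.
  intros He Hr Hr0.
  set (h := fun s => RInt rho c s).
  assert (Hh : forall s, Rabs (s - c) < e -> is_derive h s (rho s)).
  { intros s Hs; apply (is_derive_primitive rho c e); [| exact Hs].
    intros z Hz; apply (smooth1_cont c e); assumption. }
  assert (HO := open_strip_fst c e).
  assert (Hd : forall p, strip c e p -> dif (fun q => h (fst q)) p (rho (fst p)) 0).
  { intros p Hp; eapply dif_eq.
    - apply (dif_comp1 h (fun q => fst q)); [apply Hh, Hp | apply dif_fst].
    - ring.
    - ring. }
  assert (Hhs : smooth1 c e h).
  { apply (smooth_intro _ _ (fun p => rho (fst p)) (fun _ => 0)); try assumption.
    apply smooth_const, HO. }
  assert (Hcc : Rabs (c - c) < e) by (rewrite Rminus_diag, Rabs_R0; exact He).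
  assert (Hh0 : h c = 0) by apply (RInt_point c rho).
  destruct (implicit (strip c e) (fun q => h (fst q)) (c, 0) HO Hhs)
    as (d & de & g & H1 & H2 & H3 & H4 & H5 & H6 & H7).
  - exact Hcc.
  - rewrite (proj1 (dif_unique _ _ _ _ (Hd (c, 0) Hcc))); apply Hr0, Hcc.
  - simpl in *; rewrite Hh0 in *.
    assert (Hin : forall w, Rabs w < de -> square (0, 0) de (w, 0)).
    { intros w Hw; split; simpl; [rewrite Rminus_0_r; exact Hw |].
      rewrite Rminus_0_r, Rabs_R0; exact H2. }
    assert (Hdde : d <= e).
    { apply Rnot_lt_le; intros Hlt.
      assert (T : strip c e (c + e, 0)).
      { apply H3; [replace (c + e - c) with e by ring; rewrite Rabs_pos_eq; lra |].
        rewrite Rminus_0_r, Rabs_R0; exact H2. }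
      unfold strip in T; simpl in T.
      replace (c + e - c) with e in T by ring; rewrite Rabs_pos_eq in T; lra. }
    exists d, de, h, (fun w => g (w, 0)).
    split; [exact H1 |]; split; [exact Hdde |]; split; [exact H2 |].
    split; [exact Hh0 |]; split; [exact Hhs |]; split; [| split].
    + apply (smooth_comp (square (0, 0) de) (strip 0 de) g (fun p => fst p) (fun _ => 0)).
      * apply open_square.
      * apply open_strip_fst.
      * intros p Hp; apply Hin; unfold strip in Hp; rewrite Rminus_0_r in Hp; exact Hp.
      * exact H7.
      * apply smooth_fst, open_strip_fst.
      * apply smooth_const, open_strip_fst.
    + intros w Hw; destruct (H4 _ (Hin w Hw)) as [T1 T2].
      split; [exact T1 |]; split; [exact T2 |].
      destruct (H6 _ (Hin w Hw)) as [_ T3]; simpl in T3.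
      assert (Hs : strip c e (g (w, 0), 0)) by (unfold strip; simpl; lra).
      rewrite (proj1 (dif_unique _ _ _ _ (Hd _ Hs))) in T3.
      apply (dif_is_derive_u g (w, 0) _ _ T3).
    + intros s Hs Hw; apply (H5 s 0 Hs), Hin, Hw.
Qed.

(** * Minimality as a closedness condition *)

Definition coefE (x : R * R -> vec R) (p : R * R) : R := dot (vec_u x p) (vec_u x p).
Definition coefF (x : R * R -> vec R) (p : R * R) : R := dot (vec_u x p) (vec_v x p).
Definition coefG (x : R * R -> vec R) (p : R * R) : R := dot (vec_v x p) (vec_v x p).

Definition vec_smooth (S : R * R -> Prop) (x : R * R -> vec R) : Prop :=
  forall i, smooth_on S (fun p => x p i).

Definition vec_uu (x : R * R -> vec R) : R * R -> vec R := vec_u (vec_u x).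
Definition vec_uv (x : R * R -> vec R) : R * R -> vec R := vec_u (vec_v x).
Definition vec_vv (x : R * R -> vec R) : R * R -> vec R := vec_v (vec_v x).

Lemma dot_sym (a b : vec R) : dot a b = dot b a.
Proof. unfold dot; ring. Qed.

Lemma dot_differential (x : R * R -> vec R) (p a b : R * R) :
  dot (differential x p a) (differential x p b) =
  fst a * fst b * coefE x p + (fst a * snd b + snd a * fst b) * coefF x p
  + snd a * snd b * coefG x p.
Proof. unfold differential, coefE, coefF, coefG, dot; ring. Qed.

Lemma gram_det_E (x : R * R -> vec R) (p : R * R) :
  gram_det x p = coefE x p * coefG x p - coefF x p ^ 2.
Proof. reflexivity. Qed.

Lemma timelike_gram_neg (S : R * R -> Prop) (x : R * R -> vec R) (p : R * R) :
  timelike_surface S x -> S p -> 0 < coefF x p ^ 2 - coefE x p * coefG x p.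
Proof.
  intros [_ [_ H]] Hp; destruct (H p Hp) as [[[a1 a2] Ha] [[b1 b2] Hb]].
  rewrite dot_differential in Ha, Hb; simpl in Ha, Hb.
  set (E := coefE x p) in *; set (F := coefF x p) in *; set (G := coefG x p) in *.
  apply Rnot_le_lt; intros Hc.
  (* completing the square: if [E G - F^2 >= 0], then [E] times the metric is
     nonnegative on all vectors *)
  assert (Ka : 0 <= E * (a1 * a1 * E + (a1 * a2 + a2 * a1) * F + a2 * a2 * G)).
  { replace (E * _) with ((E * a1 + F * a2) ^ 2 + (E * G - F ^ 2) * a2 ^ 2) by ring.
    apply Rplus_le_le_0_compat; [apply pow2_ge_0 |].
    apply Rmult_le_pos; [lra | apply pow2_ge_0]. }
  assert (Kb : 0 <= E * (b1 * b1 * E + (b1 * b2 + b2 * b1) * F + b2 * b2 * G)).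
  { replace (E * _) with ((E * b1 + F * b2) ^ 2 + (E * G - F ^ 2) * b2 ^ 2) by ring.
    apply Rplus_le_le_0_compat; [apply pow2_ge_0 |].
    apply Rmult_le_pos; [lra | apply pow2_ge_0]. }
  destruct (Rtotal_order E 0) as [HE | [HE | HE]].
  - nra.
  - assert (HF : F = 0) by (rewrite HE in Hc; nra).
    rewrite HE, HF in Ha, Hb.
    assert (Pa := Rle_0_sqr a2); assert (Pb := Rle_0_sqr b2); unfold Rsqr in *; destruct (Rle_lt_dec 0 G); nra.
  - nra.
Qed.

Lemma normal_part_ext (x : R * R -> vec R) (p : R * R) (w w' : vec R) (i : idx) :
  (forall k, w k = w' k) -> normal_part x p w i = normal_part x p w' i.
Proof. intros H; unfold normal_part, tan_u, tan_v, dot; rewrite !H; reflexivity. Qed.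

Lemma normal_part_lin (x : R * R -> vec R) (p : R * R) (a b c : R) (w1 w2 w3 : vec R)
  (i : idx) :
  normal_part x p (fun k => a * w1 k + b * w2 k + c * w3 k) i =
  a * normal_part x p w1 i + b * normal_part x p w2 i + c * normal_part x p w3 i.
Proof.
  unfold normal_part, differential, tan_u, tan_v, dot, Rdiv; simpl; ring.
Qed.

Lemma second_form_coord (S : R * R -> Prop) (x : R * R -> vec R) (p a : R * R) (i : idx) :
  open S -> vec_smooth S x -> S p ->
  second_form x p a a i =
  normal_part x p (fun k => fst a ^ 2 * vec_uu x p k
    + 2 * fst a * snd a * vec_uv x p k + snd a ^ 2 * vec_vv x p k) i.
Proof.
  intros HS Hx Hp; unfold second_form; apply normal_part_ext; intros k.
  assert (Hu := smooth_partial_u _ _ HS (Hx k)).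
  assert (Hv := smooth_partial_v _ _ HS (Hx k)).
  assert (D := dif_plus _ _ _ _ _ _ _
    (dif_scal (fst a) _ _ _ _ (smooth_dif _ _ _ HS Hu Hp))
    (dif_scal (snd a) _ _ _ _ (smooth_dif _ _ _ HS Hv Hp))).
  destruct (dif_unique _ _ _ _ D) as [Du Dv].
  unfold differential at 1.
  change (vec_u (fun q => differential x q a) p k)
    with (partial_u (fun q => fst a * partial_u (fun r => x r k) q
                            + snd a * partial_v (fun r => x r k) q) p).
  change (vec_v (fun q => differential x q a) p k)
    with (partial_v (fun q => fst a * partial_u (fun r => x r k) q
                            + snd a * partial_v (fun r => x r k) q) p).
  rewrite Du, Dv, (smooth_schwarz S (fun r => x r k) p HS (Hx k) Hp).
  change (vec_uu x p k) with (partial_u (partial_u (fun r => x r k)) p).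
  change (vec_uv x p k) with (partial_u (partial_v (fun r => x r k)) p).
  change (vec_vv x p k) with (partial_v (partial_v (fun r => x r k)) p).
  ring.
Qed.

(** The vanishing of the mean curvature, with the metric contraction written
    in coordinates: for an orthonormal frame [(a, b)], the tensor
    [- a a^T + b b^T] is the inverse of the metric. *)
Lemma minimal_coord (S : R * R -> Prop) (x : R * R -> vec R) (p : R * R) (i : idx) :
  timelike_surface S x -> minimal S x -> S p ->
  normal_part x p (fun k => coefG x p * vec_uu x p k + (- 2 * coefF x p) * vec_uv x p k
    + coefE x p * vec_vv x p k) i = 0.
Proof.
  intros Ht Hm Hp; assert (HD := timelike_gram_neg S x p Ht Hp).
  destruct Ht as [[HS _] [[Hx _] Ht]]; destruct (Ht p Hp) as [[a0 Ha0] _].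
  rewrite dot_differential in Ha0.
  assert (Hn : forall a, second_form x p a a i =
    fst a ^ 2 * normal_part x p (vec_uu x p) i
    + 2 * fst a * snd a * normal_part x p (vec_uv x p) i
    + snd a ^ 2 * normal_part x p (vec_vv x p) i).
  { intros a; rewrite (second_form_coord S) by assumption; apply normal_part_lin. }
  rewrite normal_part_lin.
  set (E := coefE x p) in *; set (F := coefF x p) in *; set (G := coefG x p) in *.
  set (n1 := normal_part x p (vec_uu x p) i) in *.
  set (n2 := normal_part x p (vec_uv x p) i) in *.
  set (n3 := normal_part x p (vec_vv x p) i) in *.
  set (q := - (fst a0 * fst a0 * E + (fst a0 * snd a0 + snd a0 * fst a0) * F
     + snd a0 * snd a0 * G)) in *.
  assert (Hq : 0 < q) by (unfold q; lra).
  set (k := / sqrt q).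
  assert (Hk : k * k * q = 1).
  { unfold k; rewrite <- (sqrt_sqrt q) at 3 by lra; field.
    apply Rgt_not_eq, sqrt_lt_R0, Hq. }
  set (w := / sqrt (F ^ 2 - E * G)).
  assert (Hw : w * w * (F ^ 2 - E * G) = 1).
  { unfold w; rewrite <- (sqrt_sqrt (F ^ 2 - E * G)) at 3 by lra; field.
    apply Rgt_not_eq, sqrt_lt_R0, HD. }
  set (a1 := k * fst a0). set (a2 := k * snd a0).
  assert (HQ : a1 * a1 * E + (a1 * a2 + a2 * a1) * F + a2 * a2 * G = -1).
  { unfold a1, a2; transitivity (- (k * k * q)); [unfold q; ring | lra]. }
  set (b1 := - w * (F * a1 + G * a2)). set (b2 := w * (E * a1 + F * a2)).
  assert (T : / 2 * (- second_form x p (a1, a2) (a1, a2) i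
                     + second_form x p (b1, b2) (b1, b2) i) = 0).
  { apply Hm; [exact Hp | | |]; rewrite dot_differential; simpl;
      fold E F G.
    - exact HQ.
    - transitivity (- (w * w * (F ^ 2 - E * G)) *
        (a1 * a1 * E + (a1 * a2 + a2 * a1) * F + a2 * a2 * G)); [unfold b1, b2; ring |].
      rewrite Hw, HQ; ring.
    - unfold b1, b2; ring. }
  rewrite !Hn in T; simpl in T.
  assert (R1 : - a1 ^ 2 + b1 ^ 2 = - G * w ^ 2).
  { transitivity (- a1 ^ 2 * (w * w * (F ^ 2 - E * G)) + b1 ^ 2); [rewrite Hw; ring |].
    transitivity (G * w ^ 2 * (a1 * a1 * E + (a1 * a2 + a2 * a1) * F + a2 * a2 * G));
      [unfold b1; ring | rewrite HQ; ring]. }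
  assert (R2 : - (a1 * a2) + b1 * b2 = F * w ^ 2).
  { transitivity (- (a1 * a2) * (w * w * (F ^ 2 - E * G)) + b1 * b2); [rewrite Hw; ring |].
    transitivity (- F * w ^ 2 * (a1 * a1 * E + (a1 * a2 + a2 * a1) * F + a2 * a2 * G));
      [unfold b1, b2; ring | rewrite HQ; ring]. }
  assert (R3 : - a2 ^ 2 + b2 ^ 2 = - E * w ^ 2).
  { transitivity (- a2 ^ 2 * (w * w * (F ^ 2 - E * G)) + b2 ^ 2); [rewrite Hw; ring |].
    transitivity (E * w ^ 2 * (a1 * a1 * E + (a1 * a2 + a2 * a1) * F + a2 * a2 * G));
      [unfold b2; ring | rewrite HQ; ring]. }
  assert (T2 : (- a1 ^ 2 + b1 ^ 2) * n1 + 2 * (- (a1 * a2) + b1 * b2) * n2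
               + (- a2 ^ 2 + b2 ^ 2) * n3 = 0) by lra.
  rewrite R1, R2, R3 in T2.
  assert (Hw2 : w ^ 2 <> 0) by (intros Hc; simpl in Hc; rewrite Rmult_1_r in Hc; rewrite Hc in Hw; lra).
  apply (Rmult_eq_reg_l (w ^ 2)); [| exact Hw2]; lra.
Qed.

Lemma dif_dot (y z : R * R -> vec R) (p : R * R) (yu yv zu zv : vec R) :
  (forall i, dif (fun q => y q i) p (yu i) (yv i)) ->
  (forall i, dif (fun q => z q i) p (zu i) (zv i)) ->
  dif (fun q => dot (y q) (z q)) p (dot yu (z p) + dot (y p) zu) (dot yv (z p) + dot (y p) zv).
Proof.
  intros Hy Hz.
  assert (H : forall i, dif (fun q => y q i * z q i) p
    (yu i * z p i + y p i * zu i) (yv i * z p i + y p i * zv i)).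
  { intros i; apply (dif_mult (fun q => y q i) (fun q => z q i)); auto. }
  unfold dot; eapply dif_eq.
  - exact (dif_plus _ _ _ _ _ _ _ (dif_minus _ _ _ _ _ _ _
      (dif_plus _ _ _ _ _ _ _ (dif_opp _ _ _ _ (H i1)) (H i2)) (H i3)) (H i4)).
  - simpl; ring.
  - simpl; ring.
Qed.

Lemma smooth_dot (S : R * R -> Prop) (y z : R * R -> vec R) :
  open S -> vec_smooth S y -> vec_smooth S z -> smooth_on S (fun q => dot (y q) (z q)).
Proof.
  intros HS Hy Hz.
  assert (H : forall i, smooth_on S (fun q => y q i * z q i)).
  { intros i; apply (smooth_mult S (fun q => y q i) (fun q => z q i)); auto. }
  unfold dot.
  apply (smooth_plus S _ _ HS (smooth_minus S _ _ HS
    (smooth_plus S _ _ HS (smooth_opp S _ HS (H i1)) (H i2)) (H i3)) (H i4)).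
Qed.

Lemma vec_smooth_u (S : R * R -> Prop) (x : R * R -> vec R) :
  open S -> vec_smooth S x -> vec_smooth S (vec_u x).
Proof. intros HS H i; apply (smooth_partial_u S (fun q => x q i)), H; exact HS. Qed.

Lemma vec_smooth_v (S : R * R -> Prop) (x : R * R -> vec R) :
  open S -> vec_smooth S x -> vec_smooth S (vec_v x).
Proof. intros HS H i; apply (smooth_partial_v S (fun q => x q i)), H; exact HS. Qed.

Lemma vec_dif (S : R * R -> Prop) (x : R * R -> vec R) (p : R * R) :
  open S -> vec_smooth S x -> S p ->
  forall i, dif (fun q => x q i) p (vec_u x p i) (vec_v x p i).
Proof. intros HS H Hp i; apply (smooth_dif S (fun q => x q i)); auto. Qed.

Lemma vec_vu (S : R * R -> Prop) (x : R * R -> vec R) (p : R * R) (i : idx) :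
  open S -> vec_smooth S x -> S p -> vec_v (vec_u x) p i = vec_uv x p i.
Proof. intros HS H Hp; apply (smooth_schwarz S (fun q => x q i)); auto. Qed.

Definition area (x : R * R -> vec R) (p : R * R) : R := sqrt (coefF x p ^ 2 - coefE x p * coefG x p).

(** [(star_u x p i, star_v x p i)] are the components of [* dx_i], where [*]
    is composition with the endomorphism [J] of the tangent plane such that
    [J^2 = 1], [J X] is orthogonal to [X] and [(J X)^2 = - X^2]; the null
    directions are the eigendirections of [J]. *)
Definition star_u (x : R * R -> vec R) (p : R * R) (i : idx) : R :=
  (- coefF x p * vec_u x p i + coefE x p * vec_v x p i) * / area x p.
Definition star_v (x : R * R -> vec R) (p : R * R) (i : idx) : R :=
  (- coefG x p * vec_u x p i + coefF x p * vec_v x p i) * / area x p.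

Lemma smooth_D (S : R * R -> Prop) (x : R * R -> vec R) : open S -> vec_smooth S x ->
  smooth_on S (fun p => coefF x p ^ 2 - coefE x p * coefG x p).
Proof.
  intros HS Hx.
  assert (Hu := vec_smooth_u S x HS Hx). assert (Hv := vec_smooth_v S x HS Hx).
  assert (SE : smooth_on S (coefE x)) by (apply smooth_dot; assumption).
  assert (SF : smooth_on S (coefF x)) by (apply smooth_dot; assumption).
  assert (SG : smooth_on S (coefG x)) by (apply smooth_dot; assumption).
  apply (smooth_ext S (fun p => coefF x p * coefF x p - coefE x p * coefG x p)); [exact HS | intros; ring |].
  apply smooth_minus; [exact HS | |]; apply smooth_mult; assumption.
Qed.

Lemma smooth_star (S : R * R -> Prop) (x : R * R -> vec R) (i : idx) :
  open S -> vec_smooth S x -> (forall p, S p -> 0 < coefF x p ^ 2 - coefE x p * coefG x p) ->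
  smooth_on S (fun p => star_u x p i) /\ smooth_on S (fun p => star_v x p i).
Proof.
  intros HS Hx HD.
  assert (Hu := vec_smooth_u S x HS Hx). assert (Hv := vec_smooth_v S x HS Hx).
  assert (SE : smooth_on S (coefE x)) by (apply smooth_dot; assumption).
  assert (SF : smooth_on S (coefF x)) by (apply smooth_dot; assumption).
  assert (SG : smooth_on S (coefG x)) by (apply smooth_dot; assumption).
  assert (SW : smooth_on S (fun p => / area x p)).
  { apply smooth_inv; [exact HS | | apply smooth_sqrt; try assumption; apply smooth_D; assumption].
    intros p Hp; apply Rgt_not_eq, sqrt_lt_R0, HD, Hp. }
  split; (apply smooth_mult; [exact HS | | exact SW]);
    (apply smooth_plus; [exact HS | |]);
    apply smooth_mult; try exact HS; try apply smooth_opp; try assumption;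
    first [apply Hu | apply Hv].
Qed.

(** Up to a factor, the exterior derivative of [*dx_i] is the [i]-th component
    of the metric contraction of the second derivatives of [x] plus tangential
    terms from the derivatives of the metric. The normal part of this vector
    vanishes by minimality, and its tangential part is zero identically. *)
Lemma star_closed (S : R * R -> Prop) (x : R * R -> vec R) (p : R * R) (i : idx) :
  timelike_surface S x -> minimal S x -> S p ->
  partial_v (fun q => star_u x q i) p = partial_u (fun q => star_v x q i) p.
Proof.
  intros Ht Hm Hp; assert (HD := timelike_gram_neg S x p Ht Hp).
  assert (HN := minimal_coord S x p i Ht Hm Hp).
  destruct Ht as [[HS _] [[Hx _] _]].
  assert (Hu := vec_smooth_u S x HS Hx). assert (Hv := vec_smooth_v S x HS Hx).
  assert (DX : forall j, dif (fun q => vec_u x q j) p (vec_uu x p j) (vec_uv x p j)).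
  { intros j; rewrite <- (vec_vu S) by assumption; apply (vec_dif S); assumption. }
  assert (DY : forall j, dif (fun q => vec_v x q j) p (vec_uv x p j) (vec_vv x p j)).
  { apply (vec_dif S); assumption. }
  assert (DE := dif_dot _ _ _ _ _ _ _ DX DX).
  assert (DF := dif_dot _ _ _ _ _ _ _ DX DY).
  assert (DG := dif_dot _ _ _ _ _ _ _ DY DY).
  change (fun q => dot (vec_u x q) (vec_u x q)) with (coefE x) in DE.
  change (fun q => dot (vec_u x q) (vec_v x q)) with (coefF x) in DF.
  change (fun q => dot (vec_v x q) (vec_v x q)) with (coefG x) in DG.
  assert (DD := dif_minus _ _ _ _ _ _ _ (dif_mult _ _ _ _ _ _ _ DF DF) (dif_mult _ _ _ _ _ _ _ DE DG)).
  assert (HD1 : 0 < coefF x p * coefF x p - coefE x p * coefG x p) by lra.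
  assert (DW := dif_sqrt _ _ _ _ HD1 DD).
  assert (HW0 : 0 < sqrt (coefF x p * coefF x p - coefE x p * coefG x p)) by (apply sqrt_lt_R0, HD1).
  assert (DI := dif_inv _ _ _ _ (Rgt_not_eq _ _ HW0) DW).
  assert (DI' : dif (fun q => / area x q) p
     (- (/ sqrt (coefF x p * coefF x p - coefE x p * coefG x p) * / sqrt (coefF x p * coefF x p - coefE x p * coefG x p)) *
        (/ 2 * / sqrt (coefF x p * coefF x p - coefE x p * coefG x p) *
       ((dot (vec_uu x p) (vec_v x p) + dot (vec_u x p) (vec_uv x p)) * coefF x p
        + coefF x p * (dot (vec_uu x p) (vec_v x p) + dot (vec_u x p) (vec_uv x p))
        - ((dot (vec_uu x p) (vec_u x p) + dot (vec_u x p) (vec_uu x p)) * coefG x p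
           + coefE x p * (dot (vec_uv x p) (vec_v x p) + dot (vec_v x p) (vec_uv x p))))))
     (- (/ sqrt (coefF x p * coefF x p - coefE x p * coefG x p) * / sqrt (coefF x p * coefF x p - coefE x p * coefG x p)) *
        (/ 2 * / sqrt (coefF x p * coefF x p - coefE x p * coefG x p) *
       ((dot (vec_uv x p) (vec_v x p) + dot (vec_u x p) (vec_vv x p)) * coefF x p
        + coefF x p * (dot (vec_uv x p) (vec_v x p) + dot (vec_u x p) (vec_vv x p))
        - ((dot (vec_uv x p) (vec_u x p) + dot (vec_u x p) (vec_uv x p)) * coefG x p
           + coefE x p * (dot (vec_vv x p) (vec_v x p) + dot (vec_v x p) (vec_vv x p))))))).
  { eapply dif_ext; [| exact DI].
    exists (mkposreal 1 Rlt_0_1); intros q _ _; unfold area; do 2 f_equal; ring. }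
  assert (D1 := dif_mult _ _ _ _ _ _ _ (dif_plus _ _ _ _ _ _ _
    (dif_mult _ _ _ _ _ _ _ (dif_opp _ _ _ _ DF) (DX i)) (dif_mult _ _ _ _ _ _ _ DE (DY i))) DI').
  assert (D2 := dif_mult _ _ _ _ _ _ _ (dif_plus _ _ _ _ _ _ _
    (dif_mult _ _ _ _ _ _ _ (dif_opp _ _ _ _ DG) (DX i)) (dif_mult _ _ _ _ _ _ _ DF (DY i))) DI').
  rewrite (proj2 (dif_unique (fun q => star_u x q i) _ _ _ D1)).
  rewrite (proj1 (dif_unique (fun q => star_v x q i) _ _ _ D2)).
  clear D1 D2 DI DI' DW DD DE DF DG DX DY.
  revert HN; unfold normal_part, differential, tan_u, tan_v; simpl.
  rewrite gram_det_E; fold (coefE x p) (coefF x p) (coefG x p).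
  unfold area; replace (coefF x p ^ 2 - coefE x p * coefG x p) with (coefF x p * coefF x p - coefE x p * coefG x p) by ring.
  set (X := vec_u x p) in *; set (Y := vec_v x p) in *.
  set (A := vec_uu x p); set (B := vec_uv x p); set (C := vec_vv x p).
  assert (ED : forall Z, dot (fun k => coefG x p * A k + - 2 * coefF x p * B k + coefE x p * C k) Z =
    coefG x p * dot A Z - 2 * coefF x p * dot B Z + coefE x p * dot C Z).
  { intros Z; unfold dot; ring. }
  rewrite !ED, (dot_sym X A), (dot_sym X B), (dot_sym X C), (dot_sym Y B), (dot_sym Y C).
  generalize (dot A X) (dot A Y) (dot B X) (dot B Y) (dot C X) (dot C Y).
  revert HW0 HD1; generalize (coefE x p) (coefF x p) (coefG x p).
  generalize (X i) (Y i) (A i) (B i) (C i).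
  clear; intros Xi Yi Ai Bi Ci E F G HW HD a1 a2 b1 b2 c1 c2 HN.
  assert (HWW := sqrt_sqrt _ (Rlt_le _ _ HD)).
  set (W := sqrt (F * F - E * G)) in *.
  assert (HAi : G * Ai = 2 * F * Bi - E * Ci
    - ((G * (G * a1 - 2 * F * b1 + E * c1) - F * (G * a2 - 2 * F * b2 + E * c2)) * Xi
       + (E * (G * a2 - 2 * F * b2 + E * c2) - F * (G * a1 - 2 * F * b1 + E * c1)) * Yi)
      / (W * W)).
  { rewrite HWW; apply (Rplus_eq_reg_r (- (2 * F) * Bi + E * Ci)).
    apply Rminus_diag_uniq; rewrite <- HN; field; split; lra. }
  apply Rminus_diag_uniq.
  transitivity ((G * Ai - 2 * F * Bi + E * Ci
    + ((G * (G * a1 - 2 * F * b1 + E * c1) - F * (G * a2 - 2 * F * b2 + E * c2)) * Xi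
       + (E * (G * a2 - 2 * F * b2 + E * c2) - F * (G * a1 - 2 * F * b1 + E * c1)) * Yi)
      / (W * W)) / W); [| rewrite HAi; field; lra].
  apply (Rmult_eq_reg_r (W * W * W)); [| apply Rgt_not_eq; repeat apply Rmult_lt_0_compat; exact HW].
  transitivity
    ((- (b2 + c1) * Xi - F * Bi + 2 * b1 * Yi + E * Ci
      - (- (2 * b2) * Xi - G * Ai + (a2 + b1) * Yi + F * Bi)) * (W * W)
     - / 2 * (2 * F * (b2 + c1) - (2 * b1 * G + 2 * E * c2)) * (- F * Xi + E * Yi)
     + / 2 * (2 * F * (a2 + b1) - (2 * a1 * G + 2 * E * b2)) * (- G * Xi + F * Yi));
    [field; lra |].
  transitivity
    ((G * Ai - 2 * F * Bi + E * Ci) * (W * W)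
     + (G * (G * a1 - 2 * F * b1 + E * c1) - F * (G * a2 - 2 * F * b2 + E * c2)) * Xi
     + (E * (G * a2 - 2 * F * b2 + E * c2) - F * (G * a1 - 2 * F * b1 + E * c1)) * Yi);
    [rewrite HWW; field | field; lra].
Qed.

(** * Null coordinates *)

Definition vel (a : R -> vec R) (s : R) : vec R := fun i => Derive (fun r => a r i) s.

Definition null_chart (S : R * R -> Prop) (x : R * R -> vec R) (U : R * R -> Prop)
  (c : R * R) (e : R) (phi psi : R * R -> R * R) (a b : R -> vec R) : Prop :=
  inverse_pair S U c e phi psi /\
  (forall i, smooth1 (fst c) e (fun s => a s i)) /\
  (forall i, smooth1 (snd c) e (fun t => b t i)) /\
  (forall q, square c e q -> forall i, x (phi q) i = a (fst q) i + b (snd q) i) /\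
  (forall s, Rabs (s - fst c) < e -> dot (vel a s) (vel a s) = 0) /\
  (forall t, Rabs (t - snd c) < e -> dot (vel b t) (vel b t) = 0) /\
  (forall q, square c e q -> dot (vel a (fst q)) (vel b (snd q)) <> 0).

Lemma idx_choice (A : Type) (P : idx -> A -> Prop) :
  (forall i, exists y, P i y) -> exists f, forall i, P i (f i).
Proof.
  intros H.
  destruct (H i1) as [y1 H1]; destruct (H i2) as [y2 H2].
  destruct (H i3) as [y3 H3]; destruct (H i4) as [y4 H4].
  exists (fun i => match i with i1 => y1 | i2 => y2 | i3 => y3 | i4 => y4 end).
  intros []; assumption.
Qed.

Lemma const_in_v (c : R * R) (e : R) (f A : R * R -> R) :
  (forall q, square c e q -> dif f q (A q) 0) ->
  forall q, square c e q -> f q = f (fst q, snd c).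
Proof.
  intros H [s t] Hq; destruct c as [s0 t0]; simpl.
  destruct (MVT_gen (fun r => f (s, r)) t0 t (fun _ => 0)) as [z [Hz1 Hz2]].
  - intros r Hr; apply (dif_is_derive_v f (s, r) (A (s, r))), H; split; [apply Hq |].
    apply (interval_between t0 e t); [apply Hq | simpl; lra].
  - intros r Hr; apply continuity_pt_filterlim, cont_slice_v, (dif_cont f _ (A (s, r)) 0), H.
    split; [apply Hq | apply (interval_between t0 e t); [apply Hq | exact Hr]].
  - lra.
Qed.

Lemma const_in_u (c : R * R) (e : R) (f A : R * R -> R) :
  (forall q, square c e q -> dif f q 0 (A q)) ->
  forall q, square c e q -> f q = f (fst c, snd q).
Proof.
  intros H [s t] Hq; destruct c as [s0 t0]; simpl.
  destruct (MVT_gen (fun r => f (r, t)) s0 s (fun _ => 0)) as [z [Hz1 Hz2]].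
  - intros r Hr; apply (dif_is_derive_u f (r, t) _ (A (r, t))), H; split; [| apply Hq].
    apply (interval_between s0 e s); [apply Hq | simpl; lra].
  - intros r Hr; apply continuity_pt_filterlim, cont_slice_u, (dif_cont f _ 0 (A (r, t))), H.
    split; [apply (interval_between s0 e s); [apply Hq | exact Hr] | apply Hq].
  - lra.
Qed.

Lemma smooth_map_dif (V : R * R -> Prop) (phi : R * R -> R * R) (q : R * R) :
  open V -> smooth_map V phi -> V q -> exists ps pt qs qt,
  dif (fun r => fst (phi r)) q ps pt /\ dif (fun r => snd (phi r)) q qs qt.
Proof.
  intros HV [H1 H2] Hq; do 4 eexists; split; apply (smooth_dif V); assumption.
Qed.

Lemma dif_comp_map (f : R * R -> R) (phi : R * R -> R * R) (q : R * R)
  (a b ps pt qs qt : R) :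
  dif f (phi q) a b -> dif (fun r => fst (phi r)) q ps pt ->
  dif (fun r => snd (phi r)) q qs qt ->
  dif (fun r => f (phi r)) q (a * ps + b * qs) (a * pt + b * qt).
Proof.
  intros Hf H1 H2; apply (dif_ext (fun r => f (fst (phi r), snd (phi r)))).
  - exists (mkposreal 1 Rlt_0_1); intros r _ _; rewrite <- surjective_pairing; reflexivity.
  - apply dif_comp; [rewrite <- surjective_pairing |..]; assumption.
Qed.

Lemma smooth_comp_map (S V : R * R -> Prop) (f : R * R -> R) (phi : R * R -> R * R) :
  open S -> open V -> (forall q, V q -> S (phi q)) -> smooth_on S f -> smooth_map V phi ->
  smooth_on V (fun r => f (phi r)).
Proof.
  intros HS HV H Hf [H1 H2].
  apply (smooth_ext V (fun r => f (fst (phi r), snd (phi r)))); [exact HV | |].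
  - intros r _; rewrite <- surjective_pairing; reflexivity.
  - apply (smooth_comp S); try assumption.
    intros r Hr; rewrite <- surjective_pairing; auto.
Qed.

(** The covectors [dx + *dx] and [dx - *dx] are eigencovectors of [J]. *)
Lemma star_eigen (x : R * R -> vec R) (p : R * R) (i : idx) :
  0 < coefF x p ^ 2 - coefE x p * coefG x p ->
  coefE x p * (vec_v x p i + star_v x p i) = (coefF x p + area x p) * (vec_u x p i + star_u x p i) /\
  coefG x p * (vec_u x p i + star_u x p i) = (coefF x p - area x p) * (vec_v x p i + star_v x p i) /\
  coefE x p * (vec_v x p i - star_v x p i) = (coefF x p - area x p) * (vec_u x p i - star_u x p i) /\
  coefG x p * (vec_u x p i - star_u x p i) = (coefF x p + area x p) * (vec_v x p i - star_v x p i).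
Proof.
  intros HD; unfold star_u, star_v.
  assert (HW : 0 < area x p) by (apply sqrt_lt_R0, HD).
  assert (HWW : area x p * area x p = coefF x p ^ 2 - coefE x p * coefG x p)
    by (apply sqrt_sqrt; lra).
  set (E := coefE x p) in *; set (F := coefF x p) in *; set (G := coefG x p) in *.
  set (W := area x p) in *; set (X := vec_u x p i); set (Y := vec_v x p i).
  assert (HEG : E * G = F ^ 2 - W * W) by lra.
  repeat split; apply (Rmult_eq_reg_r W); try lra.
  - transitivity (E * Y * W + (- (E * G) * X + F * E * Y)); [field; lra |].
    rewrite HEG; field; lra.
  - transitivity (G * X * W + (- F * G * X + E * G * Y)); [field; lra |].
    rewrite HEG; field; lra.
  - transitivity (E * Y * W - (- (E * G) * X + F * E * Y)); [field; lra |].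
    rewrite HEG; field; lra.
  - transitivity (G * X * W - (- F * G * X + E * G * Y)); [field; lra |].
    rewrite HEG; field; lra.
Qed.

Lemma eigen_proportional (E F G W a b a' b' : R) : 0 < W ->
  E * b = (F + W) * a -> G * a = (F - W) * b ->
  E * b' = (F + W) * a' -> G * a' = (F - W) * b' -> a' * b = b' * a.
Proof.
  intros HW H1 H2 H3 H4.
  assert (K1 : (F + W) * (a' * b - b' * a) = 0).
  { transitivity ((F + W) * a' * b - b' * ((F + W) * a)); [ring |].
    rewrite <- H1, <- H3; ring. }
  assert (K2 : (F - W) * (a' * b - b' * a) = 0).
  { transitivity (a' * ((F - W) * b) - ((F - W) * b') * a); [ring |].
    rewrite <- H2, <- H4; ring. }
  assert (K3 : 2 * W * (a' * b - b' * a) = 0) by lra.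
  apply Rmult_integral in K3; destruct K3; lra.
Qed.

(** Eigencovectors of [J] for different eigenvalues are independent. *)
Lemma eigen_transverse (E F G W a b a' b' : R) : 0 < W ->
  E * b = (F + W) * a -> G * a = (F - W) * b ->
  E * b' = (F - W) * a' -> G * a' = (F + W) * b' ->
  (a <> 0 \/ b <> 0) -> (a' <> 0 \/ b' <> 0) -> a * b' - b * a' <> 0.
Proof.
  intros HW H1 H2 H3 H4 Hab Hab' HJ.
  assert (K1 : W * (a * a') = 0).
  { assert (T : E * (a * b' - b * a') = - 2 * (W * (a * a'))).
    { transitivity (a * (E * b') - E * b * a'); [ring | rewrite H1, H3; ring]. }
    rewrite HJ in T; lra. }
  assert (K2 : W * (b * b') = 0).
  { assert (T : G * (a * b' - b * a') = - 2 * (W * (b * b'))).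
    { transitivity (G * a * b' - b * (G * a')); [ring | rewrite H2, H4; ring]. }
    rewrite HJ in T; lra. }
  apply Rmult_integral in K1, K2.
  destruct K1 as [K1 | K1]; [lra |]; destruct K2 as [K2 | K2]; [lra |].
  apply Rmult_integral in K1, K2.
  assert (J2 : a * b' = b * a') by lra.
  destruct (Req_dec a 0) as [Ha | Ha].
  - assert (Hb : b <> 0) by (destruct Hab; [contradiction | assumption]).
    destruct K2 as [K2 | K2]; [contradiction |].
    rewrite K2, Rmult_0_r in J2; symmetry in J2; apply Rmult_integral in J2.
    destruct J2; [contradiction |]; destruct Hab'; contradiction.
  - destruct K1 as [K1 | K1]; [contradiction |].
    rewrite K1, Rmult_0_r in J2; apply Rmult_integral in J2.
    destruct J2; [contradiction |]; destruct Hab'; contradiction.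
Qed.

(** The kernel of an eigencovector of [J] is an eigendirection, hence null. *)
Lemma annihilator_null (E F G W a b p q : R) :
  (E * b = (F + W) * a /\ G * a = (F - W) * b) -> a * p + b * q = 0 ->
  (a <> 0 \/ b <> 0) -> p * p * E + (p * q + q * p) * F + q * q * G = 0.
Proof.
  intros [H1 H2] H Hab.
  destruct Hab as [Ha | Hb].
  - apply (Rmult_eq_reg_l (a * a)); [| apply Rmult_integral_contrapositive; tauto].
    rewrite Rmult_0_r.
    transitivity ((a * p) * (a * p) * E + 2 * (a * p) * (q * (a * F)) + q * q * a * (G * a)); [ring |].
    replace (a * p) with (- (b * q)) by lra; rewrite H2.
    transitivity (q * q * b * (E * b - 2 * F * a + (F - W) * a)); [ring | rewrite H1; ring].
  - apply (Rmult_eq_reg_l (b * b)); [| apply Rmult_integral_contrapositive; tauto].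
    rewrite Rmult_0_r.
    transitivity ((b * q) * (b * q) * G + 2 * (b * q) * (p * (b * F)) + p * p * b * (E * b)); [ring |].
    replace (b * q) with (- (a * p)) by lra; rewrite H1.
    transitivity (p * p * a * (G * a - 2 * F * b + (F + W) * b)); [ring | rewrite H2; ring].
Qed.

(** If all [dx_i + sg *dx_i] vanished at [p], the differential of [x] would
    vanish on the image of [1 + sg J], which is not zero. *)
Lemma eigen_nonzero (S : R * R -> Prop) (x : R * R -> vec R) (p : R * R) (sg : R) :
  immersion S x -> S p -> 0 < coefF x p ^ 2 - coefE x p * coefG x p -> sg * sg = 1 ->
  exists i, vec_u x p i + sg * star_u x p i <> 0 \/ vec_v x p i + sg * star_v x p i <> 0.
Proof.
  intros [_ Him] Hp HD Hsg.
  apply NNPP; intros Hno.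
  assert (HW : 0 < area x p) by (apply sqrt_lt_R0, HD).
  assert (H0 : forall i, vec_u x p i + sg * star_u x p i = 0
                      /\ vec_v x p i + sg * star_v x p i = 0).
  { intros i; split; apply NNPP; intros Hc; apply Hno; exists i; tauto. }
  assert (A1 : (1 - sg * coefF x p / area x p, sg * coefE x p / area x p) = (0, 0)).
  { apply (Him p Hp); intros i; unfold differential; simpl.
    rewrite <- (proj1 (H0 i)); unfold star_u; field; lra. }
  assert (A2 : (- sg * coefG x p / area x p, 1 + sg * coefF x p / area x p) = (0, 0)).
  { apply (Him p Hp); intros i; unfold differential; simpl.
    rewrite <- (proj2 (H0 i)); unfold star_v; field; lra. }
  injection A1 as A1 _; injection A2 as _ A2; lra.
Qed.

(** On a minimal surface each 1-form [dx_i + *dx_i] is closed, and a multiple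
    of one fixed null covector; so its primitives [xi_i] are functions of a
    single null coordinate, and one of them can serve as this coordinate.
    Likewise for the primitives [eta_i] of [dx_i - *dx_i]. *)
Lemma exists_null_chart (S : R * R -> Prop) (x : R * R -> vec R) (p0 : R * R) :
  timelike_surface S x -> minimal S x -> S p0 ->
  exists U c e phi psi a b, U p0 /\ psi p0 = c /\ null_chart S x U c e phi psi a b.
Proof.
  intros Ht Hm Hp0.
  assert (HDS := fun p => timelike_gram_neg S x p Ht).
  assert (Hcl := fun p i => star_closed S x p i Ht Hm).
  destruct Ht as [[HS _] [Him _]]; assert (Hx := proj1 Him).
  destruct (proj1 (near_square _ _) (open_near _ _ HS Hp0)) as [r [Hr Hsub]].
  set (Q := square p0 r) in *.
  assert (HQ : open Q) by apply open_square.
  assert (HQ0 : Q p0) by apply square_center, Hr.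
  assert (Hst := fun i => smooth_star S x i HS Hx HDS).
  destruct (idx_choice _ (fun i y => smooth_on Q y /\
     forall p, Q p -> dif y p (star_u x p i) (star_v x p i))) as [y Hy].
  { intros i; destruct (closed_form_exact p0 r (fun p => star_u x p i) (fun p => star_v x p i))
      as [y Hy].
    - apply (smooth_sub S); [exact Hsub | apply Hst].
    - apply (smooth_sub S); [exact Hsub | apply Hst].
    - intros p Hp; apply Hcl, Hsub, Hp.
    - exists y; exact Hy. }
  set (xi := fun i p => x p i + y i p). set (eta := fun i p => x p i - y i p).
  assert (Dxi : forall i p, Q p ->
    dif (xi i) p (vec_u x p i + star_u x p i) (vec_v x p i + star_v x p i)).
  { intros i p Hp; apply dif_plus; [apply (vec_dif S); auto | apply Hy, Hp]. }
  assert (Deta : forall i p, Q p ->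
    dif (eta i) p (vec_u x p i - star_u x p i) (vec_v x p i - star_v x p i)).
  { intros i p Hp; apply dif_minus; [apply (vec_dif S); auto | apply Hy, Hp]. }
  assert (Sxi : forall i, smooth_on Q (xi i)).
  { intros i; apply smooth_plus; [exact HQ | apply (smooth_sub S); [exact Hsub | apply Hx] | apply Hy]. }
  assert (Seta : forall i, smooth_on Q (eta i)).
  { intros i; apply smooth_minus; [exact HQ | apply (smooth_sub S); [exact Hsub | apply Hx] | apply Hy]. }
  assert (HD0 := HDS p0 Hp0).
  destruct (eigen_nonzero S x p0 1 Him Hp0 HD0 ltac:(ring)) as [i Hi].
  destruct (eigen_nonzero S x p0 (-1) Him Hp0 HD0 ltac:(ring)) as [k Hk].
  assert (HJ : jac (xi i) (eta k) p0 <> 0).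
  { unfold jac.
    destruct (dif_unique _ _ _ _ (Dxi i p0 HQ0)) as [-> ->].
    destruct (dif_unique _ _ _ _ (Deta k p0 HQ0)) as [-> ->].
    destruct (star_eigen x p0 i HD0) as [E1 [E2 _]].
    destruct (star_eigen x p0 k HD0) as [_ [_ [E3 E4]]].
    apply (eigen_transverse (coefE x p0) (coefF x p0) (coefG x p0) (area x p0)); try assumption.
    - apply sqrt_lt_R0, HD0.
    - lra.
    - lra. }
  destruct (local_inverse Q (xi i) (eta k) p0 HQ (Sxi i) (Seta k) HQ0 HJ)
    as (U & e & phi & HU & HUo & He & HUQ & Hphi & HVU & Hpsi & HUV & Hinv1 & Hinv2).
  set (c := (xi i p0, eta k p0)) in *.
  assert (HV : open (square c e)) by apply open_square.
  assert (Hcc : square c e c) by apply square_center, He.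
  (* The chain rule for [xi i (phi q) = fst q] and [eta k (phi q) = snd q]
     makes [xi i] and [eta k] the coordinate functions; proportionality of
     covectors carries the vanishing derivatives over to all other indices. *)
  assert (Hjac : forall q, square c e q -> exists ps pt qs qt,
    dif (fun r => fst (phi r)) q ps pt /\ dif (fun r => snd (phi r)) q qs qt /\
    (forall j, (vec_u x (phi q) j + star_u x (phi q) j) * pt
             + (vec_v x (phi q) j + star_v x (phi q) j) * qt = 0) /\
    (forall j, (vec_u x (phi q) j - star_u x (phi q) j) * ps
             + (vec_v x (phi q) j - star_v x (phi q) j) * qs = 0) /\
    ps * ps * coefE x (phi q) + (ps * qs + qs * ps) * coefF x (phi q) + qs * qs * coefG x (phi q) = 0 /\
    pt * pt * coefE x (phi q) + (pt * qt + qt * pt) * coefF x (phi q) + qt * qt * coefG x (phi q) = 0 /\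
    ps * qt - pt * qs <> 0).
  { intros q Hq.
    destruct (smooth_map_dif _ _ _ HV Hphi Hq) as (ps & pt & qs & qt & D1 & D2).
    exists ps, pt, qs, qt; split; [exact D1 |]; split; [exact D2 |].
    assert (HQq := HUQ _ (HVU q Hq)).
    assert (HDq := HDS _ (Hsub _ HQq)).
    assert (HW : 0 < area x (phi q)) by (apply sqrt_lt_R0, HDq).
    assert (C1 := dif_comp_map _ _ _ _ _ _ _ _ _ (Dxi i _ HQq) D1 D2).
    assert (C2 := dif_comp_map _ _ _ _ _ _ _ _ _ (Deta k _ HQq) D1 D2).
    assert (C1' : dif (fun r => xi i (phi r)) q 1 0).
    { apply (dif_ext (fun r => fst r)); [| apply dif_fst].
      apply (near_imp q (square c e)); [| apply open_near; assumption].
      intros z Hz; rewrite <- (Hinv1 z Hz) at 1; reflexivity. }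
    assert (C2' : dif (fun r => eta k (phi r)) q 0 1).
    { apply (dif_ext (fun r => snd r)); [| apply dif_snd].
      apply (near_imp q (square c e)); [| apply open_near; assumption].
      intros z Hz; rewrite <- (Hinv1 z Hz) at 1; reflexivity. }
    assert (M1 := proj1 (dif_unique _ _ _ _ C1)); rewrite (proj1 (dif_unique _ _ _ _ C1')) in M1.
    assert (M2 := proj2 (dif_unique _ _ _ _ C1)); rewrite (proj2 (dif_unique _ _ _ _ C1')) in M2.
    assert (M3 := proj1 (dif_unique _ _ _ _ C2)); rewrite (proj1 (dif_unique _ _ _ _ C2')) in M3.
    assert (M4 := proj2 (dif_unique _ _ _ _ C2)); rewrite (proj2 (dif_unique _ _ _ _ C2')) in M4.
    clear C1 C2 C1' C2'.
    destruct (star_eigen x (phi q) i HDq) as [E1 [E2 _]].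
    destruct (star_eigen x (phi q) k HDq) as [_ [_ [E3 E4]]].
    assert (EJ1 := fun j => proj1 (star_eigen x (phi q) j HDq)).
    assert (EJ2 := fun j => proj1 (proj2 (star_eigen x (phi q) j HDq))).
    assert (EJ3 := fun j => proj1 (proj2 (proj2 (star_eigen x (phi q) j HDq)))).
    assert (EJ4 := fun j => proj2 (proj2 (proj2 (star_eigen x (phi q) j HDq)))).
    set (E := coefE x (phi q)) in *; set (F := coefF x (phi q)) in *; set (G := coefG x (phi q)) in *.
    set (W := area x (phi q)) in *.
    set (a := vec_u x (phi q) i + star_u x (phi q) i) in *.
    set (b := vec_v x (phi q) i + star_v x (phi q) i) in *.
    set (a' := vec_u x (phi q) k - star_u x (phi q) k) in *.
    set (b' := vec_v x (phi q) k - star_v x (phi q) k) in *.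
    assert (Hab : a <> 0 \/ b <> 0).
    { destruct (Req_dec a 0) as [Ha | Ha]; [right | left; exact Ha].
      intros Hb; rewrite Ha, Hb in M1; lra. }
    assert (Hab' : a' <> 0 \/ b' <> 0).
    { destruct (Req_dec a' 0) as [Ha | Ha]; [right | left; exact Ha].
      intros Hb; rewrite Ha, Hb in M4; lra. }
    split; [| split; [| split; [| split]]].
    - intros j.
      assert (K := eigen_proportional E F G W a b _ _ HW E1 E2 (EJ1 j) (EJ2 j)).
      set (aj := vec_u x (phi q) j + star_u x (phi q) j) in *.
      set (bj := vec_v x (phi q) j + star_v x (phi q) j) in *.
      transitivity ((aj * pt + bj * qt) * (a * ps + b * qs)); [rewrite <- M1; ring |].
      transitivity ((a * pt + b * qt) * (aj * ps + bj * qs) +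
         (bj * a - aj * b) * (qt * ps - pt * qs)); [ring |].
      rewrite <- M2, K; ring.
    - intros j.
      assert (K' : (vec_u x (phi q) j - star_u x (phi q) j) * b'
                 = (vec_v x (phi q) j - star_v x (phi q) j) * a').
      { assert (T := eigen_proportional G F E W b' a' (vec_v x (phi q) j - star_v x (phi q) j)
                     (vec_u x (phi q) j - star_u x (phi q) j) HW E4 E3 (EJ4 j) (EJ3 j)).
        lra. }
      set (aj := vec_u x (phi q) j - star_u x (phi q) j) in *.
      set (bj := vec_v x (phi q) j - star_v x (phi q) j) in *.
      transitivity ((aj * ps + bj * qs) * (a' * pt + b' * qt)); [rewrite <- M4; ring |].
      transitivity ((a' * ps + b' * qs) * (aj * pt + bj * qt) +
         (bj * a' - aj * b') * (qs * pt - ps * qt)); [ring |].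
      rewrite <- M3, K'; ring.
    - apply (annihilator_null E F G (- W) a' b'); [split; lra | lra | exact Hab'].
    - apply (annihilator_null E F G W a b); [split; lra | lra | exact Hab].
    - intros Hz.
      assert (T : (a * ps + b * qs) * (a' * pt + b' * qt)
         - (a * pt + b * qt) * (a' * ps + b' * qs) = (a * b' - b * a') * (ps * qt - pt * qs)) by ring.
      rewrite Hz, <- M1, <- M2, <- M3, <- M4 in T; lra. }
  assert (Cxi : forall j q, square c e q -> xi j (phi q) = xi j (phi (fst q, snd c))).
  { intros j q Hq.
    apply (const_in_v c e (fun r => xi j (phi r)) (partial_u (fun r => xi j (phi r)))); [| exact Hq].
    intros z Hz; destruct (Hjac z Hz) as (ps & pt & qs & qt & D1 & D2 & K1 & _).
    assert (C := dif_comp_map _ _ _ _ _ _ _ _ _ (Dxi j _ (HUQ _ (HVU z Hz))) D1 D2).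
    rewrite K1 in C; rewrite (proj1 (dif_unique _ _ _ _ C)); exact C. }
  assert (Ceta : forall j q, square c e q -> eta j (phi q) = eta j (phi (fst c, snd q))).
  { intros j q Hq.
    apply (const_in_u c e (fun r => eta j (phi r)) (partial_v (fun r => eta j (phi r)))); [| exact Hq].
    intros z Hz; destruct (Hjac z Hz) as (ps & pt & qs & qt & D1 & D2 & _ & K2 & _).
    assert (C := dif_comp_map _ _ _ _ _ _ _ _ _ (Deta j _ (HUQ _ (HVU z Hz))) D1 D2).
    rewrite K2 in C; rewrite (proj2 (dif_unique _ _ _ _ C)); exact C. }
  set (a := fun s j => / 2 * xi j (phi (s, snd c))).
  set (b := fun t j => / 2 * eta j (phi (fst c, t))).
  assert (Sphi : forall f, smooth_on Q f -> smooth_on (square c e) (fun r => f (phi r))).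
  { intros f Hf; apply (smooth_comp_map Q (square c e)); try assumption.
    intros q Hq; apply HUQ, HVU, Hq. }
  assert (Hs0 : forall t0, Rabs (t0 - t0) < e) by (intros t0; rewrite Rminus_diag, Rabs_R0; exact He).
  assert (Sa : forall j, smooth1 (fst c) e (fun s => a s j)).
  { intros j; assert (HO := open_strip_fst (fst c) e).
    apply (smooth_mult (strip (fst c) e) (fun _ => / 2)); [exact HO | apply smooth_const, HO |].
    apply (smooth_comp (square c e) (strip (fst c) e) (fun r => xi j (phi r))
             (fun r => fst r) (fun _ => snd c)); try assumption.
    - intros q Hq; split; [exact Hq | apply Hs0].
    - apply Sphi, Sxi.
    - apply smooth_fst, HO.
    - apply smooth_const, HO. }
  assert (Sb : forall j, smooth1 (snd c) e (fun s => b s j)).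
  { intros j; assert (HO := open_strip_fst (snd c) e).
    apply (smooth_mult (strip (snd c) e) (fun _ => / 2)); [exact HO | apply smooth_const, HO |].
    apply (smooth_comp (square c e) (strip (snd c) e) (fun r => eta j (phi r))
             (fun _ => fst c) (fun r => fst r)); try assumption.
    - intros q Hq; split; [apply Hs0 | exact Hq].
    - apply Sphi, Seta.
    - apply smooth_const, HO.
    - apply smooth_fst, HO. }
  assert (Hdec : forall q, square c e q -> forall j, x (phi q) j = a (fst q) j + b (snd q) j).
  { intros q Hq j; unfold a, b; rewrite <- Cxi, <- Ceta by exact Hq; unfold xi, eta; field. }
  assert (Hvd : forall q, square c e q -> exists ps pt qs qt,
     ps * ps * coefE x (phi q) + (ps * qs + qs * ps) * coefF x (phi q) + qs * qs * coefG x (phi q) = 0 /\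
     pt * pt * coefE x (phi q) + (pt * qt + qt * pt) * coefF x (phi q) + qt * qt * coefG x (phi q) = 0 /\
     ps * qt - pt * qs <> 0 /\
     (forall j, vel a (fst q) j = differential x (phi q) (ps, qs) j) /\
     (forall j, vel b (snd q) j = differential x (phi q) (pt, qt) j)).
  { intros q Hq.
    destruct (Hjac q Hq) as (ps & pt & qs & qt & D1 & D2 & _ & _ & N1 & N2 & N3).
    exists ps, pt, qs, qt; split; [exact N1 |]; split; [exact N2 |]; split; [exact N3 |].
    assert (K : forall j, vel a (fst q) j = differential x (phi q) (ps, qs) j /\
                          vel b (snd q) j = differential x (phi q) (pt, qt) j).
    { intros j.
      assert (C := dif_comp_map _ _ _ _ _ _ _ _ _
        (vec_dif S x (phi q) HS Hx (Hsub _ (HUQ _ (HVU q Hq))) j) D1 D2).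
      assert (C' : dif (fun r => a (fst r) j + b (snd r) j) q
                (vel a (fst q) j * 1 + vel b (snd q) j * 0)
                (vel a (fst q) j * 0 + vel b (snd q) j * 1)).
      { apply dif_plus.
        - apply (dif_comp1 (fun s => a s j) (fun r => fst r)); [| apply dif_fst].
          apply (smooth1_is_derive (fst c) e (fun s => a s j)); [apply Sa | apply Hq].
        - apply (dif_comp1 (fun s => b s j) (fun r => snd r)); [| apply dif_snd].
          apply (smooth1_is_derive (snd c) e (fun s => b s j)); [apply Sb | apply Hq]. }
      assert (C'' : dif (fun r => x (phi r) j) q
                (vel a (fst q) j * 1 + vel b (snd q) j * 0)
                (vel a (fst q) j * 0 + vel b (snd q) j * 1)).
      { eapply dif_ext; [| exact C'].
        apply (near_imp q (square c e)); [| apply open_near; assumption].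
        intros z Hz; symmetry; apply Hdec, Hz. }
      destruct (dif_unique _ _ _ _ C) as [U1 U2].
      destruct (dif_unique _ _ _ _ C'') as [V1 V2].
      rewrite V1 in U1; rewrite V2 in U2; unfold differential; simpl; lra. }
    split; intros j; apply K. }
  assert (Hdot : forall (w w' z z' : vec R), (forall j, w j = w' j) -> (forall j, z j = z' j) ->
    dot w z = dot w' z').
  { intros w w' z z' H1 H2; unfold dot; rewrite !H1, !H2; reflexivity. }
  exists U, c, e, phi, (fun p => (xi i p, eta k p)), a, b.
  split; [exact HU |]; split; [reflexivity |].
  split; [| split; [exact Sa | split; [exact Sb | split; [exact Hdec | split; [| split]]]]].
  - split; [exact HUo |]; split; [exact He |]; split; [intros p Hp; apply Hsub, HUQ, Hp |].
    repeat (split; [assumption |]); assumption.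
  - intros s Hs.
    destruct (Hvd (s, snd c)) as (ps & pt & qs & qt & N1 & _ & _ & A1 & _); [split; [exact Hs | apply Hs0] |].
    simpl in A1; rewrite (Hdot _ _ _ _ A1 A1), dot_differential; exact N1.
  - intros t Hs.
    destruct (Hvd (fst c, t)) as (ps & pt & qs & qt & _ & N2 & _ & _ & B1); [split; [apply Hs0 | exact Hs] |].
    simpl in B1; rewrite (Hdot _ _ _ _ B1 B1), dot_differential; exact N2.
  - intros q Hq.
    destruct (Hvd q Hq) as (ps & pt & qs & qt & N1 & N2 & N3 & A1 & B1).
    rewrite (Hdot _ _ _ _ A1 B1), dot_differential; simpl.
    assert (HDq := HDS _ (Hsub _ (HUQ _ (HVU q Hq)))).
    set (E := coefE x (phi q)) in *; set (F := coefF x (phi q)) in *; set (G := coefG x (phi q)) in *.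
    intros Hz.
    assert (T : (ps * ps * E + (ps * qs + qs * ps) * F + qs * qs * G)
       * (pt * pt * E + (pt * qt + qt * pt) * F + qt * qt * G)
       - (ps * pt * E + (ps * qt + qs * pt) * F + qs * qt * G) ^ 2
       = - (F ^ 2 - E * G) * (ps * qt - pt * qs) ^ 2) by ring.
    rewrite N1, Hz in T.
    assert (0 < (F ^ 2 - E * G) * (ps * qt - pt * qs) ^ 2); [| lra].
    apply Rmult_lt_0_compat; [exact HDq |].
    apply pow2_gt_0, N3.
Qed.

(** * The invariant in null coordinates *)

Lemma vel_smooth1 (c e : R) (a : R -> vec R) (i : idx) :
  (forall j, smooth1 c e (fun s => a s j)) -> smooth1 c e (fun s => vel a s i).
Proof. intros H; apply (smooth1_Derive c e (fun s => a s i)), H. Qed.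

(** Differentiation of [a'^2 = 0]. *)
Lemma null_curve_acceleration (c e : R) (a : R -> vec R) (s : R) :
  (forall j, smooth1 c e (fun s => a s j)) ->
  (forall s, Rabs (s - c) < e -> dot (vel a s) (vel a s) = 0) ->
  Rabs (s - c) < e -> dot (vel a s) (vel (vel a) s) = 0.
Proof.
  intros Ha H0 Hs.
  assert (He : 0 < e) by (apply (Rle_lt_trans _ _ _ (Rabs_pos (s - c)) Hs)).
  assert (D : forall i, dif (fun p => vel a (fst p) i) (s, 0) (vel (vel a) s i) 0).
  { intros i; apply (strip_slice c e (fun r => vel a r i) He); [apply vel_smooth1, Ha | exact Hs]. }
  assert (DD := dif_dot (fun p => vel a (fst p)) (fun p => vel a (fst p)) (s, 0)
                  (vel (vel a) s) (fun _ => 0) (vel (vel a) s) (fun _ => 0) D D).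
  assert (D0 : dif (fun q => dot (vel a (fst q)) (vel a (fst q))) (s, 0) 0 0).
  { apply (dif_ext (fun _ => 0)); [| apply dif_const].
    apply (near_imp _ (strip c e)); [intros q Hq; symmetry; apply H0, Hq |].
    apply open_near; [apply open_strip_fst | exact Hs]. }
  destruct (dif_agree _ _ _ _ _ _ DD D0) as [T _]; simpl in T; rewrite (dot_sym (vel (vel a) s)) in T; lra.
Qed.

Lemma Phi'_second (y : R * R -> vec R) (t : R * R) (i : idx) :
  Phi' y t i = Dn (/ 2 * (vec_u (vec_u y) t i + vec_v (vec_v y) t i))
                  (/ 2 * (vec_u (vec_v y) t i + vec_v (vec_u y) t i)).
Proof.
  assert (R1 : forall s, dre (Phi y s i) = vec_u y s i) by (intros; unfold Phi; simpl; ring).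
  assert (R2 : forall s, dim (Phi y s i) = vec_v y s i) by (intros; unfold Phi; simpl; ring).
  assert (U : forall f g : R * R -> R, (forall s, f s = g s) -> partial_u f t = partial_u g t).
  { intros f g H; apply Derive_ext; intros; apply H. }
  assert (V : forall f g : R * R -> R, (forall s, f s = g s) -> partial_v f t = partial_v g t).
  { intros f g H; apply Derive_ext; intros; apply H. }
  unfold Phi', d_dt; rewrite (U _ _ R1), (U _ _ R2), (V _ _ R1), (V _ _ R2).
  change (partial_u (fun s => vec_u y s i) t) with (vec_u (vec_u y) t i).
  change (partial_u (fun s => vec_v y s i) t) with (vec_u (vec_v y) t i).
  change (partial_v (fun s => vec_u y s i) t) with (vec_v (vec_u y) t i).
  change (partial_v (fun s => vec_v y s i) t) with (vec_v (vec_v y) t i).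
  unfold dmul, dadd, dj, RtoD; simpl; f_equal; ring.
Qed.

(** For null tangent vectors [P], [Q], the normal part of [K + L] is
    [(K - c P) + (L - d Q)]; since [K] is orthogonal to [P] and [L] to [Q],
    neither correction changes the squares of [K] and [L]. *)
Lemma perp_sq_algebra (y : R * R -> vec R) (t : R * R) (P Q K L : vec R) :
  (forall i, vec_u y t i = P i + Q i) -> (forall i, vec_v y t i = P i - Q i) ->
  (forall i, Phi' y t i = Dn (K i + L i) (K i - L i)) ->
  dot P P = 0 -> dot Q Q = 0 -> dot P Q <> 0 -> dot P K = 0 -> dot Q L = 0 ->
  Phi'_perp_sq y t = Dn (2 * (dot K K + dot L L)) (2 * (dot K K - dot L L)).
Proof.
  intros Hu Hv HPhi HPP HQQ HPQ HPK HQL.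
  set (m := dot P Q) in *.
  assert (Huu : dot (vec_u y t) (vec_u y t) = 2 * m).
  { transitivity (dot P P + 2 * dot P Q + dot Q Q); [unfold dot; rewrite !Hu; ring |].
    rewrite HPP, HQQ; unfold m; ring. }
  assert (Hvv : dot (vec_v y t) (vec_v y t) = - (2 * m)).
  { transitivity (dot P P - 2 * dot P Q + dot Q Q); [unfold dot; rewrite !Hv; ring |].
    rewrite HPP, HQQ; unfold m; ring. }
  assert (Huv : dot (vec_u y t) (vec_v y t) = 0).
  { transitivity (dot P P - dot Q Q); [unfold dot; rewrite !Hu, !Hv; ring |].
    rewrite HPP, HQQ; ring. }
  set (kq := dot K Q). set (lp := dot L P).
  assert (Hn : forall (sg : R) (w : vec R) i, sg * sg = 1 -> (forall k, w k = K k + sg * L k) ->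
    normal_part y t w i = (K i - kq / m * P i) + sg * (L i - lp / m * Q i)).
  { intros sg w i Hsg Hw.
    assert (Wu : dot w (vec_u y t) = kq + sg * lp).
    { transitivity (dot P K + kq + sg * (lp + dot Q L)).
      - unfold kq, lp, dot; rewrite !Hw, !Hu; ring.
      - rewrite HPK, HQL; ring. }
    assert (Wv : dot w (vec_v y t) = - kq + sg * lp).
    { transitivity (dot P K - kq + sg * (lp - dot Q L)).
      - unfold kq, lp, dot; rewrite !Hw, !Hv; ring.
      - rewrite HPK, HQL; ring. }
    unfold normal_part, differential, tan_u, tan_v, gram_det; simpl.
    rewrite Wu, Wv, Huu, Hvv, Huv, Hu, Hv, Hw; field; exact HPQ. }
  assert (Hd : forall i, dnormal_part y t (Phi' y t) i =
     Dn ((K i - kq / m * P i) + (L i - lp / m * Q i))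
        ((K i - kq / m * P i) - (L i - lp / m * Q i))).
  { intros i; unfold dnormal_part; f_equal.
    - rewrite (Hn 1); [ring | ring |]. intros k; rewrite HPhi; simpl; ring.
    - rewrite (Hn (-1)); [ring | ring |]. intros k; rewrite HPhi; simpl; ring. }
  assert (S1 : dot (fun i => K i - kq / m * P i) (fun i => K i - kq / m * P i) = dot K K).
  { transitivity (dot K K - 2 * (kq / m) * dot P K + (kq / m) ^ 2 * dot P P); [unfold dot; ring |].
    rewrite HPK, HPP; ring. }
  assert (S2 : dot (fun i => L i - lp / m * Q i) (fun i => L i - lp / m * Q i) = dot L L).
  { transitivity (dot L L - 2 * (lp / m) * dot Q L + (lp / m) ^ 2 * dot Q Q); [unfold dot; ring |].
    rewrite HQL, HQQ; ring. }
  rewrite <- S1, <- S2; unfold Phi'_perp_sq, ddot; rewrite !Hd.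
  unfold dadd, dopp, dmul, dot; simpl; f_equal; ring.
Qed.

(** The conditions on [sigma] and [tau] say that locally they are functions of
    [u + v] and of [u - v]. In this form they need no factorisation through these
    variables, and apply to two arbitrary charts with the same null lines. *)
Lemma separated_derivatives (V : R * R -> Prop) (y : R * R -> vec R)
  (sigma tau : R * R -> R) (c : R * R) (e : R) (a b : R -> vec R) :
  open V -> smooth_on V sigma -> smooth_on V tau ->
  (forall i, smooth1 (fst c) e (fun s => a s i)) ->
  (forall i, smooth1 (snd c) e (fun s => b s i)) ->
  (forall q, V q -> square c e (sigma q, tau q)) ->
  (forall q, V q -> forall i, y q i = a (sigma q) i + b (tau q) i) ->
  (forall q, V q -> partial_v sigma q = partial_u sigma q /\
                    partial_v tau q = - partial_u tau q) ->
  forall t, V t ->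
  (forall i, vec_u y t i = partial_u sigma t * vel a (sigma t) i + partial_u tau t * vel b (tau t) i) /\
  (forall i, vec_v y t i = partial_u sigma t * vel a (sigma t) i - partial_u tau t * vel b (tau t) i) /\
  (forall i, Phi' y t i =
     let K := partial_u sigma t ^ 2 * vel (vel a) (sigma t) i
              + partial_u (partial_u sigma) t * vel a (sigma t) i in
     let L := partial_u tau t ^ 2 * vel (vel b) (tau t) i
              + partial_u (partial_u tau) t * vel b (tau t) i in
     Dn (K + L) (K - L)).
Proof.
  intros HV Hs Ht Ha Hb Hr Hy Huv.
  assert (Ds : forall q, V q -> dif sigma q (partial_u sigma q) (partial_u sigma q)).
  { intros q Hq; rewrite <- (proj1 (Huv q Hq)) at 2; apply (smooth_dif V); assumption. }
  assert (Dt : forall q, V q -> dif tau q (partial_u tau q) (- partial_u tau q)).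
  { intros q Hq; rewrite <- (proj2 (Huv q Hq)); apply (smooth_dif V); assumption. }
  assert (Dsu : forall q, V q -> dif (partial_u sigma) q (partial_u (partial_u sigma) q)
                                   (partial_u (partial_u sigma) q)).
  { intros q Hq.
    assert (D := smooth_dif V _ q HV (smooth_partial_u V sigma HV Hs) Hq).
    rewrite (smooth_schwarz V sigma q HV Hs Hq) in D.
    assert (D' := smooth_dif V _ q HV (smooth_partial_v V sigma HV Hs) Hq).
    apply (dif_ext _ (partial_u sigma)) in D'.
    - rewrite <- (proj1 (dif_unique _ _ _ _ D')) in D; exact D.
    - apply (near_imp q V); [intros z Hz; apply Huv, Hz | apply open_near; assumption]. }
  assert (Dtu : forall q, V q -> dif (partial_u tau) q (partial_u (partial_u tau) q)
                                   (- partial_u (partial_u tau) q)).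
  { intros q Hq.
    assert (D := smooth_dif V _ q HV (smooth_partial_u V tau HV Ht) Hq).
    rewrite (smooth_schwarz V tau q HV Ht Hq) in D.
    assert (D' := dif_opp _ _ _ _ (smooth_dif V _ q HV (smooth_partial_v V tau HV Ht) Hq)).
    apply (dif_ext _ (partial_u tau)) in D'.
    - assert (T := proj1 (dif_unique _ _ _ _ D')); simpl in T.
      replace (partial_u (partial_v tau) q) with (- partial_u (partial_u tau) q) in D by lra.
      exact D.
    - apply (near_imp q V); [| apply open_near; assumption].
      intros z Hz; simpl; rewrite (proj2 (Huv z Hz)); ring. }
  assert (Dy : forall i q, V q -> dif (fun q => y q i) q
     (partial_u sigma q * vel a (sigma q) i + partial_u tau q * vel b (tau q) i)
     (partial_u sigma q * vel a (sigma q) i - partial_u tau q * vel b (tau q) i)).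
  { intros i q Hq; apply (dif_ext (fun q => a (sigma q) i + b (tau q) i)).
    - apply (near_imp q V); [intros z Hz; symmetry; apply Hy, Hz | apply open_near; assumption].
    - eapply dif_eq.
      + apply dif_plus.
        * apply (dif_comp1 (fun s => a s i) sigma); [| apply Ds, Hq].
          apply (smooth1_is_derive (fst c) e (fun s => a s i)); [apply Ha | apply (Hr q Hq)].
        * apply (dif_comp1 (fun s => b s i) tau); [| apply Dt, Hq].
          apply (smooth1_is_derive (snd c) e (fun s => b s i)); [apply Hb | apply (Hr q Hq)].
      + unfold vel; ring.
      + unfold vel; ring. }
  assert (Hu : forall i q, V q -> vec_u y q i =
     partial_u sigma q * vel a (sigma q) i + partial_u tau q * vel b (tau q) i).
  { intros i q Hq; apply (dif_unique _ _ _ _ (Dy i q Hq)). }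
  assert (Hv : forall i q, V q -> vec_v y q i =
     partial_u sigma q * vel a (sigma q) i - partial_u tau q * vel b (tau q) i).
  { intros i q Hq; apply (dif_unique _ _ _ _ (Dy i q Hq)). }
  intros t Hpt; split; [intros i; apply Hu, Hpt |]; split; [intros i; apply Hv, Hpt |].
  intros i; rewrite Phi'_second.
  assert (DP : dif (fun q => partial_u sigma q * vel a (sigma q) i) t
     (partial_u sigma t ^ 2 * vel (vel a) (sigma t) i
      + partial_u (partial_u sigma) t * vel a (sigma t) i)
     (partial_u sigma t ^ 2 * vel (vel a) (sigma t) i
      + partial_u (partial_u sigma) t * vel a (sigma t) i)).
  { eapply dif_eq.
    - apply dif_mult; [apply Dsu, Hpt |].
      apply (dif_comp1 (fun s => vel a s i) sigma); [| apply Ds, Hpt].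
      apply (smooth1_is_derive (fst c) e (fun s => vel a s i)); [| apply (Hr t Hpt)].
      apply vel_smooth1, Ha.
    - unfold vel; ring.
    - unfold vel; ring. }
  assert (DQ : dif (fun q => partial_u tau q * vel b (tau q) i) t
     (partial_u tau t ^ 2 * vel (vel b) (tau t) i
      + partial_u (partial_u tau) t * vel b (tau t) i)
     (- (partial_u tau t ^ 2 * vel (vel b) (tau t) i
      + partial_u (partial_u tau) t * vel b (tau t) i))).
  { eapply dif_eq.
    - apply dif_mult; [apply Dtu, Hpt |].
      apply (dif_comp1 (fun s => vel b s i) tau); [| apply Dt, Hpt].
      apply (smooth1_is_derive (snd c) e (fun s => vel b s i)); [| apply (Hr t Hpt)].
      apply vel_smooth1, Hb.
    - unfold vel; ring.
    - unfold vel; ring. }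
  assert (Hn : forall f g : R * R -> R, (forall q, V q -> f q = g q) -> near t (fun q => g q = f q)).
  { intros f g H; apply (near_imp t V); [intros q Hq; symmetry; apply H, Hq | apply open_near; assumption]. }
  assert (DU := dif_ext _ (fun q => vec_u y q i) _ _ _ (Hn _ _ (Hu i)) (dif_plus _ _ _ _ _ _ _ DP DQ)).
  assert (DV := dif_ext _ (fun q => vec_v y q i) _ _ _ (Hn _ _ (Hv i)) (dif_minus _ _ _ _ _ _ _ DP DQ)).
  destruct (dif_unique _ _ _ _ DU) as [U1 U2]; destruct (dif_unique _ _ _ _ DV) as [V1 V2].
  change (vec_u (vec_u y) t i) with (partial_u (fun q => vec_u y q i) t).
  change (vec_u (vec_v y) t i) with (partial_u (fun q => vec_v y q i) t).
  change (vec_v (vec_u y) t i) with (partial_v (fun q => vec_u y q i) t).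
  change (vec_v (vec_v y) t i) with (partial_v (fun q => vec_v y q i) t).
  rewrite U1, U2, V1, V2; simpl; f_equal; field.
Qed.

Definition acc_sq (a : R -> vec R) (s : R) : R := dot (vel (vel a) s) (vel (vel a) s).

(** The double number whose components in the idempotent basis
    [(1 + j) / 2, (1 - j) / 2] are [4 A] and [4 B]. *)
Definition split_dnum (A B : R) : dnum := Dn (2 * (A + B)) (2 * (A - B)).

(** The terms with second derivatives of [sigma] and [tau] are tangential and
    disappear in the normal part. *)
Lemma separated_invariant (V : R * R -> Prop) (y : R * R -> vec R)
  (sigma tau : R * R -> R) (c : R * R) (e : R) (a b : R -> vec R) :
  open V -> smooth_on V sigma -> smooth_on V tau ->
  (forall i, smooth1 (fst c) e (fun s => a s i)) ->
  (forall i, smooth1 (snd c) e (fun s => b s i)) ->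
  (forall q, V q -> square c e (sigma q, tau q)) ->
  (forall q, V q -> forall i, y q i = a (sigma q) i + b (tau q) i) ->
  (forall q, V q -> partial_v sigma q = partial_u sigma q /\
                    partial_v tau q = - partial_u tau q) ->
  (forall s, Rabs (s - fst c) < e -> dot (vel a s) (vel a s) = 0) ->
  (forall t, Rabs (t - snd c) < e -> dot (vel b t) (vel b t) = 0) ->
  forall t, V t -> dot (vel a (sigma t)) (vel b (tau t)) <> 0 ->
  partial_u sigma t <> 0 -> partial_u tau t <> 0 ->
  Phi'_perp_sq y t = split_dnum (acc_sq a (sigma t) * partial_u sigma t ^ 4)
                                (acc_sq b (tau t) * partial_u tau t ^ 4).
Proof.
  intros HV Hs Ht Ha Hb Hr Hy Huv Na Nb t Hpt Hm Hk Hl.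
  destruct (separated_derivatives V y sigma tau c e a b HV Hs Ht Ha Hb Hr Hy Huv t Hpt)
    as [Hu [Hv HPhi]].
  destruct (Hr t Hpt) as [R1 R2]; simpl in R1, R2.
  assert (N1 := Na _ R1). assert (N2 := Nb _ R2).
  assert (A1 := null_curve_acceleration _ _ _ _ Ha Na R1).
  assert (A2 := null_curve_acceleration _ _ _ _ Hb Nb R2).
  set (k := partial_u sigma t) in *; set (l := partial_u tau t) in *.
  set (k' := partial_u (partial_u sigma) t) in *; set (l' := partial_u (partial_u tau) t) in *.
  rewrite (perp_sq_algebra y t (fun i => k * vel a (sigma t) i) (fun i => l * vel b (tau t) i)
    (fun i => k ^ 2 * vel (vel a) (sigma t) i + k' * vel a (sigma t) i)
    (fun i => l ^ 2 * vel (vel b) (tau t) i + l' * vel b (tau t) i)).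
  - assert (T1 : dot (fun i => k ^ 2 * vel (vel a) (sigma t) i + k' * vel a (sigma t) i)
      (fun i => k ^ 2 * vel (vel a) (sigma t) i + k' * vel a (sigma t) i) = acc_sq a (sigma t) * k ^ 4).
    { transitivity (k ^ 4 * acc_sq a (sigma t) + 2 * k ^ 2 * k' * dot (vel a (sigma t)) (vel (vel a) (sigma t))
        + k' ^ 2 * dot (vel a (sigma t)) (vel a (sigma t))); [unfold acc_sq, dot; ring |].
      rewrite A1, N1; ring. }
    assert (T2 : dot (fun i => l ^ 2 * vel (vel b) (tau t) i + l' * vel b (tau t) i)
      (fun i => l ^ 2 * vel (vel b) (tau t) i + l' * vel b (tau t) i) = acc_sq b (tau t) * l ^ 4).
    { transitivity (l ^ 4 * acc_sq b (tau t) + 2 * l ^ 2 * l' * dot (vel b (tau t)) (vel (vel b) (tau t))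
        + l' ^ 2 * dot (vel b (tau t)) (vel b (tau t))); [unfold acc_sq, dot; ring |].
      rewrite A2, N2; ring. }
    rewrite T1, T2; reflexivity.
  - exact Hu.
  - exact Hv.
  - exact HPhi.
  - transitivity (k ^ 2 * dot (vel a (sigma t)) (vel a (sigma t))); [unfold dot; ring | rewrite N1; ring].
  - transitivity (l ^ 2 * dot (vel b (tau t)) (vel b (tau t))); [unfold dot; ring | rewrite N2; ring].
  - assert (T : dot (fun i => k * vel a (sigma t) i) (fun i => l * vel b (tau t) i)
      = k * l * dot (vel a (sigma t)) (vel b (tau t))) by (unfold dot; ring).
    rewrite T; repeat apply Rmult_integral_contrapositive_currified; assumption.
  - transitivity (k ^ 3 * dot (vel a (sigma t)) (vel (vel a) (sigma t))
      + k * k' * dot (vel a (sigma t)) (vel a (sigma t))); [unfold dot; ring | rewrite N1, A1; ring].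
  - transitivity (l ^ 3 * dot (vel b (tau t)) (vel (vel b) (tau t))
      + l * l' * dot (vel b (tau t)) (vel b (tau t))); [unfold dot; ring | rewrite N2, A2; ring].
Qed.

(** * Isothermal charts and null charts *)

Lemma null_chart_shrink (S : R * R -> Prop) (x : R * R -> vec R) (U : R * R -> Prop)
  (c : R * R) (e e' : R) (phi psi : R * R -> R * R) (a b : R -> vec R) :
  null_chart S x U c e phi psi a b -> 0 < e' -> e' <= e ->
  null_chart S x (fun p => U p /\ square c e' (psi p)) c e' phi psi a b.
Proof.
  intros [(H1 & H2 & H3 & [H4 H4'] & H5 & [H6 H6'] & H7 & H8 & H9) (Ha & Hb & Hd & Na & Nb & Hm)] He' Hle.
  assert (Hsub : forall q, square c e' q -> square c e q) by (intros q; apply square_sub, Hle).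
  assert (Hstrip : forall z, Rabs z < e' -> Rabs z < e) by (intros; lra).
  split; [split; [| split; [exact He' |]]; repeat split |].
  - apply near_open; intros p Hp.
    assert (T := open_preimage U (square c e') (fun p => fst (psi p)) (fun p => snd (psi p)) H1
      (open_square c e')).
    assert (O : open (fun p => U p /\ square c e' (fst (psi p), snd (psi p)))).
    { apply T; intros q Hq; split; apply (smooth_cont U); assumption. }
    assert (Hp' : U p /\ square c e' (fst (psi p), snd (psi p)))
      by (rewrite <- surjective_pairing; exact Hp).
    generalize (open_near _ _ O Hp'); apply near_imp; intros q.
    rewrite <- surjective_pairing; auto.
  - intros p [Hp _]; apply H3, Hp.
  - apply (smooth_sub (square c e)); assumption.
  - apply (smooth_sub (square c e)); assumption.
  - apply H5, Hsub; assumption.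
  - rewrite H8 by (apply Hsub; assumption); apply H.
  - rewrite H8 by (apply Hsub; assumption); apply H.
  - apply (smooth_sub U); [intros p [Hp _]; exact Hp | assumption].
  - apply (smooth_sub U); [intros p [Hp _]; exact Hp | assumption].
  - apply H.
  - apply H.
  - intros t Ht; apply H8, Hsub, Ht.
  - intros p [Hp _]; apply H9, Hp.
  - repeat split; auto.
    + intros i; apply (smooth_sub (strip (fst c) e)); [intros p; apply Hstrip | apply Ha].
    + intros i; apply (smooth_sub (strip (snd c) e)); [intros p; apply Hstrip | apply Hb].
Qed.

Lemma null_chart_swap (S : R * R -> Prop) (x : R * R -> vec R) (U : R * R -> Prop)
  (c : R * R) (e : R) (phi psi : R * R -> R * R) (a b : R -> vec R) :
  null_chart S x U c e phi psi a b ->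
  null_chart S x U (snd c, fst c) e (fun q => phi (snd q, fst q))
    (fun p => (snd (psi p), fst (psi p))) b a.
Proof.
  intros [(H1 & H2 & H3 & [H4 H4'] & H5 & [H6 H6'] & H7 & H8 & H9) (Ha & Hb & Hd & Na & Nb & Hm)].
  assert (Hsw : forall q, square (snd c, fst c) e q -> square c e (snd q, fst q))
    by (intros q [A B]; split; assumption).
  assert (HO := open_square (snd c, fst c) e).
  split; [split; [exact H1 |]; split; [exact H2 |]; split; [exact H3 |] | ].
  - split; [split | split; [| split; [split | split; [| split]]]].
    + apply (smooth_comp (square c e) _ (fun q => fst (phi q)) (fun q => snd q) (fun q => fst q));
        try assumption; [apply open_square | apply smooth_snd, HO | apply smooth_fst, HO].
    + apply (smooth_comp (square c e) _ (fun q => snd (phi q)) (fun q => snd q) (fun q => fst q));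
        try assumption; [apply open_square | apply smooth_snd, HO | apply smooth_fst, HO].
    + intros t Ht; apply H5, Hsw, Ht.
    + exact H6'.
    + exact H6.
    + intros p Hp; destruct (H7 p Hp); split; assumption.
    + intros t Ht; rewrite H8 by (apply Hsw, Ht); symmetry; apply surjective_pairing.
    + intros p Hp; simpl; rewrite <- surjective_pairing; apply H9, Hp.
  - split; [exact Hb |]; split; [exact Ha |]; split.
    + intros q Hq i; rewrite (Hd _ (Hsw q Hq)); simpl; ring.
    + split; [exact Nb |]; split; [exact Na |].
      intros q Hq; rewrite dot_sym; apply (Hm _ (Hsw q Hq)).
Qed.

(** Reparametrising the two null coordinates separately and passing to
    [u = (s + t) / 2], [v = (s - t) / 2] gives isothermal coordinates; the
    sign condition on [rho1] and [rho2] is what makes [E] negative. *)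
Lemma chart_of_null_chart (S : R * R -> Prop) (x : R * R -> vec R) (U : R * R -> Prop)
  (c : R * R) (e : R) (phi psi : R * R -> R * R) (a b : R -> vec R) (rho1 rho2 : R -> R) :
  null_chart S x U c e phi psi a b ->
  smooth1 (fst c) e rho1 -> smooth1 (snd c) e rho2 ->
  (forall q, square c e q ->
     rho1 (fst q) * rho2 (snd q) * dot (vel a (fst q)) (vel b (snd q)) < 0) ->
  exists (U' V' : R * R -> Prop) (Phi1 T : R * R -> R * R),
    (forall p, U p -> psi p = c -> U' p) /\ local_coords S U' V' Phi1 /\
    isothermal V' (reparam x Phi1) /\ V' (0, 0) /\ T (0, 0) = c /\
    forall t, V' t -> square c e (T t) /\
      Phi'_perp_sq (reparam x Phi1) t =
        split_dnum (acc_sq a (fst (T t)) * (/ rho1 (fst (T t))) ^ 4)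
                   (acc_sq b (snd (T t)) * (/ rho2 (snd (T t))) ^ 4).
Proof.
  intros [(H1 & H2 & H3 & [H4 H4'] & H5 & [H6 H6'] & H7 & H8 & H9) (Ha & Hb & Hd & Na & Nb & Hm)]
    S1 S2 Hneg.
  destruct c as [c1 c2]; simpl in S1, S2, Ha, Hb, Na, Nb.
  assert (Hself : forall z, Rabs (z - z) < e)
    by (intros z; rewrite Rminus_diag, Rabs_R0; exact H2).
  assert (N1 : forall s, Rabs (s - c1) < e -> rho1 s <> 0).
  { intros s Hs Hc; assert (T := Hneg (s, c2) (conj Hs (Hself c2))); simpl in T.
    rewrite Hc in T; lra. }
  assert (N2 : forall s, Rabs (s - c2) < e -> rho2 s <> 0).
  { intros s Hs Hc; assert (T := Hneg (c1, s) (conj (Hself c1) Hs)); simpl in T.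
    rewrite Hc in T; lra. }
  destruct (reparametrisation c1 e rho1 H2 S1 N1)
    as (d1 & de1 & h1 & f1 & P1 & P2 & P3 & P4 & P5 & P6 & P7 & P8).
  destruct (reparametrisation c2 e rho2 H2 S2 N2)
    as (d2 & de2 & h2 & f2 & Q1 & Q2 & Q3 & Q4 & Q5 & Q6 & Q7 & Q8).
  set (V' := fun t : R * R => Rabs (fst t + snd t - 0) < de1 /\ Rabs (fst t - snd t - 0) < de2).
  set (sigma := fun t : R * R => f1 (fst t + snd t)).
  set (tau := fun t : R * R => f2 (fst t - snd t)).
  assert (Dp : forall q, dif (fun t => fst t + snd t) q 1 1).
  { intros q; eapply dif_eq; [apply dif_plus; [apply dif_fst | apply dif_snd] | ring | ring]. }
  assert (Dm : forall q, dif (fun t => fst t - snd t) q 1 (- (1))).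
  { intros q; eapply dif_eq; [apply dif_minus; [apply dif_fst | apply dif_snd] | ring | ring]. }
  assert (HV : open V').
  { apply open_inter; [apply (open_strip 1 1), Dp | apply (open_strip 1 (- (1))), Dm]. }
  assert (HV1 : forall t, V' t -> Rabs (fst t + snd t) < de1).
  { intros t [A _]; rewrite Rminus_0_r in A; exact A. }
  assert (HV2 : forall t, V' t -> Rabs (fst t - snd t) < de2).
  { intros t [_ A]; rewrite Rminus_0_r in A; exact A. }
  assert (Hst : forall t, V' t -> Rabs (sigma t - c1) < d1 /\ Rabs (tau t - c2) < d2).
  { intros t Ht; split; [apply P7, HV1, Ht | apply Q7, HV2, Ht]. }
  assert (Hsq : forall t, V' t -> square (c1, c2) e (sigma t, tau t)).
  { intros t Ht; destruct (Hst t Ht); split; simpl; lra. }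
  assert (Sp : smooth_on V' (fun t => fst t + snd t))
    by (apply smooth_plus; [exact HV | apply smooth_fst, HV | apply smooth_snd, HV]).
  assert (Sm : smooth_on V' (fun t => fst t - snd t))
    by (apply smooth_minus; [exact HV | apply smooth_fst, HV | apply smooth_snd, HV]).
  assert (Ss : smooth_on V' sigma).
  { apply (smooth1_comp 0 de1 f1 V'); try assumption; intros t Ht; apply Ht. }
  assert (St : smooth_on V' tau).
  { apply (smooth1_comp 0 de2 f2 V'); try assumption; intros t Ht; apply Ht. }
  assert (Ds : forall t, V' t -> dif sigma t (/ rho1 (sigma t)) (/ rho1 (sigma t))).
  { intros t Ht; eapply dif_eq.
    - apply (dif_comp1 f1 (fun t => fst t + snd t)); [apply P7, HV1, Ht | apply Dp].
    - unfold sigma; ring.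
    - unfold sigma; ring. }
  assert (Dt : forall t, V' t -> dif tau t (/ rho2 (tau t)) (- / rho2 (tau t))).
  { intros t Ht; eapply dif_eq.
    - apply (dif_comp1 f2 (fun t => fst t - snd t)); [apply Q7, HV2, Ht | apply Dm].
    - unfold tau; ring.
    - unfold tau; ring. }
  set (Phi1 := fun t => phi (sigma t, tau t)).
  set (Psi1 := fun p => (/ 2 * (h1 (fst (psi p)) + h2 (snd (psi p))),
                         / 2 * (h1 (fst (psi p)) - h2 (snd (psi p))))).
  set (B1 := fun q : R * R => Rabs (fst q - c1) < d1 /\ Rabs (snd q - c2) < d2).
  set (B2 := fun q : R * R => Rabs (fst q - 0) < de1 /\ Rabs (snd q - 0) < de2).
  set (B := fun q => B1 q /\ B2 (h1 (fst q), h2 (snd q))).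
  set (U' := fun p => U p /\ B (fst (psi p), snd (psi p))).
  assert (HB1 : open B1).
  { apply open_inter; [apply (open_strip 1 0 (fun p => fst p)), dif_fst |
      apply (open_strip 0 1 (fun p => snd p)), dif_snd]. }
  assert (HB2 : open B2).
  { apply open_inter; [apply (open_strip 1 0 (fun p => fst p)), dif_fst |
      apply (open_strip 0 1 (fun p => snd p)), dif_snd]. }
  assert (HB : open B).
  { apply open_preimage; [exact HB1 | exact HB2 |].
    intros q [A1 A2]; split.
    - apply (smooth_cont B1 (fun q => h1 (fst q))); [| split; assumption].
      apply (smooth1_comp c1 e h1 B1); try assumption.
      + intros z [Z _]; lra.
      + apply smooth_fst, HB1.
    - apply (smooth_cont B1 (fun q => h2 (snd q))); [| split; assumption].
      apply (smooth1_comp c2 e h2 B1); try assumption.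
      + intros z [_ Z]; lra.
      + apply smooth_snd, HB1. }
  assert (HU' : open U').
  { apply open_preimage; [exact H1 | exact HB |].
    intros p Hp; split; apply (smooth_cont U); assumption. }
  assert (Hpsi1 : forall p, U' p -> Rabs (fst (psi p) - c1) < e /\ Rabs (snd (psi p) - c2) < e).
  { intros p [_ [[A1 A2] _]]; simpl in A1, A2; split; lra. }
  assert (Sh1 : smooth_on U' (fun p => h1 (fst (psi p)))).
  { apply (smooth1_comp c1 e h1 U'); try assumption.
    - intros p Hp; apply Hpsi1, Hp.
    - apply (smooth_sub U); [intros p Hp; apply Hp | assumption]. }
  assert (Sh2 : smooth_on U' (fun p => h2 (snd (psi p)))).
  { apply (smooth1_comp c2 e h2 U'); try assumption.
    - intros p Hp; apply Hpsi1, Hp.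
    - apply (smooth_sub U); [intros p Hp; apply Hp | assumption]. }
  assert (Hhalf : forall f, smooth_on U' f -> smooth_on U' (fun p => / 2 * f p)).
  { intros f Hf; apply (smooth_mult U' (fun _ => / 2)); [exact HU' | apply smooth_const, HU' | exact Hf]. }
  assert (V00 : V' (0, 0)).
  { split; simpl; [replace (0 + 0 - 0) with 0 by ring | replace (0 - 0 - 0) with 0 by ring];
      rewrite Rabs_R0; assumption. }
  assert (Hsep := separated_derivatives V' (reparam x Phi1) sigma tau (c1, c2) e a b
    HV Ss St Ha Hb Hsq (fun q Hq => Hd _ (Hsq q Hq))).
  assert (Huv : forall q, V' q -> partial_v sigma q = partial_u sigma q /\
                    partial_v tau q = - partial_u tau q).
  { intros q Hq; destruct (dif_unique _ _ _ _ (Ds q Hq)) as [-> ->].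
    destruct (dif_unique _ _ _ _ (Dt q Hq)) as [-> ->]; split; ring. }
  exists U', V', Phi1, (fun t => (sigma t, tau t)).
  split; [| split; [| split; [| split; [exact V00 | split]]]].
  - intros p Hp Hc; split; [exact Hp |].
    rewrite Hc; simpl; split; split; simpl; rewrite ?P4, ?Q4, ?Rminus_diag, ?Rabs_R0; assumption.
  - apply (local_coords_intro S U' V' Phi1 Psi1); try assumption.
    + intros p q z [A1 A2] [A3 A4] Hz; split; simpl.
      * replace ((1 - z) * fst p + z * fst q + ((1 - z) * snd p + z * snd q))
          with ((1 - z) * (fst p + snd p) + z * (fst q + snd q)) by ring.
        apply convex_Rabs; assumption.
      * replace ((1 - z) * fst p + z * fst q - ((1 - z) * snd p + z * snd q))
          with ((1 - z) * (fst p - snd p) + z * (fst q - snd q)) by ring.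
        apply convex_Rabs; assumption.
    + intros p [Hp _]; apply H3, Hp.
    + split.
      * apply (smooth_comp (square (c1, c2) e) V' (fun q => fst (phi q)) sigma tau);
          try assumption; apply open_square.
      * apply (smooth_comp (square (c1, c2) e) V' (fun q => snd (phi q)) sigma tau);
          try assumption; apply open_square.
    + intros t Ht; split; [apply H5, Hsq, Ht |].
      unfold Phi1; rewrite <- surjective_pairing, H8 by (apply Hsq, Ht).
      split; [apply (Hst t Ht) |]; simpl.
      unfold sigma, tau; rewrite (proj1 (proj2 (P7 _ (HV1 t Ht)))), (proj1 (proj2 (Q7 _ (HV2 t Ht)))).
      exact Ht.
    + split; apply Hhalf.
      * apply smooth_plus; assumption.
      * apply smooth_minus; assumption.
    + intros p [_ [_ [A1 A2]]]; simpl in A1, A2; unfold V', Psi1; cbn [fst snd].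
      split; [replace (_ + _) with (h1 (fst (psi p))) by field |
              replace (_ - _ - 0) with (h2 (snd (psi p)) - 0) by field]; assumption.
    + intros t Ht; unfold Psi1, Phi1; rewrite H8 by (apply Hsq, Ht); simpl.
      unfold sigma, tau; rewrite (proj1 (proj2 (P7 _ (HV1 t Ht)))), (proj1 (proj2 (Q7 _ (HV2 t Ht)))).
      transitivity (fst t, snd t); [f_equal; field | symmetry; apply surjective_pairing].
    + intros p [Hp [[A1 A2] [A3 A4]]]; simpl in A1, A2, A3, A4.
      rewrite Rminus_0_r in A3, A4.
      unfold Phi1, sigma, tau, Psi1; cbn [fst snd].
      replace (/ 2 * (h1 (fst (psi p)) + h2 (snd (psi p)))
               + / 2 * (h1 (fst (psi p)) - h2 (snd (psi p)))) with (h1 (fst (psi p))) by field.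
      replace (/ 2 * (h1 (fst (psi p)) + h2 (snd (psi p)))
               - / 2 * (h1 (fst (psi p)) - h2 (snd (psi p)))) with (h2 (snd (psi p))) by field.
      rewrite P8, Q8 by assumption; rewrite <- surjective_pairing; apply H9, Hp.
  - intros t Ht; destruct (Hsep Huv t Ht) as [Hu [Hv _]].
    rewrite (proj1 (dif_unique _ _ _ _ (Ds t Ht))), (proj1 (dif_unique _ _ _ _ (Dt t Ht))) in Hu, Hv.
    destruct (Hsq t Ht) as [Z1 Z2]; simpl in Z1, Z2.
    assert (M1 := Na _ Z1). assert (M2 := Nb _ Z2).
    set (k := / rho1 (sigma t)) in *; set (l := / rho2 (tau t)) in *.
    set (A := vel a (sigma t)) in *; set (C := vel b (tau t)) in *.
    assert (EA : dot (vec_u (reparam x Phi1) t) (vec_u (reparam x Phi1) t) = 2 * (k * l * dot A C)).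
    { transitivity (k ^ 2 * dot A A + 2 * (k * l * dot A C) + l ^ 2 * dot C C);
        [unfold dot; rewrite !Hu; ring | rewrite M1, M2; ring]. }
    assert (EC : dot (vec_v (reparam x Phi1) t) (vec_v (reparam x Phi1) t) = - (2 * (k * l * dot A C))).
    { transitivity (k ^ 2 * dot A A - 2 * (k * l * dot A C) + l ^ 2 * dot C C);
        [unfold dot; rewrite !Hv; ring | rewrite M1, M2; ring]. }
    split; [rewrite EA, EC; ring |]; split.
    + transitivity (k ^ 2 * dot A A - l ^ 2 * dot C C);
        [unfold dot; rewrite !Hu, !Hv; ring | rewrite M1, M2; ring].
    + rewrite EA.
      assert (Hng := Hneg _ (Hsq t Ht)); simpl in Hng; fold A C in Hng.
      assert (R1 := N1 _ Z1); assert (R2 := N2 _ Z2).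
      assert (Hkl : k * l * dot A C =
        (rho1 (sigma t) * rho2 (tau t) * dot A C) * (k * l) ^ 2)
        by (unfold k, l; field; split; assumption).
      rewrite Hkl.
      assert (0 < (k * l) ^ 2).
      { apply pow2_gt_0; apply Rmult_integral_contrapositive_currified; apply Rinv_neq_0_compat; assumption. }
      nra.
  - unfold sigma, tau; simpl; f_equal.
    + replace (0 + 0) with (h1 c1) by (rewrite P4; ring).
      apply P8; [| rewrite P4]; rewrite ?Rminus_diag, ?Rabs_R0; assumption.
    + replace (0 - 0) with (h2 c2) by (rewrite Q4; ring).
      apply Q8; [| rewrite Q4]; rewrite ?Rminus_diag, ?Rabs_R0; assumption.
  - intros t Ht; split; [apply Hsq, Ht |]; cbn [fst snd].
    destruct (Hsq t Ht) as [Z1 Z2]; simpl in Z1, Z2.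
    assert (Es := proj1 (dif_unique _ _ _ _ (Ds t Ht))).
    assert (Et := proj1 (dif_unique _ _ _ _ (Dt t Ht))).
    rewrite (separated_invariant V' (reparam x Phi1) sigma tau (c1, c2) e a b); try assumption.
    + rewrite Es, Et; reflexivity.
    + intros q Hq; apply (Hd _ (Hsq q Hq)).
    + apply (Hm _ (Hsq t Ht)).
    + rewrite Es; apply Rinv_neq_0_compat, N1, Z1.
    + rewrite Et; apply Rinv_neq_0_compat, N2, Z2.
Qed.

(** Isothermal coordinates [(u, v)] of negative [E] have the same null lines
    as a null chart [(s, t)], so [u + v] and [u - v] are functions of [s] and
    [t], in one of the two orders. *)
Lemma isothermal_invariant (S : R * R -> Prop) (x : R * R -> vec R) (U : R * R -> Prop)
  (c : R * R) (e : R) (phi psi : R * R -> R * R) (a b : R -> vec R)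
  (U' V' : R * R -> Prop) (Phi1 : R * R -> R * R) (t : R * R) :
  null_chart S x U c e phi psi a b -> local_coords S U' V' Phi1 ->
  isothermal V' (reparam x Phi1) -> V' t -> U (Phi1 t) ->
  exists q k l, square c e q /\ k <> 0 /\ l <> 0 /\
    (Phi'_perp_sq (reparam x Phi1) t =
       split_dnum (acc_sq a (fst q) * k ^ 4) (acc_sq b (snd q) * l ^ 4) \/
     Phi'_perp_sq (reparam x Phi1) t =
       split_dnum (acc_sq b (snd q) * l ^ 4) (acc_sq a (fst q) * k ^ 4)).
Proof.
  intros [(H1 & H2 & H3 & _ & H5 & [H6 H6'] & H7 & H8 & H9) (Ha & Hb & Hd & Na & Nb & Hm)]
    [_ [[HV' _] [_ [[L1 L2] _]]]] Hiso Ht HUt.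
  set (y := reparam x Phi1) in *.
  set (V := fun q => V' q /\ U (fst (Phi1 q), snd (Phi1 q))).
  assert (HV : open V).
  { apply open_preimage; [exact HV' | exact H1 |].
    intros q Hq; split; apply (smooth_cont V'); assumption. }
  assert (HVU : forall q, V q -> U (Phi1 q))
    by (intros q [_ Hq]; rewrite <- surjective_pairing in Hq; exact Hq).
  assert (HVt : V t) by (split; [exact Ht | rewrite <- surjective_pairing; exact HUt]).
  assert (HPhi : smooth_map V Phi1)
    by (split; apply (smooth_sub V'); solve [intros q Hq; apply Hq | assumption]).
  set (sigma := fun q => fst (psi (Phi1 q))). set (tau := fun q => snd (psi (Phi1 q))).
  assert (Ss : smooth_on V sigma)
    by (apply (smooth_comp_map U V (fun p => fst (psi p)) Phi1); assumption).
  assert (St : smooth_on V tau)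
    by (apply (smooth_comp_map U V (fun p => snd (psi p)) Phi1); assumption).
  assert (Hsq : forall q, V q -> square c e (sigma q, tau q)).
  { intros q Hq; unfold sigma, tau; rewrite <- surjective_pairing; apply H7, HVU, Hq. }
  assert (Hy : forall q, V q -> forall i, y q i = a (sigma q) i + b (tau q) i).
  { intros q Hq i; rewrite <- (Hd _ (Hsq q Hq)); unfold sigma, tau.
    rewrite <- surjective_pairing, H9 by (apply HVU, Hq); reflexivity. }
  assert (Dy : forall q, V q -> forall i,
     vec_u y q i = partial_u sigma q * vel a (sigma q) i + partial_u tau q * vel b (tau q) i /\
     vec_v y q i = partial_v sigma q * vel a (sigma q) i + partial_v tau q * vel b (tau q) i).
  { intros q Hq i.
    assert (D : dif (fun r => a (sigma r) i + b (tau r) i) q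
      (vel a (sigma q) i * partial_u sigma q + vel b (tau q) i * partial_u tau q)
      (vel a (sigma q) i * partial_v sigma q + vel b (tau q) i * partial_v tau q)).
    { apply dif_plus.
      - apply (dif_comp1 (fun s => a s i) sigma); [| apply (smooth_dif V); assumption].
        apply (smooth1_is_derive (fst c) e (fun s => a s i)); [apply Ha | apply (Hsq q Hq)].
      - apply (dif_comp1 (fun s => b s i) tau); [| apply (smooth_dif V); assumption].
        apply (smooth1_is_derive (snd c) e (fun s => b s i)); [apply Hb | apply (Hsq q Hq)]. }
    assert (D' : dif (fun r => y r i) q
      (vel a (sigma q) i * partial_u sigma q + vel b (tau q) i * partial_u tau q)
      (vel a (sigma q) i * partial_v sigma q + vel b (tau q) i * partial_v tau q)).
    { apply (dif_ext (fun r => a (sigma r) i + b (tau r) i)); [| exact D].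
      apply (near_imp q V); [intros z Hz; symmetry; apply Hy, Hz | apply open_near; assumption]. }
    destruct (dif_unique _ _ _ _ D') as [R1 R2].
    change (vec_u y q i) with (partial_u (fun r => y r i) q).
    change (vec_v y q i) with (partial_v (fun r => y r i) q).
    rewrite R1, R2; split; ring. }
  assert (Hrel : forall q, V q ->
     (partial_u sigma q + partial_v sigma q) * (partial_u tau q + partial_v tau q) = 0 /\
     (partial_u sigma q - partial_v sigma q) * (partial_u tau q - partial_v tau q) = 0 /\
     partial_u sigma q <> 0 /\ partial_u tau q <> 0).
  { intros q Hq; destruct (Hsq q Hq) as [Z1 Z2]; simpl in Z1, Z2.
    assert (M1 := Na _ Z1). assert (M2 := Nb _ Z2). assert (M3 := Hm _ (Hsq q Hq)).
    cbn [fst snd] in M3.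
    destruct (Hiso q (proj1 Hq)) as [I1 [I2 I3]].
    assert (Hdot : forall w w' z z' : vec R, (forall j, w j = w' j) -> (forall j, z j = z' j) ->
      dot w z = dot w' z').
    { intros w w' z z' A1 A2; unfold dot; rewrite !A1, !A2; reflexivity. }
    assert (Du := fun i => proj1 (Dy q Hq i)). assert (Dv := fun i => proj2 (Dy q Hq i)).
    rewrite (Hdot _ _ _ _ Du Du), (Hdot _ _ _ _ Dv Dv) in I1.
    rewrite (Hdot _ _ _ _ Du Dv) in I2; rewrite (Hdot _ _ _ _ Du Du) in I3.
    set (A := vel a (sigma q)) in *; set (B := vel b (tau q)) in *.
    set (su := partial_u sigma q) in *; set (sv := partial_v sigma q) in *.
    set (tu := partial_u tau q) in *; set (tv := partial_v tau q) in *.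
    assert (X : forall k l k' l', dot (fun i => k * A i + l * B i) (fun i => k' * A i + l' * B i)
       = (k * l' + l * k') * dot A B).
    { intros k l k' l'.
      transitivity (k * k' * dot A A + (k * l' + l * k') * dot A B + l * l' * dot B B);
        [unfold dot; ring | rewrite M1, M2; ring]. }
    change (dot (fun i => su * A i + tu * B i) (fun i => su * A i + tu * B i)
      = - dot (fun i => sv * A i + tv * B i) (fun i => sv * A i + tv * B i)) in I1.
    change (dot (fun i => su * A i + tu * B i) (fun i => sv * A i + tv * B i) = 0) in I2.
    change (dot (fun i => su * A i + tu * B i) (fun i => su * A i + tu * B i) < 0) in I3.
    rewrite !X in I1; rewrite X in I2; rewrite X in I3.
    assert (J2 : su * tv + tu * sv = 0) by (apply Rmult_integral in I2; tauto).
    assert (J1 : su * tu + sv * tv = 0).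
    { apply (Rmult_eq_reg_r (dot A B)); [lra | exact M3]. }
    split; [lra |]; split; [lra |].
    split; intros Hc; rewrite Hc in I3; lra. }
  assert (Hcu := smooth_partial_u V sigma HV Ss). assert (Hcv := smooth_partial_v V sigma HV Ss).
  exists (sigma t, tau t), (partial_u sigma t), (partial_u tau t).
  destruct (Hrel t HVt) as [E1 [E2 [E3 E4]]].
  split; [apply Hsq, HVt |]; split; [exact E3 |]; split; [exact E4 |]; cbn [fst snd].
  destruct (Req_dec (partial_u sigma t + partial_v sigma t) 0) as [Hz | Hz].
  - right.
    assert (Hz' : partial_u sigma t - partial_v sigma t <> 0) by lra.
    set (V2 := fun q => V q /\ partial_u sigma q - partial_v sigma q <> 0).
    assert (HV2 : open V2).
    { apply near_open; intros q [Q1 Q2]; apply near_and; [apply open_near; assumption |].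
      apply (cont_neq0 (fun q => partial_u sigma q - partial_v sigma q)); [| exact Q2].
      apply (smooth_cont V); [apply smooth_minus; assumption | exact Q1]. }
    apply (separated_invariant V2 y tau sigma (snd c, fst c) e b a); try assumption.
    + apply (smooth_sub V); [intros q Hq; apply Hq | exact St].
    + apply (smooth_sub V); [intros q Hq; apply Hq | exact Ss].
    + intros q [Hq _]; destruct (Hsq q Hq); split; assumption.
    + intros q [Hq _] i; rewrite Hy by exact Hq; ring.
    + intros q [Hq Q2]; destruct (Hrel q Hq) as [F1 [F2 [F3 F4]]].
      apply Rmult_integral in F2; destruct F2 as [F2 | F2]; [contradiction |].
      apply Rmult_integral in F1; destruct F1 as [F1 | F1]; split; lra.
    + split; assumption.
    + rewrite dot_sym; apply (Hm _ (Hsq t HVt)).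
  - left.
    set (V2 := fun q => V q /\ partial_u sigma q + partial_v sigma q <> 0).
    assert (HV2 : open V2).
    { apply near_open; intros q [Q1 Q2]; apply near_and; [apply open_near; assumption |].
      apply (cont_neq0 (fun q => partial_u sigma q + partial_v sigma q)); [| exact Q2].
      apply (smooth_cont V); [apply smooth_plus; assumption | exact Q1]. }
    apply (separated_invariant V2 y sigma tau c e a b); try assumption.
    + apply (smooth_sub V); [intros q Hq; apply Hq | exact Ss].
    + apply (smooth_sub V); [intros q Hq; apply Hq | exact St].
    + intros q [Hq _]; apply Hsq, Hq.
    + intros q [Hq _]; apply Hy, Hq.
    + intros q [Hq Q2]; destruct (Hrel q Hq) as [F1 [F2 [F3 F4]]].
      apply Rmult_integral in F1; destruct F1 as [F1 | F1]; [contradiction |].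
      apply Rmult_integral in F2; destruct F2 as [F2 | F2]; split; lra.
    + split; assumption.
    + apply (Hm _ (Hsq t HVt)).
Qed.

(** * The type of a surface of general type *)

Inductive dtype := First | Second | Third.

Definition has_type (ty : dtype) (w : dnum) : Prop :=
  match ty with
  | First => D_plus w
  | Second => D_plus (- w)%DN
  | Third => D_plus (dj * w)%DN \/ D_plus (- (dj * w))%DN
  end.

Definition sign_type (ea eb : R) : dtype :=
  if Rlt_dec (ea * eb) 0 then Third else if Rlt_dec 0 ea then First else Second.

Definition unit_sign (s : R) : Prop := s = 1 \/ s = -1.

Lemma unit_sign_of (z : R) : z <> 0 -> exists s, unit_sign s /\ 0 < s * z.
Proof.
  intros Hz; destruct (Rtotal_order z 0) as [H | [H | H]]; [| contradiction |].
  - exists (-1); split; [right; reflexivity | lra].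
  - exists 1; split; [left; reflexivity | lra].
Qed.

Lemma has_type_unique (ty ty' : dtype) (w : dnum) :
  has_type ty w -> has_type ty' w -> ty = ty'.
Proof.
  destruct w as [p q]; unfold has_type, D_plus, dnorm2, dopp, dmul, dj.
  destruct ty, ty'; simpl; intros H H'; try reflexivity; exfalso; nra.
Qed.

Lemma sign_type_split (ea eb A B : R) : unit_sign ea -> unit_sign eb ->
  0 < ea * A -> 0 < eb * B -> has_type (sign_type ea eb) (split_dnum A B).
Proof.
  intros Ha Hb HA HB; unfold sign_type.
  destruct (Rlt_dec (ea * eb) 0) as [H | H]; [| destruct (Rlt_dec 0 ea) as [H' | H']];
    unfold has_type, D_plus, dnorm2, split_dnum, dopp, dmul, dj; simpl;
    destruct Ha as [-> | ->], Hb as [-> | ->]; try lra; try (split; nra).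
  - left; split; nra.
  - right; split; nra.
Qed.

Lemma sign_type_sym (ea eb : R) : unit_sign ea -> unit_sign eb ->
  sign_type eb ea = sign_type ea eb.
Proof.
  intros [-> | ->] [-> | ->]; unfold sign_type; try reflexivity;
    repeat destruct Rlt_dec; try reflexivity; lra.
Qed.

Lemma mult_pow4_pos (s z k : R) : 0 < s * z -> k <> 0 -> 0 < s * (z * k ^ 4).
Proof.
  intros H Hk; replace (s * (z * k ^ 4)) with (s * z * (k ^ 2 * k ^ 2)) by ring.
  apply Rmult_lt_0_compat; [exact H | apply Rmult_lt_0_compat; apply pow2_gt_0, Hk].
Qed.

(** A null chart on which the two components of the invariant, and the scalar
    product of the null tangent vectors, have constant signs. *)
Definition sign_chart (S : R * R -> Prop) (x : R * R -> vec R) (U : R * R -> Prop)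
  (c : R * R) (e : R) (phi psi : R * R -> R * R) (a b : R -> vec R) (ea eb k : R) : Prop :=
  null_chart S x U c e phi psi a b /\ unit_sign ea /\ unit_sign eb /\ unit_sign k /\
  (forall s, Rabs (s - fst c) < e -> 0 < ea * acc_sq a s) /\
  (forall s, Rabs (s - snd c) < e -> 0 < eb * acc_sq b s) /\
  (forall q, square c e q -> k * dot (vel a (fst q)) (vel b (snd q)) < 0).

Lemma sign_chart_swap (S : R * R -> Prop) (x : R * R -> vec R) (U : R * R -> Prop)
  (c : R * R) (e : R) (phi psi : R * R -> R * R) (a b : R -> vec R) (ea eb k : R) :
  sign_chart S x U c e phi psi a b ea eb k ->
  sign_chart S x U (snd c, fst c) e (fun q => phi (snd q, fst q))
    (fun p => (snd (psi p), fst (psi p))) b a eb ea k.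
Proof.
  intros (H & Ha & Hb & Hk & Pa & Pb & Hm).
  split; [apply null_chart_swap, H |].
  repeat (split; [assumption |]).
  intros q [Q1 Q2]; rewrite dot_sym; apply (Hm (snd q, fst q)); split; assumption.
Qed.

Lemma vel_smooth_fst (c : R * R) (e : R) (a : R -> vec R) :
  (forall j, smooth1 (fst c) e (fun s => a s j)) ->
  vec_smooth (square c e) (fun q => vel a (fst q)) /\
  vec_smooth (square c e) (fun q => vel (vel a) (fst q)).
Proof.
  intros Ha; split; intros i; apply (smooth_sub (strip (fst c) e)); try (intros q Hq; apply Hq).
  - apply (vel_smooth1 (fst c) e a i Ha).
  - apply (vel_smooth1 (fst c) e (vel a) i); intros j; apply vel_smooth1, Ha.
Qed.

Lemma vel_smooth_snd (c : R * R) (e : R) (b : R -> vec R) :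
  (forall j, smooth1 (snd c) e (fun s => b s j)) ->
  vec_smooth (square c e) (fun q => vel b (snd q)) /\
  vec_smooth (square c e) (fun q => vel (vel b) (snd q)).
Proof.
  intros Hb.
  assert (T : forall f, smooth1 (snd c) e f -> smooth_on (square c e) (fun q => f (snd q))).
  { intros f Hf; apply (smooth1_comp (snd c) e f (square c e)); try assumption.
    - apply open_square.
    - intros q Hq; apply Hq.
    - apply smooth_snd, open_square. }
  split; intros i.
  - apply (T (fun s => vel b s i)), vel_smooth1, Hb.
  - apply (T (fun s => vel (vel b) s i)), vel_smooth1; intros j; apply vel_smooth1, Hb.
Qed.

(** The null chart yields isothermal coordinates, to which the hypothesis of
    general type applies: both [acc_sq a] and [acc_sq b] are nonzero, hence of
    constant sign on a smaller square. *)
Lemma exists_sign_chart (S : R * R -> Prop) (x : R * R -> vec R) (p : R * R) :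
  timelike_surface S x -> minimal S x -> general_type S x -> S p ->
  exists U c e phi psi a b ea eb k,
    U p /\ psi p = c /\ sign_chart S x U c e phi psi a b ea eb k.
Proof.
  intros Ht Hmin Hgen Hp.
  destruct (exists_null_chart S x p Ht Hmin Hp)
    as (U & c & e & phi & psi & a & b & HU & Hc & HN).
  assert (HN' := HN).
  destruct HN' as [(_ & He & _) (Ha & Hb & _ & _ & _ & Hm)].
  assert (HO := open_square c e). assert (Hcc := square_center c e He).
  destruct (vel_smooth_fst c e a Ha) as [Sa Sa2]. destruct (vel_smooth_snd c e b Hb) as [Sb Sb2].
  assert (Hmc := smooth_cont _ _ c (smooth_dot _ _ _ HO Sa Sb) Hcc).
  assert (Hac := smooth_cont _ _ c (smooth_dot _ _ _ HO Sa2 Sa2) Hcc).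
  assert (Hbc := smooth_cont _ _ c (smooth_dot _ _ _ HO Sb2 Sb2) Hcc).
  assert (Hcontinue : forall s (f : R * R -> R), cont f c -> 0 < s * f c ->
     near c (fun q => 0 < s * f q)).
  { intros s f Hf; apply (cont_pos (fun q => s * f q)), cont_mult; [apply cont_const | exact Hf]. }
  destruct (unit_sign_of _ (Hm c Hcc)) as [k0 [Hk0 Hk0m]].
  assert (Hk : unit_sign (- k0)) by (destruct Hk0 as [-> | ->]; [right | left]; ring).
  destruct (proj1 (near_square _ _) (near_and _ _ _ (open_near _ _ HO Hcc) (Hcontinue _ _ Hmc Hk0m)))
    as [e1' [He1' Hneg']].
  set (e1 := Rmin e e1').
  assert (He1 : 0 < e1) by (apply Rmin_glb_lt; assumption).
  assert (Hle1 : e1 <= e) by apply Rmin_l. assert (Hle1' : e1 <= e1') by apply Rmin_r.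
  assert (Hneg : forall q, square c e1 q -> - k0 * dot (vel a (fst q)) (vel b (snd q)) < 0).
  { intros q Hq; assert (T := proj2 (Hneg' q (square_sub _ _ _ _ Hle1' Hq))); lra. }
  assert (HN1 := null_chart_shrink _ _ _ _ _ _ _ _ _ _ HN He1 Hle1).
  destruct (chart_of_null_chart _ _ _ _ _ _ _ _ _ (fun _ => - k0) (fun _ => 1) HN1)
    as (U' & V' & Phi1 & T & _ & HL & HI & H0 & HT0 & HT).
  - apply smooth1_const.
  - apply smooth1_const.
  - intros q Hq; rewrite Rmult_1_r; apply Hneg, Hq.
  - assert (G := Hgen U' V' Phi1 HL HI (0, 0) H0).
    rewrite (proj2 (HT (0, 0) H0)), HT0 in G.
    assert (A0 : acc_sq a (fst c) <> 0).
    { intros Hz; apply G; unfold D_zero, dnorm2, split_dnum; simpl; rewrite Hz; ring. }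
    assert (B0 : acc_sq b (snd c) <> 0).
    { intros Hz; apply G; unfold D_zero, dnorm2, split_dnum; simpl; rewrite Hz; ring. }
    destruct (unit_sign_of _ A0) as [ea [Hea HA]]. destruct (unit_sign_of _ B0) as [eb [Heb HB]].
    destruct (proj1 (near_square _ _) (near_and _ _ _ (Hcontinue _ _ Hac HA) (Hcontinue _ _ Hbc HB)))
      as [e2' [He2' Hab]].
    set (e2 := Rmin e1 e2').
    assert (He2 : 0 < e2) by (apply Rmin_glb_lt; assumption).
    assert (Hle2 : e2 <= e1) by apply Rmin_l. assert (Hle2' : e2 <= e2') by apply Rmin_r.
    assert (HN2 := null_chart_shrink _ _ _ _ _ _ _ _ _ _ HN1 He2 Hle2).
    do 10 eexists; split; [| split; [| split; [exact HN2 |]]].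
    + split; [split; [exact HU |] |]; rewrite Hc; apply square_center; assumption.
    + exact Hc.
    + split; [exact Hea |]; split; [exact Heb |]; split; [exact Hk |].
      assert (Hself : forall z, Rabs (z - z) < e2)
        by (intros z; rewrite Rminus_diag, Rabs_R0; exact He2).
      split; [| split].
      * intros s Hs; apply (Hab (s, snd c)), (square_sub _ _ e2); [exact Hle2' |].
        split; [exact Hs | apply Hself].
      * intros s Hs; apply (Hab (fst c, s)), (square_sub _ _ e2); [exact Hle2' |].
        split; [apply Hself | exact Hs].
      * intros q Hq; apply Hneg, (square_sub _ _ e2); assumption.
Qed.

(** The factors [k ^ 4] and [l ^ 4] of the invariant are positive, and the
    possible exchange of its components does not affect the type. *)
Lemma sign_chart_type (S : R * R -> Prop) (x : R * R -> vec R) (U : R * R -> Prop)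
  (c : R * R) (e : R) (phi psi : R * R -> R * R) (a b : R -> vec R) (ea eb k : R)
  (U' V' : R * R -> Prop) (Phi1 : R * R -> R * R) (t : R * R) :
  sign_chart S x U c e phi psi a b ea eb k -> local_coords S U' V' Phi1 ->
  isothermal V' (reparam x Phi1) -> V' t -> U (Phi1 t) ->
  has_type (sign_type ea eb) (Phi'_perp_sq (reparam x Phi1) t).
Proof.
  intros (HN & Hea & Heb & Hk & Ha & Hb & _) HL HI Ht HU.
  destruct (isothermal_invariant _ _ _ _ _ _ _ _ _ _ _ _ _ HN HL HI Ht HU)
    as (q & m & l & [Q1 Q2] & Hm & Hl & H).
  assert (PA := mult_pow4_pos _ _ _ (Ha _ Q1) Hm).
  assert (PB := mult_pow4_pos _ _ _ (Hb _ Q2) Hl).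
  destruct H as [-> | ->].
  - apply sign_type_split; assumption.
  - rewrite <- sign_type_sym by assumption; apply sign_type_split; assumption.
Qed.

Lemma fourth_root (z : R) : 0 < z -> sqrt (sqrt z) ^ 4 = z.
Proof.
  intros Hz; assert (H := sqrt_lt_R0 z Hz).
  transitivity ((sqrt (sqrt z) * sqrt (sqrt z)) * (sqrt (sqrt z) * sqrt (sqrt z))); [ring |].
  rewrite !sqrt_sqrt by lra; reflexivity.
Qed.

Definition type_value (ty : dtype) : dnum :=
  match ty with First => RtoD 1 | Second => RtoD (-1) | Third => dj end.

(** The null parameters with densities [(4 |a''^2|)^(1/4)] and
    [(4 |b''^2|)^(1/4)] make [a''^2] and [b''^2] equal to [1 / 4] up to sign;
    the factor [k] in the second density gives [E] the negative sign. The
    hypothesis [eb <= ea] excludes the value [- j]. *)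
Lemma canonical_chart (S : R * R -> Prop) (x : R * R -> vec R) (U : R * R -> Prop)
  (c : R * R) (e : R) (phi psi : R * R -> R * R) (a b : R -> vec R) (ea eb k : R) (p : R * R) :
  sign_chart S x U c e phi psi a b ea eb k -> eb <= ea -> U p -> psi p = c ->
  exists (U' V' : R * R -> Prop) (Phi1 : R * R -> R * R),
    U' p /\ local_coords S U' V' Phi1 /\ isothermal V' (reparam x Phi1) /\
    forall t, V' t -> Phi'_perp_sq (reparam x Phi1) t = type_value (sign_type ea eb).
Proof.
  intros (HN & Hea & Heb & Hk & Pa & Pb & Hm) Hle HU Hc.
  assert (HN' := HN); destruct HN' as [_ (Ha & Hb & _)].
  set (r1 := fun s => sqrt (sqrt (4 * ea * acc_sq a s))).
  set (r2 := fun s => k * sqrt (sqrt (4 * eb * acc_sq b s))).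
  assert (Hpos : forall s z, 0 < s * z -> 0 < sqrt (sqrt (4 * s * z))).
  { intros s z Hz; apply sqrt_lt_R0, sqrt_lt_R0; lra. }
  assert (Hroot : forall (c0 : R) (g : R -> vec R) s, (forall i, smooth1 c0 e (fun r => g r i)) ->
    (forall r, Rabs (r - c0) < e -> 0 < s * acc_sq g r) ->
    smooth1 c0 e (fun r => sqrt (sqrt (4 * s * acc_sq g r)))).
  { intros c0 g s Hg Hs.
    assert (HO := open_strip_fst c0 e).
    assert (Hacc : smooth_on (strip c0 e) (fun q => 4 * s * acc_sq g (fst q))).
    { apply (smooth_mult (strip c0 e) (fun _ => 4 * s)); [exact HO | apply smooth_const, HO |].
      assert (Hv : vec_smooth (strip c0 e) (fun q => vel (vel g) (fst q))).
      { intros i; apply (vel_smooth1 c0 e (vel g) i); intros j; apply vel_smooth1, Hg. }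
      apply (smooth_dot _ _ _ HO Hv Hv). }
    apply (smooth_sqrt (strip c0 e) (fun q => sqrt (4 * s * acc_sq g (fst q))) HO).
    - intros q Hq; specialize (Hs _ Hq); apply sqrt_lt_R0; lra.
    - apply (smooth_sqrt (strip c0 e) (fun q => 4 * s * acc_sq g (fst q)) HO); [| exact Hacc].
      intros q Hq; specialize (Hs _ Hq); lra. }
  destruct (chart_of_null_chart _ _ _ _ _ _ _ _ _ r1 r2 HN)
    as (U' & V' & Phi1 & T & HU' & HL & HI & _ & _ & HT).
  - apply (Hroot (fst c) a ea Ha Pa).
  - apply (smooth_mult (strip (snd c) e) (fun _ => k)); [| apply smooth_const |];
      try apply open_strip_fst.
    apply (Hroot (snd c) b eb Hb Pb).
  - intros q Hq.
    assert (Z1 := Hpos _ _ (Pa _ (proj1 Hq))). assert (Z2 := Hpos _ _ (Pb _ (proj2 Hq))).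
    assert (Z3 := Hm q Hq).
    assert (Z4 : 0 < r1 (fst q) * sqrt (sqrt (4 * eb * acc_sq b (snd q))))
      by (apply Rmult_lt_0_compat; assumption).
    replace (_ * _ * _) with (r1 (fst q) * sqrt (sqrt (4 * eb * acc_sq b (snd q)))
       * (k * dot (vel a (fst q)) (vel b (snd q)))) by (unfold r2; ring).
    nra.
  - exists U', V', Phi1; split; [apply HU'; assumption |].
    split; [exact HL |]; split; [exact HI |].
    intros t Ht; destruct (HT t Ht) as [[T1 T2] ->].
    assert (Z1 := Pa _ T1). assert (Z2 := Pb _ T2).
    assert (Hk4 : k ^ 4 = 1) by (destruct Hk as [-> | ->]; ring).
    assert (E1 : r1 (fst (T t)) ^ 4 = 4 * ea * acc_sq a (fst (T t)))
      by (apply fourth_root; lra).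
    assert (E2 : r2 (snd (T t)) ^ 4 = 4 * eb * acc_sq b (snd (T t))).
    { unfold r2; rewrite Rpow_mult_distr, Hk4, Rmult_1_l; apply fourth_root; lra. }
    rewrite !pow_inv, E1, E2.
    assert (N1 : acc_sq a (fst (T t)) <> 0) by (intros Hz; rewrite Hz in Z1; lra).
    assert (N2 : acc_sq b (snd (T t)) <> 0) by (intros Hz; rewrite Hz in Z2; lra).
    unfold split_dnum, sign_type.
    destruct Hea as [-> | ->], Heb as [-> | ->]; repeat destruct Rlt_dec; try lra;
      unfold type_value, RtoD, dj; f_equal; field; split; assumption.
Qed.

Lemma exists_ordered_sign_chart (S : R * R -> Prop) (x : R * R -> vec R) (p : R * R) :
  timelike_surface S x -> minimal S x -> general_type S x -> S p ->
  exists U c e phi psi a b ea eb k,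
    U p /\ psi p = c /\ sign_chart S x U c e phi psi a b ea eb k /\ eb <= ea.
Proof.
  intros hx hmin hgen Hp.
  destruct (exists_sign_chart S x p hx hmin hgen Hp)
    as (U & c & e & phi & psi & a & b & ea & eb & k & HU & Hc & HC).
  destruct (Rle_lt_dec eb ea) as [Hle | Hlt].
  - exists U, c, e, phi, psi, a, b, ea, eb, k; auto.
  - do 10 eexists; split; [exact HU |].
    split; [| split; [apply (sign_chart_swap _ _ _ _ _ _ _ _ _ _ _ _ HC) | lra]].
    simpl; rewrite Hc; reflexivity.
Qed.

(** A sign chart forces one type on its whole domain, so every point has a
    neighbourhood with a single type. Two different types cannot meet at a
    point, because an isothermal chart around it has only one value there; the
    sets of points of given type are therefore open and disjoint, and the
    connected surface lies in one of them. *)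
Lemma type_constant (S : R * R -> Prop) (x : R * R -> vec R) (U : R * R -> Prop)
  (c : R * R) (e : R) (phi psi : R * R -> R * R) (a b : R -> vec R) (ea eb k : R) (p : R * R) :
  timelike_surface S x -> minimal S x -> general_type S x -> S p ->
  sign_chart S x U c e phi psi a b ea eb k -> U p ->
  Phi'_perp_sq_in S x (has_type (sign_type ea eb)).
Proof.
  intros hx hmin hgen Hp HC HU; set (ty := sign_type ea eb).
  set (O := fun s q => exists W, open W /\ W q /\
    forall U1 V1 phi1, local_coords S U1 V1 phi1 -> isothermal V1 (reparam x phi1) ->
    forall t, V1 t -> W (phi1 t) -> has_type s (Phi'_perp_sq (reparam x phi1) t)).
  assert (Hsign : forall U c e phi psi a b ea eb k q,
    sign_chart S x U c e phi psi a b ea eb k -> U q -> O (sign_type ea eb) q).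
  { intros W c1 e1 phi1 psi1 a1 b1 ea1 eb1 k1 q H1 Hq; exists W.
    split; [apply H1 |]; split; [exact Hq |].
    intros U1 V1 phi2 L1 I1 t Ht HWt.
    apply (sign_chart_type _ _ _ _ _ _ _ _ _ _ _ _ _ _ _ _ H1 L1 I1 Ht HWt). }
  assert (HOopen : forall s, open (O s)).
  { intros s; apply near_open; intros q (W & W1 & W2 & W3).
    apply (near_imp q W); [intros z Hz; exists W; auto | apply open_near; assumption]. }
  assert (Hcover : forall q, S q -> exists s, O s q).
  { intros q Hq; destruct (exists_sign_chart S x q hx hmin hgen Hq)
      as (W & c1 & e1 & phi1 & psi1 & a1 & b1 & ea1 & eb1 & k1 & HW & _ & H1).
    exists (sign_type ea1 eb1); apply (Hsign _ _ _ _ _ _ _ _ _ _ _ H1 HW). }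
  assert (Hdisj : forall s s' q, S q -> O s q -> O s' q -> s = s').
  { intros s s' q Hq (W & _ & Wq & HW) (W' & _ & Wq' & HW').
    destruct (exists_ordered_sign_chart S x q hx hmin hgen Hq)
      as (W1 & c1 & e1 & phi1 & psi1 & a1 & b1 & ea1 & eb1 & k1 & HW1 & Hc1 & H1 & Hle).
    destruct (canonical_chart _ _ _ _ _ _ _ _ _ _ _ _ q H1 Hle HW1 Hc1)
      as (U1 & V1 & phi2 & K1 & K2 & K3 & _).
    assert (K2' := K2); destruct K2' as (_ & _ & _ & _ & _ & psi2 & _ & P2 & _ & P4).
    assert (E : phi2 (psi2 q) = q) by (apply P4, K1).
    apply (has_type_unique _ _ (Phi'_perp_sq (reparam x phi2) (psi2 q))).
    - apply (HW _ _ _ K2 K3); [apply P2, K1 | rewrite E; exact Wq].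
    - apply (HW' _ _ _ K2 K3); [apply P2, K1 | rewrite E; exact Wq']. }
  assert (HOp : O ty p) by (apply (Hsign _ _ _ _ _ _ _ _ _ _ _ HC HU)).
  assert (Hall : forall q, S q -> O ty q).
  { intros q Hq; destruct (Hcover q Hq) as [s Hs].
    apply NNPP; intros Hno.
    destruct hx as [[_ Hconn] _].
    destruct (Hconn (O ty) (fun z => exists s, s <> ty /\ O s z))
      as (z & Z1 & Z2 & s' & Z3 & Z4).
    - apply HOopen.
    - apply near_open; intros z (s' & N1 & N2).
      apply (near_imp z (O s')); [intros w Hw; exists s'; auto |].
      apply open_near; [apply HOopen | exact N2].
    - intros z Hz; destruct (Hcover z Hz) as [s' Hs'].
      destruct (classic (s' = ty)) as [-> | Hne]; [left; exact Hs' | right; exists s'; auto].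
    - exists p; auto.
    - exists q; split; [exact Hq |]; exists s; split; [| exact Hs].
      intros ->; contradiction.
    - apply Z3, (Hdisj _ _ z Z1 Z4 Z2). }
  intros U1 V1 phi1 L1 I1 t Ht.
  assert (Hst : S (phi1 t)).
  { destruct L1 as (_ & _ & K1 & _ & K2 & _); apply K1, K2, Ht. }
  destruct (Hall _ Hst) as (W & _ & Wt & HW); apply (HW _ _ _ L1 I1 t Ht Wt).
Qed.

Theorem theorem6p6 (S : R * R -> Prop) (x : R * R -> vec R)
  (hx : timelike_surface S x) (hmin : minimal S x) (hgen : general_type S x) :
  forall p : R * R, S p ->
    exists (U V : R * R -> Prop) (phi : R * R -> R * R),
      U p /\ local_coords S U V phi /\ canonical S x V phi.
Proof.
  intros p Hp.
  destruct (exists_ordered_sign_chart S x p hx hmin hgen Hp)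
    as (U & c & e & phi & psi & a & b & ea & eb & k & HU & Hc & HC & Hle).
  destruct (canonical_chart _ _ _ _ _ _ _ _ _ _ _ _ p HC Hle HU Hc)
    as (U' & V' & Phi1 & HU' & HL & HI & HV).
  assert (Hty := type_constant _ _ _ _ _ _ _ _ _ _ _ _ p hx hmin hgen Hp HC HU).
  exists U', V', Phi1; split; [exact HU' |]; split; [exact HL |]; split; [exact HI |].
  exists (type_value (sign_type ea eb)); split; [| exact HV].
  destruct (sign_type ea eb); [left | right; left | right; right];
    split; try reflexivity; exact Hty.
Qed.
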